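(* Let $(L,e)$ be a Nijenhuis operator with a unity on a manifold $\mathsf M^n$ such that $L$ is $\mathrm{gl}$-regular. Let $\mathsf p\in\mathsf M^n$ be an algebraically generic point for $L$ such that $L(\mathsf p)$ has either one real eigenvalue or two complex conjugate eigenvalues. (a) If $L(\mathsf p)$ has a single real eigenvalue $\lambda_0$, then in a neighbourhood of $\mathsf p$ there exists a unique local coordinate system $(u^1,\dots,u^n)$ centred at $\mathsf p$ such that $e=\frac{\partial}{\partial u^1}$ and $$L=\begin{pmatrix} u^1+\lambda_0&&&&& \\ u^2+1&u^1+\lambda_0&&&& \\ u^3&\ddots&\ddots&&& \\ \vdots&\ddots&\ddots&\ddots&& \\ u^{n-1}&&\ddots&\ddots&u^1+\lambda_0& \\ u^n&u^{n-1}&\cdots&u^3&u^2+1&u^1+\lambda_0 \end{pmatrix},$$ i.e. $L$ is the lower triangular Toeplitz matrix with $L^i_i=u^1+\lambda_0$, $L^{i}_{i-1}=u^2+1$, $L^i_j=u^{i-j+1}$ for $i-j\ge2$, and $L^i_j=0$ for $i<j$. (b) If $L(\mathsf p)$ has two complex conjugate eigenvalues $\mu_0,\bar\mu_0$, $\mu_0=a_0+ib_0$, then, with $n=2s$, in a neighbourhood of $\mathsf p$ there exists a unique local coordinate system $(x^1,y^1,\dots,x^s,y^s)$ centred at $\mathsf p$ such that $e=\frac{\partial}{\partial x^1}$ and $$L=\begin{pmatrix} C^1+\Lambda_0&&&&& \\ C^2+I&C^1+\Lambda_0&&&& \\ C^3&\ddots&\ddots&&& \\ \vdots&\ddots&\ddots&\ddots&&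 \\ C^{s-1}&&\ddots&\ddots&C^1+\Lambda_0& \\ C^s&C^{s-1}&\cdots&C^3&C^2+I&C^1+\Lambda_0 \end{pmatrix},$$ i.e. $L$ is the lower triangular block Toeplitz matrix with $2\times 2$ blocks equal to $C^1+\Lambda_0$ on the diagonal, $C^2+I$ in positions $(i,i-1)$, $C^{i-j+1}$ in positions $(i,j)$ with $i-j\ge2$, and zero blocks above the diagonal, where $$C^p=\begin{pmatrix} x^p&-y^p \\ y^p&x^p \end{pmatrix}\ (1\le p\le s),\qquad\Lambda_0=\begin{pmatrix} a_0&-b_0 \\ b_0&a_0 \end{pmatrix},\qquad I=\begin{pmatrix} 1&0 \\ 0&1 \end{pmatrix}.$$
   Context: Smooth or real-analytic category. For an operator field (field of endomorphisms of $T\mathsf M^n$) $L$, the Nijenhuis torsion is $\mathcal N_L(\xi,\eta)=[L\xi,L\eta]+L^2[\xi,\eta]-L[L\xi,\eta]-L[\xi,L\eta]$; $L$ is a Nijenhuis operator if $\mathcal N_L=0$. A pair $(L,e)$ is a Nijenhuis operator with a unity if $L$ is Nijenhuis and the vector field $e$ satisfies $\mathcal L_eL=\mathrm{Id}$. A linear operator is $\mathrm{gl}$-regular if each of its (complex) eigenvalues has exactly one Jordan block; an operator field is $\mathrm{gl}$-regular if it is so at every point. A point is algebraically generic for $L$ if the Segre characteristic of $L$ (number of distinct eigenvalues and sizes of the Jordan blocks belonging to each) is constant in a neighbourhood of it. Matrices: $L\frac{\partial}{\partial u^j}=\sum_iL^i_j\frac{\partial}{\partial u^i}$, $i$ = row,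 $j$ = column. A coordinate system is centred at $\mathsf p$ if all coordinates vanish at $\mathsf p$; uniqueness is understood for germs at $\mathsf p$. *)

(* Defs.v *)
From HB Require Import structures.
From mathcomp Require Import all_boot all_order all_algebra.
From mathcomp Require Import complex.
From mathcomp Require Import all_classical all_reals all_analysis.

Set Implicit Arguments.
Unset Strict Implicit.
Unset Printing Implicit Defensive.

Import Order.TTheory GRing.Theory Num.Theory.
Import numFieldNormedType.Exports.

Local Open Scope classical_set_scope.
Local Open Scope ring_scope.

Inductive category := Smooth | RealAnalytic.

Section Functions.
Variables (R : realType) (n : nat).

Fixpoint Ck (k : nat) (U : set 'cV[R]_n) (f : 'cV[R]_n -> R) : Prop :=
  (forall x, U x -> {for x, continuous f}) /\
  match k with
  | 0 => True
  | k'.+1 => forall i : 'I_n,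
      (forall x, U x -> derivable f x (delta_mx i 0)) /\
      Ck k' U ('D_(delta_mx i 0) f)
  end.

Definition monomial (c : {ffun 'I_n -> nat} -> R) (h : 'cV[R]_n)
    (a : {ffun 'I_n -> nat}) : R :=
  c a * \prod_(i < n) h i 0 ^+ a i.

(* The multi-indices are exhausted by the cubes {0, ..., N-1}^n; as absolute
   convergence is required, the choice of the exhaustion is immaterial. *)
Definition analytic_at (f : 'cV[R]_n -> R) (x : 'cV[R]_n) : Prop :=
  exists (c : {ffun 'I_n -> nat} -> R) (r : R), 0 < r /\
    forall h : 'cV[R]_n, `|h| < r ->
      cvgn (fun N => \sum_(a : {ffun 'I_n -> 'I_N})
                       `|monomial c h [ffun i => a i : nat]| : R^o) /\
      (fun N => \sum_(a : {ffun 'I_n -> 'I_N})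
                  monomial c h [ffun i => a i : nat] : R^o) @ \oo --> f (x + h).

Definition class_on (cat : category) (U : set 'cV[R]_n) (f : 'cV[R]_n -> R) :
    Prop :=
  match cat with
  | Smooth => forall k, Ck k U f
  | RealAnalytic => forall x, U x -> analytic_at f x
  end.

Definition mx_class_on (cat : category) (U : set 'cV[R]_n) (m k : nat)
    (F : 'cV[R]_n -> 'M[R]_(m, k)) : Prop :=
  forall i j, class_on cat U (fun x => F x i j).

End Functions.

(* [param] is the inverse of [coord]; the values of [coord] outside [dom] and
   of [param] outside [coord @` dom] are irrelevant. *)
Record chart (R : realType) (n : nat) (M : topologicalType) := Chart {
  dom : set M;
  coord : M -> 'cV[R]_n;
  param : 'cV[R]_n -> M
}.

Section Charts.
Variables (R : realType) (cat : category) (n : nat) (M : topologicalType).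
Implicit Types c : chart R n M.

Definition is_chart c : Prop :=
  [/\ open (dom c), open (coord c @` dom c),
      forall q, dom c q -> param c (coord c q) = q,
      forall q, dom c q -> {for q, continuous (coord c)} &
      forall x, (coord c @` dom c) x -> {for x, continuous (param c)}].

Definition transition c c' : 'cV[R]_n -> 'cV[R]_n := coord c' \o param c.

Definition compatible c c' : Prop :=
  mx_class_on cat (coord c @` (dom c `&` dom c')) (transition c c') /\
  mx_class_on cat (coord c' @` (dom c `&` dom c')) (transition c' c).

End Charts.

Record manifold (R : realType) (cat : category) (n : nat) := Manifold {
  carrier :> topologicalType;
  atlas : set (chart R n carrier);
  manifold_hausdorff : hausdorff_space carrier;
  manifold_second_countable : @second_countable carrier;
  atlas_chart : forall c, atlas c -> is_chart c;
  atlas_cover : forall q : carrier, exists2 c, atlas c & dom c q;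
  atlas_compatible : forall c c', atlas c -> atlas c' -> compatible cat c c'
}.

Section Fields.
Variables (R : realType) (cat : category) (n : nat) (M : manifold R cat n).
Implicit Types (c u : chart R n M) (q p : M) (W : set M).

(* The local coordinate systems of M, i.e. the maximal atlas. *)
Definition charts : set (chart R n M) :=
  [set c | is_chart c /\ forall c', atlas c' -> compatible cat c c'].

(* Tensor fields are given by their components in every local coordinate
   system: [xi c q] is the column of the components of xi at q with respect to
   c, and similarly for matrices of operator fields. *)
Definition vfamily := chart R n M -> M -> 'cV[R]_n.
Definition ofamily := chart R n M -> M -> 'M[R]_n.
Implicit Types (xi eta e : vfamily) (L : ofamily).

(* The Jacobian matrix at q of the change of coordinates from c to c',
   applied to v. *)
Definition change_of_components c c' q (v : 'cV[R]_n) : 'cV[R]_n :=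
  'D_v (transition c c') (coord c q).

Definition vector_field W xi : Prop :=
  forall c, charts c ->
    mx_class_on cat (coord c @` (dom c `&` W)) (xi c \o param c) /\
    forall c', charts c' -> forall q, dom c q -> dom c' q -> W q ->
      xi c' q = change_of_components c c' q (xi c q).

Definition operator_field L : Prop :=
  forall c, charts c ->
    mx_class_on cat (coord c @` dom c) (L c \o param c) /\
    forall c', charts c' -> forall q, dom c q -> dom c' q -> forall v,
      L c' q *m change_of_components c c' q v =
      change_of_components c c' q (L c q *m v).

Definition apply_field L xi : vfamily := fun c q => L c q *m xi c q.

(* [xi, eta]^i = xi^j d_j eta^i - eta^j d_j xi^i *)
Definition bracket xi eta : vfamily := fun c q =>
  'D_(xi c q) (eta c \o param c) (coord c q) -
  'D_(eta c q) (xi c \o param c) (coord c q).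

Definition nijenhuis_torsion L xi eta : vfamily :=
  let A := apply_field L in
  bracket (A xi) (A eta) + A (A (bracket xi eta))
    - A (bracket (A xi) eta) - A (bracket xi (A eta)).

Definition lie_derivative e L xi : vfamily :=
  bracket e (apply_field L xi) - apply_field L (bracket e xi).

(* Identities between tensor fields are tested on local vector fields, as a
   real-analytic field given near a point need not extend to M. *)
Definition nijenhuis_operator L : Prop :=
  operator_field L /\
  forall W, open W -> forall xi eta, vector_field W xi -> vector_field W eta ->
  forall c q, charts c -> dom c q -> W q -> nijenhuis_torsion L xi eta c q = 0.

Definition unity L e : Prop :=
  vector_field setT e /\
  forall W, open W -> forall xi, vector_field W xi ->
  forall c q, charts c -> dom c q -> W q -> lie_derivative e L xi c q = xi c q.

Definition nijenhuis_with_unity L e : Prop := nijenhuis_operator L /\ unity L e.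

End Fields.

Section Jordan.
Variable F : fieldType.

Definition jordan_block (k : nat) (a : F) : 'M[F]_k :=
  \matrix_(i, j) (if i == j then a else (j == i.+1 :> nat)%:R).

(* The blocks are listed as pairs (eigenvalue, size). *)
Definition block_at (s : seq (F * nat)) (i : nat) : F * nat :=
  nth (0 : F, 0%N) s i.

Definition jordan_mx (s : seq (F * nat)) :
    'M[F]_(\sum_(i < size s) (block_at s i).2) :=
  \mxdiag_(i < size s) jordan_block (block_at s i).2 (block_at s i).1.

(* P and Q are mutually inverse, which forces the two dimensions to agree. *)
Definition jordan_form (n : nat) (A : 'M[F]_n) (s : seq (F * nat)) : Prop :=
  all (fun b => 0 < b.2)%N s /\
  exists P Q, [/\ P *m Q = 1%:M, Q *m P = 1%:M & A = P *m jordan_mx s *m Q].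

(* One list of block sizes for every distinct eigenvalue. *)
Definition block_sizes (s : seq (F * nat)) : seq (seq nat) :=
  [seq [seq b.2 | b <- s & b.1 == a] | a <- undup [seq b.1 | b <- s]].

End Jordan.

Section Algebraic.
Variable R : realType.

Definition complexify (n : nat) (A : 'M[R]_n) : 'M[R[i]]_n :=
  map_mx (real_complex R) A.

Definition gl_regular (n : nat) (A : 'M[R]_n) : Prop :=
  exists2 s, jordan_form (complexify A) s & uniq [seq b.1 | b <- s].

(* The blocks of a Jordan form may be listed in any order, so that sigma is
   determined by A up to reordering. *)
Definition segre (n : nat) (A : 'M[R]_n) (sigma : seq (seq nat)) : Prop :=
  exists2 s, jordan_form (complexify A) s & block_sizes s = sigma.

Variables (cat : category) (n : nat) (M : manifold R cat n).
Implicit Types (L : ofamily M) (e : vfamily M) (p q : M).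

(* For properties of matrices that are invariant under similarity. *)
Definition holds_at L q (P : 'M[R]_n -> Prop) : Prop :=
  forall c, charts c -> dom c q -> P (L c q).

Definition gl_regular_field L : Prop := forall q, holds_at L q (@gl_regular n).

Definition algebraically_generic L p : Prop :=
  exists sigma, \forall q \near p, holds_at L q (fun A => segre A sigma).

(* The complex spectrum, without multiplicities, is the list s. *)
Definition eigenvalues_are (s : seq R[i]) (A : 'M[R]_n) : Prop :=
  forall z, eigenvalue (complexify A) z = (z \in s).

(* u is centred at p, e is the first coordinate field of u, and the matrix of
   L in the coordinates u is T u. *)
Definition normalizes L e p (T : 'cV[R]_n -> 'M[R]_n) (u : chart R n M) :
    Prop :=
  [/\ charts u, dom u p, coord u p = 0 &
      forall q, dom u q ->
        e u q = \col_i (i == 0 :> nat)%:R /\ L u q = T (coord u q)].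

Definition exists_unique_germ p (P : chart R n M -> Prop) : Prop :=
  (exists u, P u) /\
  forall u u', P u -> P u' -> \forall q \near p, coord u q = coord u' q.

End Algebraic.

Section NormalForms.
Variables (R : realType) (n : nat).

(* Numbering of the coordinates from 0: [nth_coord u k] is u^(k+1). *)
Definition nth_coord (u : 'cV[R]_n) (k : nat) : R :=
  if insub k is Some i then u i 0 else 0.

Definition toeplitz_entry (lambda0 : R) (u : 'cV[R]_n) (k : nat) : R :=
  match k with
  | 0 => nth_coord u 0 + lambda0
  | 1 => nth_coord u 1 + 1
  | _ => nth_coord u k
  end.

Definition toeplitz_form (lambda0 : R) (u : 'cV[R]_n) : 'M[R]_n :=
  \matrix_(i, j) if (i < j)%N then 0 else toeplitz_entry lambda0 u (i - j).

Definition conformal_mx (x y : R) : 'M[R]_2 :=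
  \matrix_(i, j) if i == j then x else if i == 0 then - y else y.

(* u = (x^1, y^1, ..., x^s, y^s); [coord_block u k] is C^(k+1). *)
Definition coord_block (u : 'cV[R]_n) (k : nat) : 'M[R]_2 :=
  conformal_mx (nth_coord u k.*2) (nth_coord u k.*2.+1).

Definition block_toeplitz_entry (a0 b0 : R) (u : 'cV[R]_n) (k : nat) :
    'M[R]_2 :=
  match k with
  | 0 => coord_block u 0 + conformal_mx a0 b0
  | 1 => coord_block u 1 + 1%:M
  | _ => coord_block u k
  end.

Definition block_toeplitz_form (a0 b0 : R) (u : 'cV[R]_n) : 'M[R]_n :=
  \matrix_(i, j)
    if (i./2 < j./2)%N then 0
    else block_toeplitz_entry a0 b0 u (i./2 - j./2) (inord (i %% 2))
                                                    (inord (j %% 2)).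

End NormalForms.

(* Main.v *)
(* In a chart, let X_g = g(L) e for a real polynomial g. The vanishing of the
   torsion and Lie_e L = Id give Lie_{X_g} L = g(L), whence
   [X_f, X_g] = X_{f g' - f' g}; by gl-regularity e is a cyclic vector of L, so
   the X_g span the tangent spaces. Taking traces of powers of L, one finds that
   an eigenvalue mu satisfies X_g mu = g(mu). The normal coordinates are the
   coefficients (their real and imaginary parts if mu is not real) of
   U - mu_0 - t, where U = mu + u_1 t + ... modulo t^s solves X_g U = g(U) for
   all g and U = mu_0 + t at p. The coefficients are found one at a time, as
   u_1 = exp z and u_j = u_1 z: the equations prescribe the form dz on the X_g,
   and the bracket relation says that this form is closed. Conversely, any
   normal coordinates come from such a U, and if two solutions agree modulo
   t^j, the difference of their coefficients of t^j divided by u_1 is annihilated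
   by all X_g, hence constant. *)

(* Genericity is used through the number of distinct eigenvalues: near p the spectrum keeps its
   type, so [mu] is a function of traces (tr L / n, or a square root formed from tr L and tr L^2)
   and thus of the given class. The differential of a nonreal [mu] has two real components, whence
   the traces up to tr L^3. Torsion and unity become dmu(L v) = mu dmu(v) and dmu(e) = 1, so dmu is
   a left eigenvector that does not vanish on e; this is what makes e cyclic. The coefficient of t^j
   in g(U) is affine in u_j with slope g'(mu): u_1 solves the homogeneous linear equation, and the
   factor u_1 in u_j is variation of constants. Both cases run in parallel: functions are
   complex-valued, a flag [re] marks the real case, and a linear dictionary [theta] between columns
   and polynomials modulo t^s turns the Toeplitz matrices into multiplications. In the analytic
   category everything rests on Cauchy estimates for all derivatives; solutions of dg = F(g) inherit
   them from F, which covers elementary functions and inverse maps alike. *)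
Require Import Defs.
From HB Require Import structures.
From mathcomp Require Import all_boot all_order all_algebra.
From mathcomp Require Import complex.
From mathcomp Require Import all_classical all_reals all_analysis.
From mathcomp Require Import ring lra zify.
(* Repeated because mathcomp has its own [coord]. *)
Require Import Defs.

Set Implicit Arguments.
Unset Strict Implicit.
Unset Printing Implicit Defensive.

Import Order.TTheory GRing.Theory Num.Theory.
Import numFieldNormedType.Exports.

Local Open Scope classical_set_scope.
Local Open Scope ring_scope.

(** * Directional derivatives *)

Section Norm.
Variables (R : realType) (n : nat).
Implicit Types x y c : 'cV[R]_n.

Lemma cvnorm_leP x (r : R) : 0 <= r -> reflect (forall i, `|x i 0| <= r) (`|x| <= r).
Proof.
move=> r0; apply: (iffP idP) => [xr i|xr].
  apply: le_trans xr; rewrite /Num.Def.normr/= mx_normrE.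
  exact: (le_bigmax _ (fun ij => `|x ij.1 ij.2|) (i, 0)).
rewrite /Num.Def.normr/= mx_normrE; apply: bigmax_le => // -[i j] _ /=.
by rewrite ord1.
Qed.

Lemma coord_le_cvnorm x i : `|x i 0| <= `|x|.
Proof. exact/cvnorm_leP. Qed.

Lemma cvnorm_ltP x (r : R) : 0 < r -> reflect (forall i, `|x i 0| < r) (`|x| < r).
Proof.
move=> r0; apply: (iffP idP) => [xr i|xr].
  exact: le_lt_trans (coord_le_cvnorm x i) xr.
rewrite /Num.Def.normr/= mx_normrE.
by apply/bigmax_ltP; split => // -[i j] _ /=; rewrite ord1.
Qed.

Lemma ballcvP c r x : reflect (ball c r x) (`|x - c| < r).
Proof. by rewrite -ball_normE /ball_ /= distrC; apply: idP. Qed.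

Lemma ball_gt0r c r x : ball c r x -> 0 < r.
Proof. by move/ballcvP; apply: le_lt_trans. Qed.

(** The norm is the maximum norm, so balls are boxes; axis-parallel paths between two points of a
    ball stay inside it. *)
Lemma ball_box c r x y (z : 'cV[R]_n) : ball c r x -> ball c r y ->
  (forall i, z i 0 = x i 0 \/ z i 0 = y i 0) -> ball c r z.
Proof.
move=> bx by_ hz; have r0 := ball_gt0r bx.
move: bx by_ => /ballcvP/cvnorm_ltP-/(_ r0) bx /ballcvP/cvnorm_ltP-/(_ r0) by_.
apply/ballcvP/cvnorm_ltP => // i.
by have := bx i; have := by_ i; rewrite !mxE; case: (hz i) => ->.
Qed.

Lemma ball_seg c r x v t : ball c r x -> ball c r (x + v) -> 0 <= t <= 1 ->
  ball c r (x + t *: v).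
Proof.
move=> /ballcvP bx /ballcvP bv /andP[t0 t1]; apply/ballcvP.
have -> : x + t *: v - c = (1 - t) *: (x - c) + t *: (x + v - c).
  by apply/matrixP => i j; rewrite !mxE; ring.
apply: le_lt_trans (ler_normD _ _) _.
rewrite !normrZ !ger0_norm ?subr_ge0 //.
have [->|tn0] := eqVneq t 0; first by rewrite subr0 mul1r mul0r addr0.
have t0' : 0 < t by rewrite lt_def tn0.
have -> : r = (1 - t) * r + t * r by ring.
apply: ler_ltD; last by rewrite ltr_pM2l.
by rewrite ler_wpM2l ?subr_ge0 // ltW.
Qed.

Lemma nbhs_ballcv c (A : set 'cV[R]_n) : nbhs c A ->
  exists2 r, 0 < r & ball c r `<=` A.
Proof. by move/nbhs_ballP => [r /= r0 h]; exists r. Qed.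

Lemma open_ballcv (A : set 'cV[R]_n) c : open A -> A c ->
  exists2 r, 0 < r & ball c r `<=` A.
Proof. by move=> oA Ac; apply: nbhs_ballcv; exact: open_nbhs_nbhs. Qed.

Lemma ball_le_sub c r s : r <= s -> (ball c r : set 'cV[R]_n) `<=` ball c s.
Proof. exact: le_ball. Qed.

Lemma ball_opencv c r : open (ball c r : set 'cV[R]_n).
Proof. exact: ball_open. Qed.

End Norm.

Section OneVar.
Variables (R : realType) (V : normedModType R).
Implicit Types (f g : V -> R) (x v : V).

(** In this form differentiation rules become estimates in the scalar t alone, with no appeal to a
    differential of f as a map. *)
Lemma is_deriveP f x v d : is_derive x v f d <->
  forall e, 0 < e -> exists2 del, 0 < del &
    forall t : R, `|t| < del -> `|f (x + t *: v) - f x - t * d| <= e * `|t|.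
Proof.
split=> [[/derivable_nbhs dfx <-] e e0|H].
  have /eqaddoP /(_ e e0) := dfx.
  rewrite /= near_simpl => /nbhs_ballP[del /= del0 H].
  exists del => // t tdel.
  have := H t; rewrite -ball_normE /ball_ /= sub0r normrN => /(_ tdel).
  have -> : f (x + t *: v) - f x - t * 'D_v f x =
            f (t *: v + x) - (f x + t *: 'D_v f x).
    by rewrite [x + _]addrC opprD addrA.
  by [].
have cvgd : (h^-1 *: ((f \o shift x) (h *: v) - f x)) @[h --> 0^'] --> (d : R).
  apply/cvgrPdist_le => e e0.
  have [del del0 Hdel] := H e e0.
  near=> h.
  have h0 : h != 0 by near: h; exact: nbhs_dnbhs_neq.
  have hd : `|h| < del by near: h; exact: dnbhs0_lt.
  have := Hdel h hd.
  rewrite /= [h *: v + x]addrC => le.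
  have -> : d - h^-1 *: (f (x + h *: v) - f x) =
            - (h^-1 * (f (x + h *: v) - f x - h * d)).
    rewrite -[h^-1 *: _]/(h^-1 * _).
    by rewrite [in RHS]mulrBr (mulKf h0) opprB.
  by rewrite normrN normrM normfV ler_pdivrMl ?normr_gt0 // [leRHS]mulrC.
split; first by apply/cvg_ex; exists d.
exact/cvg_lim.
Unshelve. all: by end_near. Qed.

Lemma is_derive_uniq f x v d d' : is_derive x v f d -> is_derive x v f d' ->
  d = d'.
Proof. by case=> _ <- [_ <-]. Qed.

Lemma iderD f g x v a b : is_derive x v f a -> is_derive x v g b ->
  is_derive x v (fun y => f y + g y) (a + b).
Proof. exact: is_deriveD. Qed.

Lemma iderN f x v a : is_derive x v f a -> is_derive x v (fun y => - f y) (- a).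
Proof. exact: is_deriveN. Qed.

Lemma iderB f g x v a b : is_derive x v f a -> is_derive x v g b ->
  is_derive x v (fun y => f y - g y) (a - b).
Proof. exact: is_deriveB. Qed.

Lemma iderM f g x v a b : is_derive x v f a -> is_derive x v g b ->
  is_derive x v (fun y => f y * g y) (a * g x + f x * b).
Proof.
move=> fa gb; have -> : a * g x + f x * b = f x *: b + g x *: a.
  by rewrite addrC [a * _]mulrC.
exact: is_deriveM.
Qed.

Lemma iderc (c : R) x v : is_derive x v (fun=> c) 0.
Proof. exact: is_derive_cst. Qed.

Lemma ider_sum (I : Type) (r : seq I) (P : pred I) (h : I -> V -> R)
    (dh : I -> R) x v : (forall i, P i -> is_derive x v (h i) (dh i)) ->
  is_derive x v (fun y => \sum_(i <- r | P i) h i y) (\sum_(i <- r | P i) dh i).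
Proof.
move=> H; elim: r => [|i r IH].
  rewrite big_nil; under eq_fun do rewrite big_nil.
  exact: iderc.
rewrite big_cons; under eq_fun do rewrite big_cons.
by case: ifP => // Pi; apply: iderD => //; exact: H.
Qed.

Lemma ider_near f g x v d : (\forall y \near x, f y = g y) ->
  is_derive x v f d -> is_derive x v g d.
Proof. exact: near_eq_is_derive. Qed.

Lemma iderZv f x v (a : R) d : is_derive x v f d -> is_derive x (a *: v) f (a * d).
Proof.
move=> /is_deriveP H; apply/is_deriveP => e e0.
(* The summand 1 covers the case a = 0. *)
have [del del0 Hd] := H (e / (`|a| + 1)) (divr_gt0 e0 (ltr_wpDl (normr_ge0 a) ltr01)).
have a1 : 0 < `|a| + 1 by rewrite ltr_wpDl.
exists (del / (`|a| + 1)); first exact: divr_gt0.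
move=> t; rewrite ltr_pdivlMr // => td.
have ta : `|t * a| <= `|t| * (`|a| + 1).
  by rewrite normrM ler_wpM2l // lerDl.
have := Hd (t * a) (le_lt_trans ta td).
rewrite scalerA mulrA => /le_trans; apply.
rewrite -[leLHS]mulrA; apply: ler_wpM2l; first exact: ltW.
by rewrite [leLHS]mulrC ler_pdivrMr.
Qed.

Lemma ider_seg f x v d (s : R) : is_derive (x + s *: v) v f d ->
  is_derive s 1 (fun t : R => f (x + t *: v)) d.
Proof.
move=> fd.
have E : (fun h : R => h^-1 *: (((fun t : R => f (x + t *: v)) \o shift s) (h *: 1) - f (x + s *: v)))
    = (fun h : R => h^-1 *: ((f \o shift (x + s *: v)) (h *: v) - f (x + s *: v))).
  by apply/funext => h /=; rewrite [h%:A]mulr1 scalerDl addrCA.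
by case: fd => fd <-; split; rewrite /derivable /derive E.
Qed.

Lemma MVT_dir f x v (d : R -> R) :
  (forall t, 0 <= t <= 1 -> is_derive (x + t *: v) v f (d t)) ->
  exists2 t, 0 <= t <= 1 & f (x + v) - f x = d t.
Proof.
move=> H.
have H1 (t : R) : 0 <= t <= 1 -> is_derive t 1 (fun t : R => f (x + t *: v)) (d t).
  by move=> t01; apply: ider_seg; exact: H.
have [||c c01] := @MVT_segment R (fun t : R => f (x + t *: v)) d 0 1 ler01.
- by move=> t; rewrite in_itv /= => /andP[t0 t1]; apply: H1; rewrite !ltW.
- apply: derivable_within_continuous => t; rewrite in_itv /= => t01.
  by case: (H1 t t01).
rewrite scale1r scale0r addr0 subr0 mulr1 => E.
by exists c => //; move: c01; rewrite in_itv.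
Qed.

Lemma ider_cvg f x v d : is_derive x v f d ->
  (fun t : R => f (x + t *: v)) @ (0 : R) --> f x.
Proof.
move=> fd.
have H : is_derive (0 : R) 1 (fun t : R => f (x + t *: v)) d.
  by apply: ider_seg; rewrite scale0r addr0.
case: H => /derivable1_diffP/differentiable_continuous + _.
by rewrite /prop_for /continuous_at scale0r addr0.
Qed.

End OneVar.

Section MultiVar.
Variables (R : realType) (n : nat).
Notation V := 'cV[R]_n.
Implicit Types (f g : V -> R) (x y c : V).

Definition pd (i : 'I_n) (f : V -> R) : V -> R := 'D_(delta_mx i 0) f.

(** The increment telescopes along the path that replaces the coordinates of x by those of y one at
    a time, and the one-variable mean value theorem applies on every edge. Partial derivatives are
    thus enough. *)
Lemma MVT_box f c r x y : ball c r x -> ball c r y ->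
  (forall z i, ball c r z -> derivable f z (delta_mx i 0)) ->
  exists xi : 'I_n -> V,
    (forall i, ball c r (xi i) /\ `|xi i - x| <= `|y - x|) /\
    f y - f x = \sum_i (y - x) i 0 * pd i f (xi i).
Proof.
move=> bx by_ df.
pose z (k : nat) : V := \col_i if (i < k)%N then y i 0 else x i 0.
have bz k : ball c r (z k).
  by apply: ball_box bx by_ _ => i; rewrite mxE; case: ifP; [right|left].
have zS (k : 'I_n) : z k.+1 = z k + (y - x) k 0 *: delta_mx k 0.
  apply/colP => i; rewrite !mxE eqxx andbT ltnS.
  have [->|ik] := eqVneq i k; first by rewrite leqnn ltnn /= mulr1; ring.
  by rewrite mulr0 addr0 ltn_neqAle leq_eqVlt (inj_eq val_inj) (negbTE ik) /= ltn_neqAle (inj_eq val_inj) ik.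
have H (k : 'I_n) : exists xi, [/\ ball c r xi, `|xi - x| <= `|y - x| &
    f (z k.+1) - f (z k) = (y - x) k 0 * pd k f xi].
  have [|t t01] := @MVT_dir R V f (z k) ((y - x) k 0 *: delta_mx k 0)
    (fun t => (y - x) k 0 * pd k f (z k + t *: ((y - x) k 0 *: delta_mx k 0))).
    move=> t t01; apply: iderZv; apply: derivableP; apply: df.
    by apply: ball_seg => //; rewrite -zS.
  rewrite -zS => E; exists (z k + t *: ((y - x) k 0 *: delta_mx k 0)).
  split=> //; first by apply: ball_seg => //; rewrite -zS.
  apply/cvnorm_leP => // i; apply: le_trans (coord_le_cvnorm (y - x) i).
  rewrite !mxE eqxx andbT; have [->|ik] := eqVneq i k.
    rewrite ltnn mulr1 addrAC subrr add0r normrM ger0_norm; last by case/andP: t01.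
    by rewrite ler_piMl //; case/andP: t01.
  by rewrite !mulr0 addr0; case: ifP => // _; rewrite subrr normr0.
have [xi Hxi] := choice H; exists xi; split.
  by move=> i; have [] := Hxi i.
have -> : f y - f x = f (z n) - f (z 0).
  by congr (f _ - f _); apply/colP => i; rewrite !mxE ?ltn_ord.
rewrite -(telescope_sumr (fun k => f (z k))) // big_mkord.
by apply: eq_bigr => i _; have [_ _] := Hxi i.
Qed.

Lemma lip_box f c r x y (C : R) : ball c r x -> ball c r y ->
  (forall z i, ball c r z -> derivable f z (delta_mx i 0)) ->
  (forall z i, ball c r z -> `|pd i f z| <= C) ->
  `|f y - f x| <= n%:R * C * `|y - x|.
Proof.
move=> bx by_ df Cf; have [xi [bxi ->]] := MVT_box bx by_ df.
apply: le_trans (ler_norm_sum _ _ _) _.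
have -> : n%:R * C * `|y - x| = \sum_(i < n) `|y - x| * C.
  by rewrite sumr_const card_ord -mulr_natl; ring.
apply: ler_sum => i _; rewrite normrM ler_pM //; first exact: coord_le_cvnorm.
by apply: Cf; case: (bxi i).
Qed.

Definition C1at f x := (\forall y \near x, forall i, derivable f y (delta_mx i 0))
  /\ forall i, {for x, continuous (pd i f)}.

Lemma near_all (T : Type) (F : set_system T) (FF : Filter F) (m : nat)
    (P : 'I_m -> T -> Prop) : (forall i, \forall t \near F, P i t) ->
  \forall t \near F, forall i, P i t.
Proof. exact: filter_forall. Qed.

Lemma continuous_forP (W : normedModType R) (f : W -> R) (x : W) :
  {for x, continuous f} <-> forall e : R, 0 < e ->
    exists2 d : R, 0 < d & forall w, ball x d w -> `|f w - f x| <= e.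
Proof.
rewrite /prop_for /continuous_at; split=> [/cvgrPdist_le H e e0|H].
  have /nbhs_ballP[d /= d0 Hd] := H e e0.
  by exists d => // y /Hd /=; rewrite distrC.
apply/cvgrPdist_le => e e0; have [d d0 Hd] := H e e0.
by apply/nbhs_ballP; exists d => //= y /Hd; rewrite distrC.
Qed.

Lemma cvg_coordP (T : Type) (F : set_system T) (FF : Filter F) (g : T -> V) x :
  (forall i, (fun t => g t i 0) @ F --> x i 0) -> g @ F --> x.
Proof.
move=> H; apply/cvgrPdist_lt => e e0.
have /near_all : forall i, \forall t \near F, `|x i 0 - g t i 0| < e.
  by move=> i; move/cvgrPdist_lt : (H i); apply.
by apply: filterS => t Ht; apply/cvnorm_ltP => // i; rewrite !mxE.
Qed.

(* Only the values of [f] near [g x] matter, and [g] need not be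
   differentiable as a map: directional derivatives suffice. *)
Lemma chain_rule (W : normedModType R) (f : V -> R) (g : W -> V) (x v : W) (dg : 'I_n -> R) :
  (forall j, is_derive x v (fun w => g w j 0 : R) (dg j)) -> C1at f (g x) ->
  is_derive x v (fun w => f (g w) : R) (\sum_j dg j * pd j f (g x)).
Proof.
move=> Hg [fd fc].
have [r r0 Hr] := nbhs_ballcv fd.
have gc : (fun t : R => g (x + t *: v)) @ (0 : R) --> g x.
  by apply: cvg_coordP => j; apply: ider_cvg; exact: Hg.
apply/is_deriveP => e e0.
have M0 : 0 < \sum_j (`|dg j| + 1) + 1 + \sum_j `|pd j f (g x)|.
  apply: ltr_pwDl; last by apply: sumr_ge0.
  by rewrite ltr_wpDl // sumr_ge0 // => j _; rewrite addr_ge0.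
set M := (X in 0 < X) in M0.
pose d := Order.min 1 (e / M).
have d0 : 0 < d by rewrite lt_min ltr01 divr_gt0.
have d1 : d <= 1 by rewrite ge_min lexx.
have dM : d * M <= e by rewrite -ler_pdivlMr // ge_min lexx orbT.
have N1 j : \forall t \near (0 : R),
    `|g (x + t *: v) j 0 - g x j 0 - t * dg j| <= d * `|t|.
  have [del del0 H] := iffLR (is_deriveP _ _ _ _) (Hg j) d d0.
  apply/nbhs_ballP; exists del => //= t.
  by rewrite -ball_normE /ball_ /= sub0r normrN => /H.
move/near_all in N1.
have N2 j : \forall y \near g x, `|pd j f (g x) - pd j f y| <= d.
  by move/cvgrPdist_le : (fc j) => /(_ d d0).
move/near_all: N2 => /nbhs_ballcv [r2 r20 N2].
have N3 : \forall t \near (0 : R), `|g (x + t *: v) - g x| < Order.min r r2.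
  near=> t; rewrite distrC; near: t.
  by move/cvgrPdist_lt: gc; apply; rewrite lt_min r0.
have [del /= del0 Hdel] := iffLR (nbhs_ballP (0 : R) _) (filterI N1 N3).
exists del => // t td.
have /Hdel[{}N1 {}N3] : ball (0 : R) del t.
  by rewrite -ball_normE /ball_ /= sub0r normrN.
have [|||xi [bxi ->]] := @MVT_box f (g x) (Order.min r r2) (g x) (g (x + t *: v)).
- by apply/ballcvP; rewrite subrr normr0 lt_min r0.
- exact/ballcvP.
- by move=> z i bz; apply: Hr; apply: ball_le_sub bz; rewrite ge_min lexx.
rewrite mulr_sumr -sumrB.
apply: (@le_trans _ _ (\sum_j (`|t| * (d * (`|dg j| + 1)) + `|t| * d * `|pd j f (g x)|))).
  apply: le_trans (ler_norm_sum _ _ _) _; apply: ler_sum => j _.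
  rewrite !mxE.
  set a := g (x + t *: v) j 0 - g x j 0; set p := pd j f (xi j); set q := pd j f (g x).
  have -> : a * p - t * (dg j * q) = a * (p - q) + (a - t * dg j) * q by ring.
  apply: le_trans (ler_normD _ _) _; apply: lerD; rewrite normrM.
    have ha : `|a| <= `|t| * (`|dg j| + 1).
      have -> : a = (a - t * dg j) + t * dg j by ring.
      apply: le_trans (ler_normD _ _) _.
      rewrite mulrDr mulr1 addrC lerD //; first by rewrite normrM.
      by apply: le_trans (N1 j) _; rewrite ler_piMl.
    rewrite [X in _ <= X](_ : _ = (`|t| * (`|dg j| + 1)) * d); last by ring.
    rewrite ler_pM // distrC; apply: N2.
    by apply: ball_le_sub (bxi j).1; rewrite ge_min lexx orbT.
  rewrite [X in _ <= X](_ : _ = (d * `|t|) * `|q|); last by ring.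
  by apply: ler_wpM2r => //; exact: N1.
rewrite big_split /= -!mulr_sumr.
rewrite [X in X <= _](_ : _ = `|t| * (d * (\sum_j (`|dg j| + 1) + \sum_j `|pd j f (g x)|))); last by ring.
rewrite mulrC ler_wpM2r //; apply: le_trans dM; rewrite ler_pM2l //.
by rewrite /M; lra.
Unshelve. all: by end_near. Qed.

Lemma ider_coord x v i : is_derive x v (fun y : V => y i 0) (v i 0).
Proof.
apply/is_deriveP => e e0; exists 1 => // t _.
have -> : (x + t *: v) i 0 - x i 0 - t * v i 0 = 0 by rewrite !mxE; ring.
by rewrite normr0 mulr_ge0 // ltW.
Qed.

Lemma C1_ider f x v : C1at f x ->
  is_derive x v f (\sum_j v j 0 * pd j f x).
Proof. by apply: (@chain_rule _ f id) => j; exact: ider_coord. Qed.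

End MultiVar.

(** * Smooth and analytic functions *)

Section CkTheory.
Variables (R : realType) (n : nat).
Notation V := 'cV[R]_n.
Implicit Types (f g : V -> R) (U W : set V) (x y c : V) (k : nat).

Lemma Ck_cont k U f x : Ck k U f -> U x -> {for x, continuous f}.
Proof. by case: k => [|k] /= [h _]; exact: h. Qed.

Lemma Ck_der k U f x i : Ck k.+1 U f -> U x ->
  is_derive x (delta_mx i 0) f (pd i f x).
Proof. by move=> /= [_ /(_ i)[h _]] Ux; apply: derivableP; exact: h. Qed.

Lemma Ck_pd k U f i : Ck k.+1 U f -> Ck k U (pd i f).
Proof. by move=> /= [_ /(_ i)[_ h]]. Qed.

Lemma CkS k U f : (forall x, U x -> {for x, continuous f}) ->
  (forall i, Ck k U (pd i f) /\
     forall x, U x -> is_derive x (delta_mx i 0) f (pd i f x)) -> Ck k.+1 U f.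
Proof.
by move=> h1 h2; split => // i; have [a b] := h2 i; split => // x /b [].
Qed.

Lemma CkW k U f : Ck k.+1 U f -> Ck k U f.
Proof.
elim: k f => [|k IH] f H; first by split => // x; exact: Ck_cont H.
apply: CkS => [x|i]; first exact: Ck_cont H.
by split; [apply: IH; exact: Ck_pd|move=> x; exact: Ck_der H].
Qed.

Lemma Ck_le k j U f : (j <= k)%N -> Ck k U f -> Ck j U f.
Proof.
move/subnK <-; elim: (k - j)%N => // d IH; rewrite addSn => H; exact/IH/CkW.
Qed.

Lemma Ck_sub k U W f : W `<=` U -> Ck k U f -> Ck k W f.
Proof.
move=> WU; elim: k f => [|k IH] f H.
  by split => // x /WU; exact: Ck_cont H.
apply: CkS => [x /WU|i]; first exact: Ck_cont H.
by split; [apply: IH; exact: Ck_pd|move=> x /WU; exact: Ck_der H].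
Qed.

Lemma open_near_eq U f g x : open U -> (forall y, U y -> f y = g y) -> U x ->
  \forall y \near x, f y = g y.
Proof.
move=> oU fg Ux; have : nbhs x U by exact: open_nbhs_nbhs.
by apply: filterS => y; exact: fg.
Qed.

Lemma pd_ext U f g i x : open U -> (forall y, U y -> f y = g y) -> U x ->
  pd i f x = pd i g x.
Proof. by move=> oU fg Ux; apply: near_eq_derive; exact: open_near_eq fg _. Qed.

Lemma continuous_ext U f g x : open U -> (forall y, U y -> f y = g y) -> U x ->
  {for x, continuous f} -> {for x, continuous g}.
Proof.
move=> oU fg Ux; have [r r0 Hr] := open_ballcv oU Ux.
move=> /continuous_forP H; apply/continuous_forP => e e0.
have [d d0 Hd] := H e e0; exists (Order.min d r); first by rewrite lt_min d0.
move=> w wb; rewrite -!fg //.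
  by apply: Hd; apply: ball_le_sub wb; rewrite ge_min lexx.
by apply: Hr; apply: ball_le_sub wb; rewrite ge_min lexx orbT.
Qed.

Lemma Ck_ext k U f g : open U -> (forall y, U y -> f y = g y) ->
  Ck k U f -> Ck k U g.
Proof.
move=> oU; elim: k f g => [|k IH] f g fg H.
  by split => // x Ux; apply: (continuous_ext oU fg Ux); exact: Ck_cont H Ux.
apply: CkS => [x Ux|i].
  by apply: (continuous_ext oU fg Ux); exact: Ck_cont H Ux.
split; first by apply: IH (Ck_pd i H) => y; exact: pd_ext.
move=> x Ux; apply: (ider_near (open_near_eq oU fg Ux)).
by rewrite -(pd_ext i oU fg Ux); exact: Ck_der H Ux.
Qed.

Lemma CkS_ider k U f (df : 'I_n -> V -> R) : open U ->
  (forall x, U x -> {for x, continuous f}) ->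
  (forall i x, U x -> is_derive x (delta_mx i 0) f (df i x)) ->
  (forall i, Ck k U (df i)) -> Ck k.+1 U f.
Proof.
move=> oU fc dfE dfk; apply: CkS => // i.
have E x : U x -> df i x = pd i f x by move=> Ux; have [_ <-] := dfE i x Ux.
split; first exact: Ck_ext (dfk i).
by move=> x Ux; rewrite -E //; exact: dfE.
Qed.

Lemma Ck1_C1at U f x : open U -> Ck 1 U f -> U x -> C1at f x.
Proof.
move=> oU H Ux; split; last by move=> i; exact: Ck_cont (Ck_pd i H) Ux.
have : nbhs x U by exact: open_nbhs_nbhs.
by apply: filterS => y Uy i; have [] := Ck_der i H Uy.
Qed.

Lemma continuous_forM f g x : {for x, continuous f} -> {for x, continuous g} ->
  {for x, continuous (fun y => f y * g y)}.
Proof. by move=> fc gc; exact: continuousM. Qed.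

Lemma continuous_forD f g x : {for x, continuous f} -> {for x, continuous g} ->
  {for x, continuous (fun y => f y + g y)}.
Proof. by move=> fc gc; exact: continuousD. Qed.

Lemma continuous_for_cst (a : R) x : {for x, continuous (fun _ : V => a)}.
Proof. exact: cst_continuous. Qed.

Lemma continuous_for_coord i x : {for x, continuous (fun y : V => y i 0 : R)}.
Proof. exact: coord_continuous. Qed.

Lemma Ck_cst k U (a : R) : open U -> Ck k U (fun=> a).
Proof.
move=> oU; elim: k a => [|k IH] a; first by split => // x _; exact: continuous_for_cst.
apply: (@CkS_ider _ _ _ (fun _ _ => 0)) => // *.
exact: continuous_for_cst.
Qed.

Lemma Ck_coord k U i : open U -> Ck k U (fun y => y i 0).
Proof.
move=> oU; case: k => [|k]; first by split => // x _; exact: continuous_for_coord.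
apply: (@CkS_ider _ _ _ (fun j _ => (delta_mx j 0 : V) i 0)) => // [x _|j x _|j].
- exact: continuous_for_coord.
- exact: ider_coord.
- exact: Ck_cst.
Qed.

Lemma Ck_add k U f g : open U -> Ck k U f -> Ck k U g ->
  Ck k U (fun y => f y + g y).
Proof.
move=> oU; elim: k f g => [|k IH] f g Hf Hg.
  by split => // x Ux; apply: continuous_forD; [exact: Ck_cont Hf Ux|exact: Ck_cont Hg Ux].
apply: (@CkS_ider _ _ _ (fun i y => pd i f y + pd i g y)) => // [x Ux|i x Ux|i].
- by apply: continuous_forD; [exact: Ck_cont Hf Ux|exact: Ck_cont Hg Ux].
- by apply: iderD; [exact: Ck_der Hf Ux|exact: Ck_der Hg Ux].
- by apply: IH; exact: Ck_pd.
Qed.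

Lemma Ck_mul k U f g : open U -> Ck k U f -> Ck k U g ->
  Ck k U (fun y => f y * g y).
Proof.
move=> oU; elim: k f g => [|k IH] f g Hf Hg.
  by split => // x Ux; apply: continuous_forM; [exact: Ck_cont Hf Ux|exact: Ck_cont Hg Ux].
apply: (@CkS_ider _ _ _ (fun i y => pd i f y * g y + f y * pd i g y)) => // [x Ux|i x Ux|i].
- by apply: continuous_forM; [exact: Ck_cont Hf Ux|exact: Ck_cont Hg Ux].
- by apply: iderM; [exact: Ck_der Hf Ux|exact: Ck_der Hg Ux].
- apply: Ck_add => //; apply: IH; by [exact: Ck_pd|exact: CkW].
Qed.

Lemma Ck_sum k U (I : Type) (r : seq I) (h : I -> V -> R) : open U ->
  (forall i, Ck k U (h i)) -> Ck k U (fun y => \sum_(i <- r) h i y).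
Proof.
move=> oU H; elim: r => [|i r IH].
  by apply: (@Ck_ext _ _ (fun=> 0)) (Ck_cst _ _ oU) => // y _; rewrite big_nil.
apply: (@Ck_ext _ _ (fun y => h i y + \sum_(i <- r) h i y)) => //.
  by move=> y _; rewrite big_cons.
exact: Ck_add.
Qed.

End CkTheory.

Section CkComp.
Variables (R : realType) (n m : nat).
Variables (W : set 'cV[R]_n) (U : set 'cV[R]_m) (g : 'cV[R]_n -> 'cV[R]_m).
Hypotheses (oW : open W) (oU : open U) (gWU : forall x, W x -> U (g x)).

Lemma ider_comp f x v (dg : 'I_m -> R) : Ck 1 U f -> W x ->
  (forall j, is_derive x v (fun y => g y j 0 : R) (dg j)) ->
  is_derive x v (fun y => f (g y) : R) (\sum_j dg j * pd j f (g x)).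
Proof.
by move=> Hf Wx Hg; apply: chain_rule => //; apply: Ck1_C1at Hf _ => //; exact: gWU.
Qed.

Lemma continuous_for_comp f x : {for g x, continuous f} ->
  (forall j, {for x, continuous (fun y => g y j 0 : R)}) ->
  {for x, continuous (fun y => f (g y) : R)}.
Proof.
move=> cf cg; apply: (@continuous_comp _ _ _ g f x) => //.
exact: (@cvg_coordP _ _ _ _ (nbhs_filter x)).
Qed.

Lemma Ck_comp k f : Ck k U f -> (forall j, Ck k W (fun x => g x j 0 : R)) ->
  Ck k W (fun x => f (g x) : R).
Proof.
elim: k f => [|k IH] f Hf Hg.
  split => // x Wx; apply: continuous_for_comp => [|j].
    by apply: Ck_cont Hf _; exact: gWU.
  exact: Ck_cont (Hg j) Wx.
apply: (@CkS_ider _ _ _ _ _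
  (fun i x => \sum_j pd i (fun x => g x j 0 : R) x * pd j f (g x))) => // [x Wx|i x Wx|i].
- apply: continuous_for_comp => [|j]; last exact: Ck_cont (Hg j) Wx.
  by apply: Ck_cont Hf _; exact: gWU.
- apply: ider_comp => // [|j]; first exact: Ck_le Hf.
  exact: Ck_der (Hg j) Wx.
- apply: Ck_sum => // j; apply: Ck_mul => //; first exact: Ck_pd (Hg j).
  by apply: IH => [|l]; [exact: Ck_pd|exact: CkW].
Qed.

(** Bootstrapping: if g is C^k, then its derivatives F o g are C^k as well, so g is C^(k+1). *)
Lemma Ck_ode (F : 'I_n -> 'I_m -> 'cV[R]_m -> R) :
  (forall k i j, Ck k U (F i j)) ->
  (forall x j, W x -> {for x, continuous (fun y => g y j 0 : R)}) ->
  (forall i j x, W x ->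
     is_derive x (delta_mx i 0) (fun y => g y j 0 : R) (F i j (g x))) ->
  forall k j, Ck k W (fun x => g x j 0 : R).
Proof.
move=> HF gc Hg; elim=> [|k IH] j; first by split => // x Wx; exact: gc.
have H i : Ck k W (fun x => F i j (g x)) by exact: Ck_comp.
by apply: (@CkS_ider _ _ _ _ _ (fun i x => F i j (g x))) => // *; exact: gc.
Qed.

End CkComp.

(** * Majorants for the derivatives of all orders *)

Section Majorants.
Variables (R : realType).
Implicit Types (a b : nat -> R) (k l : nat).

(** The bound that the Leibniz rule gives for the derivatives of order k of a product, when [a] and
    [b] bound those of the factors. *)
Definition bconv a b k : R := \sum_(i < k.+1) 'C(k, i)%:R * a i * b (k - i)%N.

(** Pascal's rule, in the shape of the product rule: the shift of a majorant corresponds to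
    differentiation. *)
Lemma bconv_shift a b k :
  bconv (a \o succn) b k + bconv a (b \o succn) k = bconv a b k.+1.
Proof.
rewrite /bconv [RHS]big_ord_recl /= bin0 mul1r subn0.
have -> : \sum_(i < k.+1) 'C(k.+1, bump 0 i)%:R * a (bump 0 i) * b (k.+1 - bump 0 i)%N
  = \sum_(i < k.+1) 'C(k, i)%:R * a i.+1 * b (k - i)%N
    + \sum_(i < k.+1) 'C(k, i.+1)%:R * a i.+1 * b (k - i)%N.
  rewrite -big_split /=; apply: eq_bigr => i _.
  by rewrite /bump /= add1n binS natrD subSS; ring.
rewrite addrCA; congr (_ + _).
have -> : a 0 * b k.+1 = 'C(k, 0)%:R * a 0 * b (k.+1 - 0)%N.
  by rewrite bin0 mul1r subn0.
have := @big_ord_recl R 0 +%R k.+1 (fun i : 'I_k.+2 => 'C(k, i)%:R * a i * b (k.+1 - i)%N) => /=.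
rewrite /bump /= => E.
under [X in _ = _ + X]eq_bigr do rewrite -[(k - _)%N]subSS -add1n.
rewrite -E [RHS]big_ord_recr /= bin_small // mulr0n !mul0r addr0.
by apply: eq_bigr => i _ /=; rewrite subSn // -ltnS.
Qed.

Lemma geometric_half k : \sum_(i < k) (2^-1 : R) ^+ i <= 2.
Proof.
suff -> : \sum_(i < k) (2^-1 : R) ^+ i = 2 - 2 * 2^-1 ^+ k.
  by rewrite lerBlDr lerDl mulr_ge0 // exprn_ge0 // invr_ge0.
elim: k => [|k IH]; first by rewrite big_ord0 expr0; ring.
by rewrite big_ord_recr /= IH exprS; field.
Qed.

Lemma ffact_fact_le k l i : (i <= k)%N -> (k ^_ i * (l + k - i)`! <= (l + k)`!)%N.
Proof.
move=> ik; rewrite -(@ffact_fact (l + k) i); last exact: leq_trans (leq_addl _ _).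
rewrite leq_mul2r; apply/orP; right.
elim: i ik => // i IH ik; rewrite !ffactnSr leq_mul ?IH ?leq_sub2r ?leq_addl //.
exact: ltnW.
Qed.

(** Since G <= K / 2, the terms are dominated by a geometric series of ratio 1/2, and the product
    costs only a factor 2. The offset l in the factorial accounts for l derivatives already taken of
    the second factor. *)
Lemma bconv_fact (A C K G : R) l k : 0 <= A -> 0 <= C -> 0 <= G -> 2 * G <= K ->
  bconv (fun j => A * G ^+ j * j`!%:R) (fun j => C * K ^+ j * (l + j)`!%:R) k
    <= 2 * A * C * K ^+ k * (l + k)`!%:R.
Proof.
move=> A0 C0 G0 GK; have K0 : 0 <= K by apply: le_trans GK; rewrite mulr_ge0.
have D0 : 0 <= A * C * K ^+ k * (l + k)`!%:R by rewrite !mulr_ge0 ?exprn_ge0.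
apply: (@le_trans _ _ (\sum_(i < k.+1) (A * C * K ^+ k * (l + k)`!%:R) * 2^-1 ^+ i)).
  apply: ler_sum => i _; have ik : (i <= k)%N by rewrite -ltnS.
  rewrite [leLHS](_ : _ = (A * C) * ((G ^+ i * K ^+ (k - i)) *
    ('C(k, i) * i`! * (l + (k - i))`!)%:R)); last by rewrite !natrM; ring.
  rewrite [leRHS](_ : _ = (A * C) * ((K ^+ k * 2^-1 ^+ i) * (l + k)`!%:R)); last by ring.
  apply: ler_wpM2l; first exact: mulr_ge0.
  apply: ler_pM => //; first by rewrite mulr_ge0 // exprn_ge0.
    rewrite (_ : K ^+ k = K ^+ (k - i) * K ^+ i); last by rewrite -exprD subnK.
    rewrite -mulrA [leLHS]mulrC; apply: ler_wpM2l; first exact: exprn_ge0.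
    rewrite -exprMn; apply: lerXn2r; rewrite ?nnegrE ?mulr_ge0 ?invr_ge0 //.
    by rewrite ler_pdivlMr // mulrC.
  by rewrite ler_nat bin_ffact addnBA // ffact_fact_le.
rewrite -mulr_sumr [leRHS](_ : _ = (A * C * K ^+ k * (l + k)`!%:R) * 2); last by ring.
by apply: ler_wpM2l => //; exact: geometric_half.
Qed.

Section Dim.
Variable n : nat.
Notation V := 'cV[R]_n.
Implicit Types (f g : V -> R) (B : set V).

(* [a j] bounds the derivatives of order [j <= k] of [f] on [B]. *)
Fixpoint maj k B a f : Prop :=
  (forall y, B y -> `|f y| <= a 0) /\
  match k with
  | 0 => True
  | k'.+1 => forall i : 'I_n, maj k' B (a \o succn) (pd i f)
  end.

Lemma maj0 k B a f y : maj k B a f -> B y -> `|f y| <= a 0.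
Proof. by case: k => [|k] /= [h _]; exact: h. Qed.

Lemma maj_pd k B a f i : maj k.+1 B a f -> maj k B (a \o succn) (pd i f).
Proof. by move=> /= [_]. Qed.

Lemma maj_le k B B' a b f : B' `<=` B -> (forall j, a j <= b j) ->
  maj k B a f -> maj k B' b f.
Proof.
move=> BB; elim: k a b f => [|k IH] a b f ab H; split => //.
- by move=> y /BB By; apply: le_trans (maj0 H By) _.
- by move=> y /BB By; apply: le_trans (maj0 H By) _.
- by move=> i; apply: (IH (a \o succn)) => // [j|]; [exact: ab|exact: maj_pd].
Qed.

Lemma majW k B a f : maj k.+1 B a f -> maj k B a f.
Proof.
elim: k a f => [|k IH] a f H; split => //; try by move=> y; exact: maj0 H.
by move=> i; apply: IH; exact: maj_pd.
Qed.

Lemma maj_ext k B a f g : open B -> (forall y, B y -> f y = g y) ->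
  maj k B a f -> maj k B a g.
Proof.
move=> oB; elim: k a f g => [|k IH] a f g fg H; split => //.
- by move=> y By; rewrite -fg //; exact: maj0 H By.
- by move=> y By; rewrite -fg //; exact: maj0 H By.
- by move=> i; apply: IH (maj_pd i H) => y; exact: pd_ext.
Qed.

Lemma maj_add k B a b f g : open B -> Ck k B f -> Ck k B g ->
  maj k B a f -> maj k B b g -> maj k B (fun j => a j + b j) (fun y => f y + g y).
Proof.
move=> oB; elim: k a b f g => [|k IH] a b f g Cf Cg Hf Hg; split => //.
- move=> y By; apply: le_trans (ler_normD _ _) _.
  by rewrite lerD //; [exact: maj0 Hf By|exact: maj0 Hg By].
- move=> y By; apply: le_trans (ler_normD _ _) _.
  by rewrite lerD //; [exact: maj0 Hf By|exact: maj0 Hg By].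
- move=> i; apply: (@maj_ext _ _ _ (fun y => pd i f y + pd i g y)) => //.
    move=> y By; apply/esym.
    by have [_ <-] := iderD (Ck_der i Cf By) (Ck_der i Cg By).
  apply: (IH (a \o succn) (b \o succn)); by [exact: Ck_pd|exact: maj_pd].
Qed.

Lemma maj_mul k B a b f g : open B -> Ck k B f -> Ck k B g ->
  maj k B a f -> maj k B b g -> maj k B (bconv a b) (fun y => f y * g y).
Proof.
move=> oB; elim: k a b f g => [|k IH] a b f g Cf Cg Hf Hg; split => //.
- move=> y By; rewrite normrM /bconv big_ord1 bin0 mul1r.
  by rewrite ler_pM //; [exact: maj0 Hf By|exact: maj0 Hg By].
- move=> y By; rewrite normrM /bconv big_ord1 bin0 mul1r.
  by rewrite ler_pM //; [exact: maj0 Hf By|exact: maj0 Hg By].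
- move=> i; apply: (@maj_ext _ _ _ (fun y => pd i f y * g y + f y * pd i g y)) => //.
    move=> y By; apply/esym.
    by have [_ <-] := iderM (Ck_der i Cf By) (Ck_der i Cg By).
  apply: (@maj_le _ B _ (fun j => bconv (a \o succn) b j + bconv a (b \o succn) j)) => //.
    by move=> j; rewrite bconv_shift.
  apply: maj_add => //.
  + by apply: Ck_mul => //; [exact: Ck_pd|exact: CkW].
  + by apply: Ck_mul => //; [exact: CkW|exact: Ck_pd].
  + by apply: IH; [exact: Ck_pd|exact: CkW|exact: maj_pd|exact: majW].
  + by apply: IH; [exact: CkW|exact: Ck_pd|exact: majW|exact: maj_pd].
Qed.

Lemma maj_cst k B (c : R) a : open B -> (forall j, 0 <= a j) -> `|c| <= a 0 ->
  maj k B a (fun=> c).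
Proof.
move=> oB; elim: k c a => [|k IH] c a a0 ca; split => //.
move=> i; apply: (@maj_ext _ _ _ (fun=> 0)) => // [y _|].
  by apply/esym; have [_] := iderc c y (delta_mx i 0).
by apply: IH => [j|] //=; rewrite normr0.
Qed.

Lemma maj_coord k B a i : open B -> (forall j, 0 <= a j) ->
  (forall y, B y -> `|y i 0| <= a 0) -> 1 <= a 1 -> maj k B a (fun y => y i 0).
Proof.
move=> oB a0 yB a1; case: k => [|k]; split => //.
move=> j; apply: (@maj_ext _ _ _ (fun=> (delta_mx j 0 : V) i 0)) => // [y _|].
  by apply/esym; have [_] := ider_coord y (delta_mx j 0) i.
apply: maj_cst => // [l|]; first exact: a0.
by rewrite mxE /=; case: (_ && _) => //=; rewrite ?normr1 ?normr0 // a0.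
Qed.

Lemma maj_sum k B a (m : nat) (h : 'I_m -> V -> R) : open B ->
  (forall j, 0 <= a j) ->
  (forall i, Ck k B (h i)) -> (forall i, maj k B a (h i)) ->
  maj k B (fun j => m%:R * a j) (fun y => \sum_i h i y).
Proof.
move=> oB a0; elim: m h => [|m IH] h Ch Hh.
  apply: (@maj_ext _ _ _ (fun=> 0)) => // [y _|]; first by rewrite big_ord0.
  by apply: maj_cst => // [j|]; rewrite ?mul0r ?normr0.
apply: (@maj_ext _ _ _ (fun y => h ord0 y + \sum_(i < m) h (lift ord0 i) y)) => //.
  by move=> y _; rewrite big_ord_recl.
apply: (@maj_le _ B _ (fun j => a j + m%:R * a j)) => //.
  by move=> j; rewrite -[m.+1]add1n natrD mulrDl mul1r.
apply: maj_add => //; first by apply: Ck_sum.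
by apply: IH.
Qed.

End Dim.

Section CompMaj.
Variables (n m : nat) (B' : set 'cV[R]_n) (B : set 'cV[R]_m).
Variable g : 'cV[R]_n -> 'cV[R]_m.
Hypotheses (oB : open B) (oB' : open B') (gB : forall x, B' x -> B (g x)).
Hypothesis Cg : forall k j, Ck k B' (fun x => g x j 0 : R).

Lemma pd_comp f i x : Ck 1 B f -> B' x -> pd i (fun y => f (g y) : R) x =
  \sum_j pd i (fun x => g x j 0 : R) x * pd j f (g x).
Proof.
move=> Hf Bx; have [_] // : is_derive x (delta_mx i 0) (fun y => f (g y) : R)
  (\sum_j pd i (fun x => g x j 0 : R) x * pd j f (g x)).
by apply: (ider_comp oB gB) => // j; exact: (@Ck_der _ _ 0).
Qed.

(** Induction on the order, with l and C free: a derivative of f o g is a sum of m products of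
    derivatives of g with [pd j f] o g, and the majorant of [pd j f] is that of f with C * H for C
    and l.+1 for l. The loss 2 * m * A * H of one step is absorbed by one factor K. *)
Lemma maj_comp (A G H K : R) : 0 <= A -> 0 <= G -> 0 <= H -> 2 * G <= K ->
  2 * m%:R * A * H <= K ->
  (forall k i j, maj k B' (fun t => A * G ^+ t * t`!%:R) (pd i (fun x => g x j 0 : R))) ->
  forall k l (C : R) f, 0 <= C -> (forall k', Ck k' B f) ->
  (forall k', maj k' B (fun t => C * H ^+ t * (l + t)`!%:R) f) ->
  maj k B' (fun t => C * K ^+ t * (l + t)`!%:R) (fun x => f (g x) : R).
Proof.
move=> A0 G0 H0 GK HK Hg; have K0 : 0 <= K by apply: le_trans GK; rewrite mulr_ge0.
elim=> [|k IH] l C f C0 Cf Hf; split => //.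
- by move=> y By; apply: maj0 (Hf 0) _; exact: gB.
- by move=> y By; apply: maj0 (Hf 0) _; exact: gB.
move=> i; apply: (@maj_ext _ _ _ _
  (fun x => \sum_j pd i (fun x => g x j 0 : R) x * pd j f (g x))) => //.
  by move=> y By; rewrite pd_comp.
have E0 t : 0 <= 2 * A * (C * H) * K ^+ t * (l.+1 + t)`!%:R.
  by rewrite !mulr_ge0 ?exprn_ge0.
apply: (@maj_le _ _ B' _ (fun t => m%:R * (2 * A * (C * H) * K ^+ t * (l.+1 + t)`!%:R))) => //.
  move=> t /=; rewrite [(l + t.+1)%N]addnS -addSn exprS.
  rewrite [leLHS](_ : _ = (2 * m%:R * A * H) * (C * K ^+ t * (l.+1 + t)`!%:R)); last by ring.
  rewrite [leRHS](_ : _ = K * (C * K ^+ t * (l.+1 + t)`!%:R)); last by ring.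
  by rewrite ler_wpM2r // !mulr_ge0 ?exprn_ge0.
apply: maj_sum => // j.
  apply: Ck_mul => //; first exact: (@Ck_pd _ _ k).
  by apply: (Ck_comp oB' oB gB) => //; exact: Ck_pd (Cf _).
apply: (@maj_le _ _ B' _ (bconv (fun t => A * G ^+ t * t`!%:R)
   (fun t => (C * H) * K ^+ t * (l.+1 + t)`!%:R))) => //.
  by move=> t; apply: bconv_fact => //; exact: mulr_ge0.
apply: maj_mul => //.
- exact: (@Ck_pd _ _ k).
- by apply: (Ck_comp oB' oB gB) => //; exact: Ck_pd (Cf _).
- apply: IH => //; [exact: mulr_ge0|by move=> k'; exact: Ck_pd (Cf _)|move=> k'].
  apply: (@maj_le _ _ B _ ((fun t => C * H ^+ t * (l + t)`!%:R) \o succn)) => //.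
    by move=> t /=; rewrite exprS addnS mulrA.
  exact: (maj_pd _ (Hf k'.+1)).
Qed.

(* If [g] is an integral map of the fields [F i], then differentiating [f o g]
   amounts to applying the fields [F i] to [f]. *)
Lemma maj_ode (F : 'I_n -> 'I_m -> 'cV[R]_m -> R) (A G H K : R) :
  0 <= A -> 0 <= G -> 2 * G <= H -> 2 * m%:R * A * H <= K ->
  (forall k i j, Ck k B (F i j)) ->
  (forall i j x, B' x -> pd i (fun y => g y j 0 : R) x = F i j (g x)) ->
  (forall k i j, maj k B (fun t => A * G ^+ t * t`!%:R) (F i j)) ->
  forall k l (C : R) f, 0 <= C -> (forall k', Ck k' B f) ->
  (forall k', maj k' B (fun t => C * H ^+ t * (l + t)`!%:R) f) ->
  maj k B' (fun t => C * K ^+ t * (l + t)`!%:R) (fun x => f (g x) : R).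
Proof.
move=> A0 G0 GH HK CF dg MF; have H0 : 0 <= H by apply: le_trans GH; rewrite mulr_ge0.
have K0 : 0 <= K by apply: le_trans HK; rewrite !mulr_ge0.
elim=> [|k IH] l C f C0 Cf Hf; split => //.
- by move=> y By; apply: maj0 (Hf 0) _; exact: gB.
- by move=> y By; apply: maj0 (Hf 0) _; exact: gB.
move=> i; pose h y := \sum_j F i j y * pd j f y.
apply: (@maj_ext _ _ _ _ (fun x => h (g x))) => //.
  move=> y By; rewrite pd_comp // /h; apply: eq_bigr => j _.
  by rewrite dg.
have Ch k' : Ck k' B h.
  by apply: Ck_sum => // j; apply: Ck_mul => //; exact: Ck_pd (Cf _).
apply: (@maj_le _ _ B' _ (fun t => (m%:R * (2 * A * (C * H))) * K ^+ t * (l.+1 + t)`!%:R)) => //.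
  move=> t /=; rewrite [(l + t.+1)%N]addnS -addSn exprS.
  rewrite [leLHS](_ : _ = (2 * m%:R * A * H) * (C * K ^+ t * (l.+1 + t)`!%:R)); last by ring.
  rewrite [leRHS](_ : _ = K * (C * K ^+ t * (l.+1 + t)`!%:R)); last by ring.
  by rewrite ler_wpM2r // !mulr_ge0 ?exprn_ge0.
apply: IH => // [|k']; first by rewrite !mulr_ge0.
apply: (@maj_le _ _ B _ (fun t => m%:R * (2 * A * (C * H) * H ^+ t * (l.+1 + t)`!%:R))) => //.
  by move=> t; rewrite !mulrA.
apply: maj_sum => // [t|j|j]; first by rewrite !mulr_ge0 ?exprn_ge0.
  by apply: Ck_mul => //; exact: Ck_pd (Cf _).
apply: (@maj_le _ _ B _ (bconv (fun t => A * G ^+ t * t`!%:R)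
   (fun t => (C * H) * H ^+ t * (l.+1 + t)`!%:R))) => //.
  by move=> t; apply: bconv_fact => //; exact: mulr_ge0.
apply: maj_mul => //; first exact: Ck_pd (Cf _).
apply: (@maj_le _ _ B _ ((fun t => C * H ^+ t * (l + t)`!%:R) \o succn)) => //.
  by move=> t /=; rewrite exprS addnS mulrA.
exact: (maj_pd _ (Hf k'.+1)).
Qed.

End CompMaj.
End Majorants.

(** * The functions of the category and their closure properties *)

Section Class.
Variable R : realType.

(* Analyticity as Cauchy estimates on all derivatives; this is the form in which
   it is stable under composition, differential equations and limits. *)
Definition ana (n : nat) (U : set 'cV[R]_n) (f : 'cV[R]_n -> R) : Prop :=
  forall x, U x -> exists r A H : R, [/\ 0 < r, 0 < A, 0 < H,
    (ball x r : set 'cV[R]_n) `<=` U &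
    forall k, maj k (ball x r) (fun j => A * H ^+ j * j`!%:R) f].

(** Smoothness is demanded in both categories, so that the differential calculus is common to
    them. *)
Definition cls (cat : category) (n : nat) (U : set 'cV[R]_n) (f : 'cV[R]_n -> R) :=
  (forall k, Ck k U f) /\ (cat = RealAnalytic -> ana U f).

Variable cat : category.

Section Basic.
Variable n : nat.
Notation V := 'cV[R]_n.
Implicit Types (f g : V -> R) (U W : set V) (x y : V).

Lemma cls_Ck k U f : cls cat U f -> Ck k U f.
Proof. by case. Qed.

Lemma cls_cont U f x : cls cat U f -> U x -> {for x, continuous f}.
Proof. by move=> H; exact: Ck_cont (cls_Ck 0 H). Qed.

Lemma cls_der U f x i : cls cat U f -> U x ->
  is_derive x (delta_mx i 0) f (pd i f x).
Proof. by move=> [/(_ 1%N)/Ck_der h _] Ux; exact: h. Qed.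

Lemma cls_ider U f x v : open U -> cls cat U f -> U x ->
  is_derive x v f (\sum_i v i 0 * pd i f x).
Proof. by move=> oU [/(_ 1%N) h _] Ux; apply: C1_ider; exact: Ck1_C1at h Ux. Qed.

Lemma cls_ext U f g : open U -> (forall y, U y -> f y = g y) ->
  cls cat U f -> cls cat U g.
Proof.
move=> oU fg [fk fa]; split=> [k|/fa H]; first exact: Ck_ext (fk k).
move=> x Ux; have [r [A [K [r0 A0 K0 rU Hm]]]] := H x Ux.
exists r, A, K; split => // k; apply: maj_ext (Hm k); first exact: ball_opencv.
by move=> y /rU; exact: fg.
Qed.

Lemma cls_sub U W f : open W -> W `<=` U -> cls cat U f -> cls cat W f.
Proof.
move=> oW WU [fk fa]; split=> [k|/fa H]; first exact: Ck_sub (fk k).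
move=> x Wx; have [r [A [K [r0 A0 K0 rU Hm]]]] := H x (WU _ Wx).
have [s s0 sW] := open_ballcv oW Wx.
exists (Order.min r s), A, K; split => //; first by rewrite lt_min r0.
  by apply: subset_trans sW; apply: ball_le_sub; rewrite ge_min lexx orbT.
move=> k; apply: maj_le (Hm k) => //.
by apply: ball_le_sub; rewrite ge_min lexx.
Qed.

Lemma ana_pd U f i : ana U f -> ana U (pd i f).
Proof.
move=> Ha y Wy; have [r [A [K [r0 A0 K0 rU Hm]]]] := Ha y Wy.
exists r, (A * K), (2 * K); split => //; rewrite ?mulr_gt0 // => j.
apply: maj_le (maj_pd i (Hm j.+1)) => // t /=.
(* The factor t.+1 from the shifted factorial is at most 2 ^ t, which doubles the geometric
   constant. *)
rewrite [leLHS](_ : _ = (A * K * K ^+ t * t`!%:R) * t.+1%:R); last first.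
  by rewrite exprS factS natrM; ring.
rewrite [leRHS](_ : _ = (A * K * K ^+ t * t`!%:R) * 2 ^+ t); last first.
  by rewrite exprMn; ring.
apply: ler_wpM2l; first by rewrite !mulr_ge0 ?exprn_ge0 // ltW.
by rewrite -natrX ler_nat ltn_expl.
Qed.

Lemma maj_fact_le k x r r' (A A' K K' : R) f : r' <= r -> 0 <= A -> 0 <= K ->
  A <= A' -> K <= K' -> maj k (ball x r) (fun j => A * K ^+ j * j`!%:R) f ->
  maj k (ball x r') (fun j => A' * K' ^+ j * j`!%:R) f.
Proof.
move=> rr A0 K0 AA KK; apply: maj_le => [|j]; first exact: ball_le_sub.
rewrite ler_wpM2r //; apply: ler_pM => //; first exact: exprn_ge0.
by apply: lerXn2r; rewrite ?nnegrE //; apply: le_trans KK.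
Qed.

Lemma ana_unif U (m : nat) (f : 'I_m -> V -> R) x : open U -> U x ->
  (forall i, ana U (f i)) -> exists r A H : R, [/\ 0 < r, 0 < A, 0 < H,
    (ball x r : set V) `<=` U &
    forall i k, maj k (ball x r) (fun j => A * H ^+ j * j`!%:R) (f i)].
Proof.
move=> oU Ux fa.
have [r /choice[A /choice[K HA]]] := choice (fun i => fa i x Ux).
have [s s0 sU] := open_ballcv oU Ux.
exists (\big[Order.min/s]_i r i), (1 + \sum_i A i), (1 + \sum_i K i); split.
- by apply/bigmin_gtP; split => // i _; case: (HA i).
- by rewrite ltr_pwDl // sumr_ge0 // => i _; apply: ltW; case: (HA i).
- by rewrite ltr_pwDl // sumr_ge0 // => i _; apply: ltW; case: (HA i).
- by apply: subset_trans sU; apply: ball_le_sub; exact: bigmin_le_id.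
move=> i k; have [r0 A0 K0 _ H] := HA i.
apply: maj_fact_le (H k); rewrite ?(ltW A0) ?(ltW K0) //; first exact: bigmin_le.
- rewrite (bigD1 i) //= addrCA lerDl addr_ge0 // sumr_ge0 // => j _.
  by apply: ltW; case: (HA j).
- rewrite (bigD1 i) //= addrCA lerDl addr_ge0 // sumr_ge0 // => j _.
  by apply: ltW; case: (HA j).
Qed.

Lemma ana_unif2 U f g x : open U -> U x -> ana U f -> ana U g ->
  exists r A H : R, [/\ 0 < r, 0 < A, 0 < H, (ball x r : set V) `<=` U &
    forall k, maj k (ball x r) (fun j => A * H ^+ j * j`!%:R) f /\
              maj k (ball x r) (fun j => A * H ^+ j * j`!%:R) g].
Proof.
move=> oU Ux fa ga.
have [|r [A [H [r0 A0 H0 rU Hm]]]] :=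
  @ana_unif U 2 (fun i => if i == 0 then f else g) x oU Ux.
  by move=> i; case: ifP.
exists r, A, H; split => // k; split; first exact: (Hm 0).
exact: (Hm 1).
Qed.

Lemma cls_loc U f : (forall x, U x -> exists2 W, open W & W x /\ cls cat W f) ->
  open U -> cls cat U f.
Proof.
move=> H oU; split=> [k|E].
  elim: k f H => [|k IH] f H.
    by split => // x /H[W oW [Wx fW]]; exact: cls_cont fW Wx.
  apply: CkS => [x|i]; first by move=> /H[W oW [Wx fW]]; exact: cls_cont fW Wx.
  split; last by move=> x /H[W oW [Wx fW]]; exact: cls_der fW Wx.
  apply: IH => x /H[W oW [Wx [fk fa]]]; exists W => //; split => //.
  by split=> [j|/fa Ha]; [exact: Ck_pd (fk j.+1)|exact: ana_pd].
move=> x Ux; have [W oW [Wx [_ /(_ E) Wa]]] := H x Ux.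
have [r [A [K [r0 A0 K0 rU Hm]]]] := Wa x Wx.
have [s s0 sU] := open_ballcv oU Ux.
exists (Order.min r s), A, K; split => //; first by rewrite lt_min r0.
  by apply: subset_trans sU; apply: ball_le_sub; rewrite ge_min lexx orbT.
move=> k; apply: maj_le (Hm k) => //.
by apply: ball_le_sub; rewrite ge_min lexx.
Qed.

Lemma cls_pd U f i : cls cat U f -> cls cat U (pd i f).
Proof.
move=> [fk fa]; by split=> [j|/fa Ha]; [exact: Ck_pd (fk j.+1)|exact: ana_pd].
Qed.

Lemma cls_cst U (a : R) : open U -> cls cat U (fun=> a).
Proof.
move=> oU; split=> [k|_ x Ux]; first exact: Ck_cst.
have [s s0 sU] := open_ballcv oU Ux.
exists s, (`|a| + 1), 1; split => //.
move=> k; apply: maj_cst; first exact: ball_opencv.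
  by move=> j; rewrite !mulr_ge0 ?exprn_ge0 // addr_ge0.
by rewrite expr0 fact0 !mulr1 lerDl.
Qed.

Lemma cls_coord U i : open U -> cls cat U (fun y => y i 0).
Proof.
move=> oU; split=> [k|_ x Ux]; first exact: Ck_coord.
have [s s0 sU] := open_ballcv oU Ux.
exists s, (`|x| + s + 1), 1; split => //; first by rewrite ltr_wpDl // addr_ge0 // ltW.
have A1 : 1 <= `|x| + s + 1 by rewrite lerDr addr_ge0 // ltW.
move=> k; apply: maj_coord; first exact: ball_opencv.
- by move=> j; rewrite !mulr_ge0 ?exprn_ge0 //; apply: le_trans A1.
- move=> y /ballcvP yx; rewrite expr0 fact0 !mulr1.
  apply: le_trans (coord_le_cvnorm y i) _.
  have -> : y = x + (y - x) by rewrite addrC subrK.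
  apply: le_trans (ler_normD _ _) _; rewrite -addrA lerD2l; apply: le_trans (ltW yx) _.
  by rewrite lerDl.
- by rewrite expr1n (_ : 1`! = 1%N) // !mulr1.
Qed.

Lemma cls_add U f g : open U -> cls cat U f -> cls cat U g ->
  cls cat U (fun y => f y + g y).
Proof.
move=> oU [fk fa] [gk ga]; split=> [k|E x Ux]; first exact: Ck_add.
have [r [A [K [r0 A0 K0 rU Hm]]]] := ana_unif2 oU Ux (fa E) (ga E).
exists r, (A + A), K; split => //; first exact: addr_gt0.
move=> k; have oB : open (ball x r : set V) by exact: ball_opencv.
apply: (@maj_le _ _ _ (ball x r) _ (fun j => A * K ^+ j * j`!%:R + A * K ^+ j * j`!%:R)) => //.
  by move=> j; rewrite !mulrDl.
by have [? ?] := Hm k; apply: maj_add => //; [exact: Ck_sub (fk k)|exact: Ck_sub (gk k)].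
Qed.

Lemma cls_mul U f g : open U -> cls cat U f -> cls cat U g ->
  cls cat U (fun y => f y * g y).
Proof.
move=> oU [fk fa] [gk ga]; split=> [k|E x Ux]; first exact: Ck_mul.
have [r [A [K [r0 A0 K0 rU Hm]]]] := ana_unif2 oU Ux (fa E) (ga E).
exists r, (2 * A * A), (2 * K); split => //; rewrite ?mulr_gt0 //.
move=> k; have oB : open (ball x r : set V) by exact: ball_opencv.
apply: (@maj_le _ _ _ (ball x r) _
  (bconv (fun j => A * K ^+ j * j`!%:R) (fun j => A * (2 * K) ^+ j * (0 + j)`!%:R))) => //.
  by move=> j; apply: (@bconv_fact R A A (2 * K) K 0 j) => //; exact: ltW.
have [? ?] := Hm k.
apply: maj_mul => //; [exact: Ck_sub (fk k)|exact: Ck_sub (gk k)|].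
apply: (@maj_fact_le _ _ r _ A _ K) => //; first exact: ltW.
  exact: ltW.
by rewrite ler_peMl ?ler1n // ltW.
Qed.

Lemma cls_sum U (I : Type) (r : seq I) (P : pred I) (h : I -> V -> R) : open U ->
  (forall i, P i -> cls cat U (h i)) -> cls cat U (fun y => \sum_(i <- r | P i) h i y).
Proof.
move=> oU H; elim: r => [|i r IH].
  by apply: (@cls_ext _ (fun=> 0)) (cls_cst _ oU) => // y _; rewrite big_nil.
apply: (@cls_ext _ (fun y => if P i then h i y + \sum_(i <- r | P i) h i y
  else \sum_(i <- r | P i) h i y)) => //.
  by move=> y _; rewrite big_cons; case: ifP.
by case Pi: (P i) => //; apply: cls_add => //; exact: H.
Qed.

Lemma cls_prod U (I : Type) (r : seq I) (P : pred I) (h : I -> V -> R) : open U ->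
  (forall i, P i -> cls cat U (h i)) -> cls cat U (fun y => \prod_(i <- r | P i) h i y).
Proof.
move=> oU H; elim: r => [|i r IH].
  by apply: (@cls_ext _ (fun=> 1)) (cls_cst _ oU) => // y _; rewrite big_nil.
apply: (@cls_ext _ (fun y => if P i then h i y * \prod_(i <- r | P i) h i y
  else \prod_(i <- r | P i) h i y)) => //.
  by move=> y _; rewrite big_cons; case: ifP.
by case Pi: (P i) => //; apply: cls_mul => //; exact: H.
Qed.

Lemma cls_opp U f : open U -> cls cat U f -> cls cat U (fun y => - f y).
Proof.
move=> oU Hf; apply: (@cls_ext _ (fun y => (-1) * f y)) => //.
  by move=> y _; rewrite mulN1r.
by apply: cls_mul => //; exact: cls_cst.
Qed.

Lemma cls_sub_fun U f g : open U -> cls cat U f -> cls cat U g ->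
  cls cat U (fun y => f y - g y).
Proof. by move=> oU Hf Hg; apply: cls_add => //; exact: cls_opp. Qed.

Lemma cls_prim U f (df : 'I_n -> V -> R) : open U ->
  (forall x i, U x -> is_derive x (delta_mx i 0) f (df i x)) ->
  (forall x, U x -> {for x, continuous f}) ->
  (forall i, cls cat U (df i)) -> cls cat U f.
Proof.
move=> oU fd fc dfc; split=> [[|k]|E x Ux]; first by split.
  apply: (@CkS_ider _ _ _ _ _ df); [exact: oU|exact: fc|].
  by move=> i; exact: cls_Ck.
have [c c0 Hc] := iffLR (continuous_forP _ _) (fc x Ux) 1 ltr01.
have [r [A [K [r0 A0 K0 rU Hm]]]] := ana_unif oU Ux (fun i => (dfc i).2 E).
have mr : Order.min r c <= r by rewrite ge_min lexx.
have F0 : 0 <= `|f x| + 1 by rewrite addr_ge0.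
(* On the smaller ball f is bounded by |f x| + 1; a geometric constant above 1 makes the shift of
   the order between f and its partial derivatives harmless. *)
exists (Order.min r c), (A + (`|f x| + 1)), (K + 1); split.
- by rewrite lt_min r0.
- exact: ltr_wpDr.
- by rewrite addr_gt0.
- by apply: subset_trans rU; exact: ball_le_sub.
have H0 y : ball x (Order.min r c) y ->
    `|f y| <= (A + (`|f x| + 1)) * (K + 1) ^+ 0 * 0`!%:R.
  move=> yb; rewrite expr0 fact0 !mulr1.
  have -> : f y = (f y - f x) + f x by rewrite subrK.
  apply: le_trans (ler_normD _ _) _.
  have : `|f y - f x| <= 1 by apply: Hc; apply: ball_le_sub yb; rewrite ge_min lexx orbT.
  by move: A0; lra.
case=> [|k]; split => // i.
have oB : open (ball x (Order.min r c) : set V) by exact: ball_opencv.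
apply: (@maj_ext _ _ _ _ _ (df i)) => //.
  move=> y /(ball_le_sub mr)/rU Uy; apply/esym.
  by have [_ <-] := fd y i Uy.
apply: maj_le (Hm i k) => [|j /=]; first exact: ball_le_sub.
rewrite exprS factS natrM.
rewrite [leRHS](_ : _ = (A + (`|f x| + 1)) * (K + 1) ^+ j * j`!%:R * ((K + 1) * j.+1%:R)); last by ring.
rewrite -[leLHS]mulr1; apply: ler_pM => //.
- by rewrite !mulr_ge0 ?exprn_ge0 ?ltW.
- rewrite ler_wpM2r //; apply: ler_pM; [exact: ltW|by rewrite exprn_ge0 // ltW|by rewrite lerDl|].
  by apply: lerXn2r; rewrite ?nnegrE; lra.
- by rewrite -[leLHS]mulr1; apply: ler_pM; rewrite ?ler1n //; move: K0; lra.
Qed.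

End Basic.

Section Composition.
Variables (n m : nat) (W : set 'cV[R]_n) (U : set 'cV[R]_m).
Variable g : 'cV[R]_n -> 'cV[R]_m.
Hypotheses (oW : open W) (oU : open U) (gWU : forall x, W x -> U (g x)).

Lemma preim_ball x (r : R) : W x -> 0 < r ->
  (forall j, {for x, continuous (fun y => g y j 0 : R)}) ->
  exists2 d : R, 0 < d & ball x d `<=` W /\ forall y, ball x d y -> ball (g x) r (g y).
Proof.
move=> Wx r0 gc; have [d d0 dW] := open_ballcv oW Wx.
have gx : {for x, continuous g} by exact: (@cvg_coordP _ _ _ _ (nbhs_filter x)).
have [e e0 He] : exists2 e : R, 0 < e & forall y, ball x e y -> ball (g x) r (g y).
  have := gx (ball (g x) r) (nbhsx_ballx _ _ r0).
  by move=> /nbhs_ballcv[e e0 He]; exists e.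
exists (Order.min d e); first by rewrite lt_min d0.
split=> [|y yb]; first by apply: subset_trans dW; apply: ball_le_sub; rewrite ge_min lexx.
by apply: He; apply: ball_le_sub yb; rewrite ge_min lexx orbT.
Qed.

Lemma cls_comp f : cls cat U f -> (forall j, cls cat W (fun x => g x j 0 : R)) ->
  cls cat W (fun x => f (g x) : R).
Proof.
move=> [fk fa] gk; split=> [k|E x Wx].
  by apply: (Ck_comp oW oU gWU) => // j; exact: cls_Ck.
have [s [C [H [s0 C0 H0 sU Hf]]]] := fa E _ (gWU Wx).
have [r [A [G [r0 A0 G0 rW Hg]]]] := ana_unif oW Wx (fun j => (gk j).2 E).
have [d d0 [dW Hd]] := preim_ball Wx s0 (fun j => cls_cont (gk j) Wx).
(* The partial derivatives of g have the constants A * G and 2 * G, by t.+1 <= 2 ^ t as for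
   [ana_pd]; K is the sum of the two lower bounds that [maj_comp] asks for. *)
pose K := 2 * (2 * G) + 2 * m%:R * (A * G) * H.
have K1 : 0 <= 2 * m%:R * (A * G) * H by rewrite !mulr_ge0 // ltW.
have K0 : 0 < K by rewrite ltr_pwDl // !mulr_gt0.
have mr : Order.min d r <= r by rewrite ge_min lexx orbT.
have md : Order.min d r <= d by rewrite ge_min lexx.
exists (Order.min d r), C, K; split => //.
- by rewrite lt_min d0.
- by apply: subset_trans dW; exact: ball_le_sub.
move=> k; apply: (@maj_comp _ _ _ _ (ball (g x) s) g _ _ _ _ (A * G) (2 * G) H K _ _ _ _ _ _ k 0 C f) => //.
- exact: ball_opencv.
- exact: ball_opencv.
- by move=> y yb; apply: Hd; exact: ball_le_sub yb.
- by move=> k' j; apply: Ck_sub (cls_Ck k' (gk j)); apply: subset_trans dW; exact: ball_le_sub.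
- by rewrite mulr_ge0 ?ltW.
- by rewrite mulr_ge0 ?ltW.
- exact: ltW.
- by rewrite /K lerDl.
- by rewrite /K lerDr mulr_ge0 // mulr_ge0 // ltW.
- move=> k' i j; apply: maj_le (maj_pd i (Hg j k'.+1)) => [|t /=]; first exact: ball_le_sub.
  rewrite [leLHS](_ : _ = (A * G * G ^+ t * t`!%:R) * t.+1%:R); last first.
    by rewrite exprS factS natrM; ring.
  rewrite [leRHS](_ : _ = (A * G * G ^+ t * t`!%:R) * 2 ^+ t); last first.
    by rewrite exprMn; ring.
  apply: ler_wpM2l; first by rewrite !mulr_ge0 ?exprn_ge0 // ltW.
  by rewrite -natrX ler_nat ltn_expl.
- exact: ltW.
- by move=> k'; exact: Ck_sub (fk k').
Qed.

(** The regularity principle behind elementary functions and inverse maps. In the analytic case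
    [maj_ode] is applied to the coordinate functions composed with g. *)
Lemma cls_ode (F : 'I_n -> 'I_m -> 'cV[R]_m -> R) :
  (forall i j, cls cat U (F i j)) ->
  (forall x j, W x -> {for x, continuous (fun y => g y j 0 : R)}) ->
  (forall i j x, W x ->
     is_derive x (delta_mx i 0) (fun y => g y j 0 : R) (F i j (g x))) ->
  forall j, cls cat W (fun x => g x j 0 : R).
Proof.
move=> HF gc Hg j; have gk := Ck_ode oW oU gWU (fun k i j => cls_Ck k (HF i j)) gc Hg.
split=> // E x Wx.
have [r [A [G [r0 A0 G0 rU Hm]]]] := @ana_unif m U #|{: 'I_n * 'I_m}|
   (fun i => F (enum_val i).1 (enum_val i).2) (g x) oU (gWU Wx) (fun i => (HF _ _).2 E).
have [d d0 [dW Hd]] := preim_ball Wx r0 (fun j => gc x j Wx).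
have HmF k i l : maj k (ball (g x) r) (fun j => A * G ^+ j * j`!%:R) (F i l).
  by have := Hm (enum_rank (i, l)) k; rewrite enum_rankK.
pose H := 2 * G; pose K := 2 * m%:R * A * H + 1.
have H0 : 0 < H by rewrite mulr_gt0.
have K1 : 0 <= 2 * m%:R * A * H by rewrite !mulr_ge0 // ltW.
(* The first two terms bound the coordinates on the ball; the last one gives C * H >= 1, the bound
   for the first derivatives of a coordinate. *)
pose C := `|g x| + r + H^-1.
have C0 : 0 < C by rewrite ltr_wpDl // ?invr_gt0 // addr_ge0 // ltW.
exists d, C, K; split => //; first exact: ltr_wpDl.
move=> k; apply: (@maj_ode _ _ _ (ball x d) (ball (g x) r) g _ _ _ _ F A G H K _ _ _ _ _ _ _ k 0 C (fun y => y j 0)) => //.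
- exact: ball_opencv.
- exact: ball_opencv.
- by move=> k' l; exact: Ck_sub (gk k' l).
- exact: ltW.
- exact: ltW.
- by rewrite /K lerDl.
- by move=> k' i l; apply: Ck_sub (cls_Ck k' (HF i l)).
- by move=> i l y yb; have [_ <-] := Hg i l y (dW _ yb).
- exact: ltW.
- by move=> k'; apply: Ck_coord; exact: ball_opencv.
move=> k'; apply: maj_coord; first exact: ball_opencv.
- by move=> t; rewrite !mulr_ge0 ?exprn_ge0 // ltW.
- move=> y /ballcvP yx; rewrite expr0 fact0 !mulr1.
  apply: le_trans (coord_le_cvnorm y j) _.
  have -> : y = g x + (y - g x) by rewrite addrC subrK.
  apply: le_trans (ler_normD _ _) _; rewrite /C -addrA lerD2l; apply: le_trans (ltW yx) _.
  by rewrite lerDl invr_ge0 ltW.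
- rewrite expr1 (_ : (0 + 1)`! = 1%N) // mulr1 /C mulrDl mulVf ?gt_eqF // lerDr.
  by rewrite mulr_ge0 ?addr_ge0 // ltW.
Qed.

End Composition.
End Class.

(** * Elementary functions as solutions of differential equations *)

Section Elementary.
Variables (R : realType) (cat : category).

Lemma ider_1 (h : R -> R) (y : 'cV[R]_1) (i : 'I_1) d :
  is_derive (y 0 0 : R) 1 h d ->
  is_derive y (delta_mx i 0) (fun y => h (y 0 0) : R) d.
Proof.
move=> /is_deriveP H; apply/is_deriveP => e e0.
have [del del0 Hd] := H e e0; exists del => // t /Hd.
by rewrite (ord1 i) !mxE eqxx.
Qed.

(** Functions of one variable are regarded as functions of a column of length one, so that the
    results in several variables apply to them. *)
Definition up (W : set R) : set 'cV[R]_1 := [set y | W (y 0 0)].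

Lemma open_up W : open W -> open (up W).
Proof.
move=> oW; have -> : up W = (fun y : 'cV[R]_1 => y 0 0 : R) @^-1` W by [].
by apply: open_comp => // y _; exact: coord_continuous.
Qed.

Definition cls1 (W : set R) (h : R -> R) :=
  cls cat (up W) (fun y : 'cV[R]_1 => h (y 0 0)).

Lemma cls1_comp n (U : set 'cV[R]_n) (W : set R) h f : open U -> open W ->
  cls1 W h -> cls cat U f -> (forall x, U x -> W (f x)) ->
  cls cat U (fun x => h (f x)).
Proof.
move=> oU oW Hh Hf UW.
have := @cls_comp R cat n 1 U (up W) (fun x => const_mx (f x)) oU (open_up oW) _ _ Hh.
move=> H; apply: (cls_ext oU _ (H _ _)) => [y _|x Ux|j].
- by rewrite mxE.
- by rewrite /up /= mxE; exact: UW.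
- by apply: (cls_ext oU _ Hf) => y _; rewrite mxE.
Qed.

Lemma ider_continuous1 (h : R -> R) (s d : R) : is_derive s 1 h d ->
  {for s, continuous h}.
Proof. by case=> /derivable1_diffP/differentiable_continuous. Qed.

(** Applied to F z = - z^2 for the inverse, 1 / (2 z) for the square root and z for the
    exponential. *)
Lemma cls1_ode (W W' : set R) h F : open W -> open W' ->
  (forall s, W s -> W' (h s)) -> cls1 W' F ->
  (forall s, W s -> is_derive s 1 h (F (h s))) -> cls1 W h.
Proof.
move=> oW oW' WW HF Hh.
have oU := open_up oW; have oU' := open_up oW'.
have := @cls_ode R cat 1 1 (up W) (up W') (fun y => const_mx (h (y 0 0))) oU oU'
   _ (fun _ _ y => F (y 0 0)) _ _ _ 0.
move=> H; apply: (cls_ext oU _ (H _ _ _ _)) => [y _|x Ux|i j|x j Ux|i j x Ux].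
- by rewrite mxE.
- by rewrite /up /= mxE; exact: WW.
- exact: HF.
- have -> : (fun y : 'cV[R]_1 => (const_mx (h (y 0 0)) : 'cV[R]_1) j 0 : R)
    = (fun y : 'cV[R]_1 => h (y 0 0)) by apply/funext => y; rewrite mxE.
  have c1 := @continuous_for_coord R 1 0 x.
  exact: (continuous_comp c1 (ider_continuous1 (Hh _ Ux))).
- have -> : (fun y : 'cV[R]_1 => (const_mx (h (y 0 0)) : 'cV[R]_1) j 0 : R)
    = (fun y : 'cV[R]_1 => h (y 0 0)) by apply/funext => y; rewrite mxE.
  by rewrite mxE; apply: ider_1; exact: Hh.
Qed.

Lemma cls1_id W : open W -> cls1 W id.
Proof. by move=> oW; apply: cls_coord; exact: open_up. Qed.

Lemma open_neq0 : open [set s : R | s != 0].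
Proof.
have -> : [set s : R | s != 0] = ~` [set 0].
  by apply/seteqP; split => x /= /eqP.
by rewrite openC; exact: closed_eq.
Qed.

Lemma cls1_inv : cls1 [set s | s != 0] (fun s => s^-1).
Proof.
apply: (@cls1_ode _ [set s | s != 0] _ (fun z => - (z * z))); try exact: open_neq0.
- by move=> s /= s0; rewrite invr_eq0.
- have o := open_up open_neq0.
  by apply: cls_opp => //; apply: cls_mul => //; exact: cls_coord.
- move=> s /= s0; apply: DeriveDef.
    by apply: (@derivableV R R (id : R -> R) s 1 s0); exact: derivable_id.
  have := @deriveV R R (id : R -> R) s 1 s0; rewrite derive_id [_ *: 1]mulr1 expr2 invfM => <- //.
Qed.

Lemma cls_inv n (U : set 'cV[R]_n) f : open U -> cls cat U f ->
  (forall x, U x -> f x != 0) -> cls cat U (fun x => (f x)^-1).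
Proof. by move=> oU Hf f0; apply: cls1_comp open_neq0 cls1_inv Hf f0. Qed.

Lemma cls_sqrt n (U : set 'cV[R]_n) f : open U -> cls cat U f ->
  (forall x, U x -> 0 < f x) -> cls cat U (fun x => Num.sqrt (f x)).
Proof.
move=> oU Hf f0; apply: (@cls1_comp _ _ [set s : R | 0 < s] Num.sqrt f) => //.
apply: (@cls1_ode _ [set s | 0 < s] _ (fun z => (2 * z)^-1)); try exact: open_gt.
- by move=> s /=; rewrite sqrtr_gt0.
- have o : open (up [set s : R | 0 < s]) by apply: open_up; exact: open_gt.
  apply: cls_inv => //; first by apply: cls_mul => //; [exact: cls_cst|exact: cls_coord].
  by move=> x /= x0; rewrite mulf_neq0 // gt_eqF.
Qed.

Lemma cls_exp n (U : set 'cV[R]_n) f : open U -> cls cat U f ->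
  cls cat U (fun x => expR (f x)).
Proof.
move=> oU Hf; apply: (@cls1_comp _ _ setT expR f) => //; first exact: openT.
apply: (@cls1_ode _ setT _ id); try exact: openT; try by [].
by apply: cls1_id; exact: openT.
Qed.

(** Neither function solves an autonomous equation of first order on its own; the pair solves (a,
    b)' = (- b, a). *)
Lemma cls1_cos_sin : cls1 setT cos /\ cls1 setT sin.
Proof.
pose g (y : 'cV[R]_1) : 'cV[R]_2 := \col_j if j == 0 then cos (y 0 0) else sin (y 0 0).
have oT : open (up setT) by exact: open_up openT.
have oT2 : open [set: 'cV[R]_2] by exact: openT.
have gE j : (fun y : 'cV[R]_1 => g y j 0 : R) =
    (fun y => (if j == 0 then cos else sin) (y 0 0)).
  by apply/funext => y; rewrite mxE; case: ifP.
pose F (i : 'I_1) (j : 'I_2) (z : 'cV[R]_2) : R := if j == 0 then - z 1 0 else z 0 0.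
have dE j (s : R) : is_derive s 1 (if j == 0 :> 'I_2 then @cos R else @sin R)
    (if j == 0 then - sin s else cos s).
  by case: ifP => _; [exact: is_derive_cos|exact: is_derive_sin].
have H := @cls_ode R cat 1 2 (up setT) setT g oT oT2 _ F _ _ _.
have {}H j : cls cat (up setT) (fun y => g y j 0).
  apply: H => // [i k|x k _|i k x _].
  - rewrite /F; case: (k == 0); last exact: cls_coord.
    by apply: cls_opp => //; exact: cls_coord.
  - rewrite gE; have c1 := @continuous_for_coord R 1 0 x.
    exact: (continuous_comp c1 (ider_continuous1 (dE k _))).
  - rewrite gE; apply: ider_1; rewrite /F /g !mxE /=.
    exact: dE.
split; first by have := H 0; rewrite gE.
by have := H 1; rewrite gE.
Qed.

Lemma cls_cos n (U : set 'cV[R]_n) f : open U -> cls cat U f ->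
  cls cat U (fun x => cos (f x)).
Proof.
by move=> oU Hf; apply: (@cls1_comp _ _ setT cos f) => //; [exact: openT|case: cls1_cos_sin].
Qed.

Lemma cls_sin n (U : set 'cV[R]_n) f : open U -> cls cat U f ->
  cls cat U (fun x => sin (f x)).
Proof.
by move=> oU Hf; apply: (@cls1_comp _ _ setT sin f) => //; [exact: openT|case: cls1_cos_sin].
Qed.

End Elementary.

(** * The Poincare lemma *)

Section Limits.
Variable R : realType.
Implicit Types (u : nat -> R) (l : R).

Definition tends u l := forall e, 0 < e -> exists N0, forall N, (N0 <= N)%N -> `|u N - l| <= e.

Lemma tendsP u l : tends u l <-> u @ \oo --> l.
Proof.
split=> [H|/cvgrPdist_le H e e0].
  apply/cvgrPdist_le => e e0; have [N0 HN] := H e e0.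
  by exists N0 => // N /HN; rewrite distrC.
by have [N0 _ HN] := H e e0; exists N0 => N /HN; rewrite distrC.
Qed.

Lemma tends_harmonic (C : R) : tends (fun N => C / N.+1%:R) 0.
Proof.
apply/tendsP; rewrite -[X in _ --> X](mulr0 C).
apply: cvgM; first exact: cvg_cst.
exact: cvg_harmonic.
Qed.

Lemma tends_uniq u l l' : tends u l -> tends u l' -> l = l'.
Proof. by move=> /tendsP h /tendsP h'; exact: (cvg_unique _ h h'). Qed.

Lemma cauchy_tends u (ep : nat -> R) : tends ep 0 ->
  (forall N M, `|u N - u M| <= ep N + ep M) -> exists l, tends u l.
Proof.
move=> ep0 H; suff : cvgn u by move=> /cvg_ex[l /tendsP ul]; exists l.
apply: cauchy_cvg; apply/cauchy_ballP => e e0.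
have [N0 HN] := ep0 (e / 3) (divr_gt0 e0 (ltr0n _ 3)).
exists (([set u N | N in [set N | (N0 <= N)%N]]), ([set u N | N in [set N | (N0 <= N)%N]])) => /=.
  by split; exists N0 => // N /= h; exists N.
move=> [a b] /= [[N hN <-] [M hM <-]].
rewrite -ball_normE /ball_ /=; apply: le_lt_trans (H N M) _.
have := HN N hN; have := HN M hM; rewrite !subr0 !ler_norml.
by move=> /andP[_ h1] /andP[_ h2]; lra.
Qed.

End Limits.

Section UniformLimit.
Variables (R : realType) (n : nat).
Notation V := 'cV[R]_n.
Variables (c : V) (r : R) (F : nat -> V -> R) (ep : nat -> R).
Hypothesis (ep0 : tends ep 0).

(** The mean value theorem for F N - F M bounds the increments of this difference by |t| times a
    quantity independent of t; letting M grow, the same holds for F N - f, and the expansion of a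
    single F N passes to f. *)
Lemma unif_lim_der (f g : V -> R) i x :
  (forall N y, ball c r y -> derivable (F N) y (delta_mx i 0)) ->
  (forall N y, ball c r y -> `|pd i (F N) y - g y| <= ep N) ->
  (forall y, ball c r y -> tends (fun N => F N y) (f y)) ->
  ball c r x -> is_derive x (delta_mx i 0) f (g x).
Proof.
move=> dF gF fF bx; apply/is_deriveP => e e0.
set v : V := delta_mx i 0.
have [N0 HN] := ep0 (divr_gt0 e0 (ltr0n _ 4)).
have epN : ep N0 <= e / 4.
  by have := HN N0 (leqnn _); rewrite subr0 ler_norml => /andP[].
have e40 : 0 < e / 4 by rewrite divr_gt0.
have [del1 del10 H1] := iffLR (is_deriveP _ _ _ _) (derivableP (dF N0 x bx)) (e / 4) e40.
have [del2 del20 H2] : exists2 d : R, 0 < d & forall t : R, `|t| < d -> ball c r (x + t *: v).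
  have [s s0 Hs] := open_ballcv (@ball_opencv R n c r) bx.
  exists s => // t ts; apply: Hs; apply/ballcvP.
  rewrite addrAC subrr add0r; apply/cvnorm_ltP => // j.
  by rewrite !mxE; case: (_ && _); rewrite ?mulr1 // mulr0 normr0.
exists (Order.min del1 del2); first by rewrite lt_min del10.
move=> t; rewrite lt_min => /andP[t1 t2].
have by_ := H2 t t2; set y := x + t *: v in by_ *.
have key N M : `|(F N y - F M y) - (F N x - F M x)| <= `|t| * (ep N + ep M).
  have [s s01 E] := @MVT_dir R V (fun z => F N z - F M z) x (t *: v)
    (fun s => t * (pd i (F N) (x + s *: (t *: v)) - pd i (F M) (x + s *: (t *: v)))) (fun s s01 =>
     iderZv t (iderB (derivableP (dF N _ (ball_seg bx by_ s01)))
                     (derivableP (dF M _ (ball_seg bx by_ s01))))).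
  rewrite -/y in E; rewrite E normrM ler_wpM2l //.
  have bz := ball_seg bx by_ s01; set z := x + s *: (t *: v) in bz *.
  have -> : pd i (F N) z - pd i (F M) z = (pd i (F N) z - g z) - (pd i (F M) z - g z) by ring.
  by apply: le_trans (ler_normB _ _) _; rewrite lerD // gF.
have lim N : `|(F N y - f y) - (F N x - f x)| <= `|t| * ep N.
  apply/ler_addgt0Pr => d d0.
  pose d' := d / (3 + `|t|).
  have t3 : 0 < 3 + `|t| by rewrite ltr_pwDl.
  have d'0 : 0 < d' by rewrite divr_gt0.
  have [Na HNa] := fF y by_ d' d'0; have [Nb HNb] := fF x bx d' d'0.
  have [Nc HNc] := ep0 d'0.
  pose M := maxn Na (maxn Nb Nc).
  have ha := HNa M (leq_maxl _ _).
  have hb := HNb M (leq_trans (leq_maxl _ _) (leq_maxr _ _)).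
  have hc := HNc M (leq_trans (leq_maxr _ _) (leq_maxr _ _)).
  have -> : (F N y - f y) - (F N x - f x) = ((F N y - F M y) - (F N x - F M x)) + ((F M y - f y) - (F M x - f x)) by ring.
  apply: le_trans (ler_normD _ _) _.
  have hc' : ep M <= d' by move: hc; rewrite subr0 ler_norml => /andP[].
  have h1 := key N M.
  have h2 : `|(F M y - f y) - (F M x - f x)| <= d' + d'.
    by apply: le_trans (ler_normB _ _) _; rewrite lerD.
  have h3 : `|t| * (ep N + ep M) <= `|t| * ep N + `|t| * d'.
    by rewrite mulrDr lerD2l ler_wpM2l.
  have h4 : d' * (3 + `|t|) = d by rewrite /d' divfK // gt_eqF.
  move: h1 h2 h3 h4 d'0; set T := `|t|; nra.
have -> : f y - f x - t * g x = - ((F N0 y - f y) - (F N0 x - f x))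
   + (F N0 y - F N0 x - t * pd i (F N0) x) + t * (pd i (F N0) x - g x) by ring.
apply: le_trans (ler_normD _ _) _.
have h1 := lim N0.
have h2 := H1 t t1.
have h3 : `|t * (pd i (F N0) x - g x)| <= `|t| * (e / 4).
  by rewrite normrM ler_wpM2l //; apply: le_trans epN; exact: gF.
have h4 : `|t| * ep N0 <= `|t| * (e / 4) by rewrite ler_wpM2l.
have h5 := ler_normD (- ((F N0 y - f y) - (F N0 x - f x))) (F N0 y - F N0 x - t * pd i (F N0) x).
rewrite normrN in h5.
have h6 : 0 <= `|t| by [].
apply: le_trans (lerD h5 h3) _.
apply: le_trans (lerD (lerD (le_trans h1 h4) h2) (lexx _)) _.
by move: h6 e0; set T := `|t|; nra.
Qed.

Lemma unif_primitive (g : 'I_n -> V -> R) : ball c r c ->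
  (forall N, F N c = 0) ->
  (forall N i y, ball c r y -> derivable (F N) y (delta_mx i 0)) ->
  (forall N i y, ball c r y -> `|pd i (F N) y - g i y| <= ep N) ->
  exists2 f : V -> R, f c = 0 & forall i x, ball c r x ->
    is_derive x (delta_mx i 0) f (g i x).
Proof.
move=> bc F0 dF gF.
have H y : ball c r y -> exists l, tends (fun N => F N y) l.
  move=> by_; apply: (@cauchy_tends _ _ (fun N => n%:R * ep N * `|y - c|)).
    move=> e e0; have C0 : 0 < n%:R * `|y - c| + 1 by rewrite ltr_wpDl // mulr_ge0.
    have [N0 HN] := ep0 (divr_gt0 e0 C0); exists N0 => N /HN; rewrite !subr0.
    rewrite ler_pdivlMr // => h; apply: le_trans h.
    rewrite [n%:R * _]mulrC -mulrA normrM ler_wpM2l // ger0_norm ?mulr_ge0 //.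
    by rewrite lerDl.
  move=> N M.
  have := @lip_box R n (fun z => F N z - F M z) c r c y (ep N + ep M) bc by_ _ _.
  rewrite !F0 !subr0 => H; rewrite -mulrDl -mulrDr; apply: H.
    by move=> z i bz; case: (iderB (derivableP (dF N i z bz)) (derivableP (dF M i z bz))).
  move=> z i bz.
  rewrite /pd; have [_ ->] := iderB (derivableP (dF N i z bz)) (derivableP (dF M i z bz)).
  rewrite -[X in `|X|](_ : (pd i (F N) z - g i z) - (pd i (F M) z - g i z) = _); last first.
    by rewrite /pd; ring.
  by apply: le_trans (ler_normB _ _) _; rewrite lerD // gF.
(* The default value 0 is never taken inside the ball, where the limit exists. *)
pose f y := xget 0 [set l | tends (fun N => F N y) l].
have Hf y : ball c r y -> tends (fun N => F N y) (f y).
  by move=> /H[l Hl]; rewrite /f; case: xgetP => // /(_ l).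
exists f.
  apply: (tends_uniq (Hf c bc)) => e e0; exists 0 => N _.
  by rewrite F0 subrr normr0 ltW.
by move=> i x bx; apply: unif_lim_der => // N y by_; [exact: dF|exact: gF].
Qed.

End UniformLimit.

Section Poincare.
Variables (R : realType).

(** On each subinterval the mean value theorem turns the increment of q into a value of dq, and a
    second application compares it with the value at the left end. The sums thus converge to an
    increment of a known primitive, and no integral enters. *)
Lemma riemann_sum (q dq ddq : R -> R) (M : R) N :
  (forall t : R, 0 <= t <= 1 -> is_derive t 1 q (dq t)) ->
  (forall t : R, 0 <= t <= 1 -> is_derive t 1 dq (ddq t)) ->
  (forall t : R, 0 <= t <= 1 -> `|ddq t| <= M) ->
  `|N.+1%:R^-1 * \sum_(k < N.+1) dq (k%:R / N.+1%:R) - (q 1 - q 0)| <= M / N.+1%:R.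
Proof.
move=> dqE ddqE ddqM.
have N0 : 0 < N.+1%:R :> R by rewrite ltr0n.
pose t (k : nat) : R := k%:R / N.+1%:R.
have t01 k : (k <= N.+1)%N -> 0 <= t k <= 1.
  by move=> kN; rewrite divr_ge0 //= ler_pdivrMr // mul1r ler_nat.
have tS k : t k.+1 = t k + N.+1%:R^-1 by rewrite /t -natr1 mulrDl mul1r.
have cont (f df : R -> R) a b : 0 <= a -> b <= 1 ->
    (forall t : R, 0 <= t <= 1 -> is_derive t 1 f (df t)) ->
    {within `[a, b], continuous f}.
  move=> a0 b1 H; apply: derivable_within_continuous => s; rewrite in_itv /= => /andP[as_ sb].
  by case: (H s) => //; rewrite (le_trans a0 as_) (le_trans sb b1).
have mvt (f df : R -> R) a b : 0 <= a -> a <= b -> b <= 1 ->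
    (forall t : R, 0 <= t <= 1 -> is_derive t 1 f (df t)) ->
    exists2 s, a <= s <= b & f b - f a = df s * (b - a).
  move=> a0 ab b1 H; have [||s] := @MVT_segment R f df a b ab.
  - move=> s; rewrite in_itv /= => /andP[as_ sb]; apply: H.
    by rewrite (le_trans a0 (ltW as_)) (le_trans (ltW sb) b1).
  - exact: cont H.
  - by rewrite in_itv /= => sab ->; exists s.
have step k : (k < N.+1)%N ->
    `|N.+1%:R^-1 * dq (t k) - (q (t k.+1) - q (t k))| <= M / N.+1%:R / N.+1%:R.
  move=> kN; have /andP[a0 a1] := t01 k (ltnW kN); have /andP[b0 b1] := t01 k.+1 kN.
  have ab : t k <= t k.+1 by rewrite tS lerDl invr_ge0 ltW.
  have [s /andP[as_ sb] ->] := mvt q dq (t k) (t k.+1) a0 ab b1 dqE.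
  have [s' /andP[as' s'b] E] := mvt dq ddq (t k) s a0 as_ (le_trans sb b1) ddqE.
  have -> : t k.+1 - t k = N.+1%:R^-1 by rewrite tS addrAC subrr add0r.
  have -> : N.+1%:R^-1 * dq (t k) - dq s * N.+1%:R^-1 = - (dq s - dq (t k)) / N.+1%:R by ring.
  rewrite E normrM normrN normrM [X in _ * X]ger0_norm ?invr_ge0 ?(ltW N0) //.
  rewrite ler_wpM2r ?invr_ge0 ?(ltW N0) //; apply: ler_pM => //.
    by apply: ddqM; rewrite (le_trans a0 as') (le_trans s'b (le_trans sb b1)).
  rewrite ger0_norm ?subr_ge0 // lerBlDl; apply: le_trans sb _.
  by rewrite tS.
have -> : q 1 - q 0 = \sum_(k < N.+1) (q (t k.+1) - q (t k)).
  rewrite -(big_mkord xpredT (fun k => q (t k.+1) - q (t k))) telescope_sumr //.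
  by rewrite /t mul0r divff ?gt_eqF.
rewrite mulr_sumr -sumrB; apply: le_trans (ler_norm_sum _ _ _) _.
apply: (@le_trans _ _ (\sum_(k < N.+1) (M / N.+1%:R / N.+1%:R))).
  by apply: ler_sum => k _; apply: step.
by rewrite sumr_const card_ord -[X in X <= _]mulr_natr divfK // gt_eqF.
Qed.

Variable n : nat.
Notation V := 'cV[R]_n.

Lemma loc_bound (m : nat) (f : 'I_m -> V -> R) x :
  (forall i, {for x, continuous (f i)}) ->
  exists r C : R, [/\ 0 < r, 0 <= C & forall i y, ball x r y -> `|f i y| <= C].
Proof.
move=> fc.
have H i : exists d : R, 0 < d /\ forall y, ball x d y -> `|f i y| <= `|f i x| + 1.
  have [d d0 Hd] := iffLR (continuous_forP _ _) (fc i) 1 ltr01.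
  exists d; split => // y /Hd h; have -> : f i y = f i x + (f i y - f i x) by ring.
  by apply: le_trans (ler_normD _ _) _; rewrite lerD2l.
have [d Hd] := choice H.
exists (\big[Order.min/1]_i d i), (\sum_i (`|f i x| + 1)); split.
- by apply/bigmin_gtP; split => // i _; case: (Hd i).
- by apply: sumr_ge0 => i _; rewrite addr_ge0.
move=> i y yb; apply: (@le_trans _ _ (`|f i x| + 1)).
  by case: (Hd i) => _; apply; apply: ball_le_sub yb; exact: bigmin_le.
by rewrite (bigD1 i) //= lerDl sumr_ge0 // => j _; rewrite addr_ge0.
Qed.

(* The potential is the limit of the Riemann sums of its integral along rays;
   their derivatives are, by closedness, Riemann sums of
   [d/dt (t * om_j (x0 + t h))], hence converge uniformly to [om_j (x0 + h)]. *)
Lemma poincare (U : set V) x0 (om : 'I_n -> V -> R) : open U -> U x0 ->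
  (forall i, Ck 2 U (om i)) ->
  (forall i j x, U x -> pd i (om j) x = pd j (om i) x) ->
  exists2 r : R, 0 < r /\ ball x0 r `<=` U & exists2 F : V -> R, F x0 = 0 &
    forall i x, ball x0 r x -> is_derive x (delta_mx i 0) F (om i x).
Proof.
move=> oU Ux0 omC closed_om.
have [r1 [C1 [r10 C10 H1]]] := @loc_bound _ (fun p : 'I_#|{: 'I_n * 'I_n}| =>
   pd (enum_val p).1 (om (enum_val p).2)) x0
   (fun p => Ck_cont (Ck_pd (enum_val p).1 (omC (enum_val p).2)) Ux0).
have [r2 [C2 [r20 C20 H2]]] := @loc_bound _ (fun p : 'I_#|{: 'I_n * ('I_n * 'I_n)}| =>
   pd (enum_val p).1 (pd (enum_val p).2.1 (om (enum_val p).2.2))) x0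
   (fun p => Ck_cont (Ck_pd (enum_val p).1 (Ck_pd (enum_val p).2.1 (omC (enum_val p).2.2))) Ux0).
have {}H1 i j y : ball x0 r1 y -> `|pd i (om j) y| <= C1.
  by move=> yb; have := H1 (enum_rank (i, j)) y yb; rewrite enum_rankK.
have {}H2 i j k y : ball x0 r2 y -> `|pd i (pd j (om k)) y| <= C2.
  by move=> yb; have := H2 (enum_rank (i, (j, k))) y yb; rewrite enum_rankK.
have [r3 r30 r3U] := open_ballcv oU Ux0.
pose r := Order.min (Order.min r1 r2) (Order.min r3 1).
have r0 : 0 < r by rewrite !lt_min r10 r20 r30 ltr01.
have rr1 y : ball x0 r y -> ball x0 r1 y by apply: ball_le_sub; rewrite !ge_min lexx.
have rr2 y : ball x0 r y -> ball x0 r2 y by apply: ball_le_sub; rewrite !ge_min lexx orbT.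
have rU y : ball x0 r y -> U y.
  by move=> yb; apply: r3U; apply: ball_le_sub yb; rewrite !ge_min lexx !orbT.
have bx0 : ball x0 r x0 by exact: ballxx.
have h1 y j : ball x0 r y -> `|(y - x0) j 0| <= 1.
  move=> /ballcvP yb; apply: le_trans (coord_le_cvnorm _ _) _; apply: ltW.
  by apply: lt_le_trans yb _; rewrite !ge_min lexx !orbT.
pose gam (x : V) (t : R) : V := x0 + t *: (x - x0).
have bgam x t : ball x0 r x -> 0 <= t <= 1 -> ball x0 r (gam x t).
  by move=> bx t01; apply: ball_seg => //; rewrite addrC subrK.
pose phi (t : R) (x : V) := \sum_i (x - x0) i 0 * om i (gam x t).
pose F (N : nat) (x : V) := N.+1%:R^-1 * \sum_(k < N.+1) phi (k%:R / N.+1%:R) x.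
pose dq j x (t : R) := om j (gam x t) + t * \sum_i (x - x0) i 0 * pd i (om j) (gam x t).
have C1at_om j x t : ball x0 r x -> 0 <= t <= 1 -> C1at (om j) (gam x t).
  move=> bx t01; apply: (Ck1_C1at oU); first exact: Ck_le (omC j).
  by apply: rU; exact: bgam.
have C1at_dom i j x t : ball x0 r x -> 0 <= t <= 1 -> C1at (pd i (om j)) (gam x t).
  move=> bx t01; apply: (Ck1_C1at oU); first exact: Ck_pd (omC j).
  by apply: rU; exact: bgam.
have gam_t x (t : R) i : is_derive t 1 (fun s : R => gam x s i 0 : R) ((x - x0) i 0).
  apply: (@ider_seg R V (fun y : V => y i 0) x0 (x - x0) _ t).
  exact: ider_coord.
have gam_x x (t : R) j i : is_derive x (delta_mx j 0) (fun y : V => gam y t i 0 : R) (t * (delta_mx j 0 : V) i 0).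
  have -> : (fun y => gam y t i 0 : R) = (fun y => x0 i 0 + t * (y i 0 - x0 i 0)).
    by apply/funext => y; rewrite !mxE.
  have -> : t * (delta_mx j 0 : V) i 0 = 0 + (0 * (x i 0 - x0 i 0) + t * ((delta_mx j 0 : V) i 0 - 0)) by ring.
  exact: (iderD (iderc _ _ _) (iderM (iderc _ _ _) (iderB (ider_coord _ _ _) (iderc _ _ _)))).
have dphi x (t : R) j : ball x0 r x -> 0 <= t <= 1 ->
    is_derive x (delta_mx j 0) (phi t) (dq j x t).
  move=> bx t01.
  have -> : dq j x t = \sum_i ((delta_mx j 0 : V) i 0 * om i (gam x t) +
      (x - x0) i 0 * \sum_l (t * (delta_mx j 0 : V) l 0) * pd l (om i) (gam x t)).
    rewrite big_split /= (bigD1 j) //= mxE !eqxx mul1r big1 ?addr0; last first.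
      by move=> i ij; rewrite mxE (negbTE ij) mul0r.
    rewrite /dq mulr_sumr; congr (_ + _); apply: eq_bigr => i _.
    have dl l : (delta_mx j 0 : V) l 0 = (l == j)%:R by rewrite mxE andbT.
    rewrite (bigD1 j) //= dl eqxx mulr1 big1 ?addr0; last first.
      by move=> l lj; rewrite dl (negbTE lj) mulr0 mul0r.
    by rewrite closed_om; [ring|apply: rU; exact: bgam].
  apply: ider_sum => i _; refine (iderM _ _).
    have -> : (fun y : V => (y - x0) i 0 : R) = (fun y => y i 0 - x0 i 0).
      by apply/funext => y; rewrite !mxE.
    rewrite -[(delta_mx j 0 : V) i 0]subr0.
    exact: (iderB (ider_coord _ _ _) (iderc _ _ _)).
  exact: (chain_rule (fun l => gam_x x t j l) (C1at_om i x t bx t01)).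
pose ddq j x (t : R) := (\sum_i (x - x0) i 0 * pd i (om j) (gam x t)) +
   (1 * (\sum_i (x - x0) i 0 * pd i (om j) (gam x t)) +
    t * \sum_i (0 * pd i (om j) (gam x t) +
      (x - x0) i 0 * \sum_l (x - x0) l 0 * pd l (pd i (om j)) (gam x t))).
have ddqE j x (t : R) : ball x0 r x -> 0 <= t <= 1 -> is_derive t 1 (dq j x) (ddq j x t).
  move=> bx t01; refine (iderD _ (iderM (is_derive_id _ _) (ider_sum _ _))).
    exact: (chain_rule (fun l => gam_t x t l) (C1at_om j x t bx t01)).
  move=> i _; refine (iderM (iderc _ _ _) _).
  exact: (chain_rule (fun l => gam_t x t l) (C1at_dom i j x t bx t01)).
have dqE j x (t : R) : ball x0 r x -> 0 <= t <= 1 ->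
    is_derive t 1 (fun t : R => t * om j (gam x t)) (dq j x t).
  move=> bx t01; have -> : dq j x t = 1 * om j (gam x t) +
     t * \sum_i (x - x0) i 0 * pd i (om j) (gam x t) by rewrite mul1r.
  refine (iderM (is_derive_id _ _) _).
  exact: (chain_rule (fun l => gam_t x t l) (C1at_om j x t bx t01)).
pose M := n%:R * C1 + (n%:R * C1 + n%:R * (n%:R * C2)).
have sum_le (m : nat) (a b : 'I_m -> R) (C : R) : (forall i, `|a i| <= 1) ->
    (forall i, `|b i| <= C) -> `|\sum_i a i * b i| <= m%:R * C.
  move=> a1 bC; apply: le_trans (ler_norm_sum _ _ _) _.
  rewrite -[m in leRHS]card_ord mulr_natl -sumr_const; apply: ler_sum => i _.
  by rewrite normrM -[C]mul1r ler_pM.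
have ddqM j x t : ball x0 r x -> 0 <= t <= 1 -> `|ddq j x t| <= M.
  move=> bx t01; have bg := bgam x t bx t01.
  have B1 : `|\sum_i (x - x0) i 0 * pd i (om j) (gam x t)| <= n%:R * C1.
    by apply: (sum_le) => i; [exact: h1|apply: H1; exact: rr1].
  apply: le_trans (ler_normD _ _) _; apply: lerD => //.
  apply: le_trans (ler_normD _ _) _; apply: lerD; first by rewrite mul1r.
  rewrite normrM -[leRHS]mul1r; apply: ler_pM => //.
    by rewrite ger0_norm; case/andP: t01.
  under eq_bigr do rewrite mul0r add0r.
  apply: (sum_le) => i; first exact: h1.
  by apply: (sum_le) => l; [exact: h1|apply: H2; exact: rr2].
have k01 (N : nat) (k : 'I_N.+1) : 0 <= (k%:R / N.+1%:R : R) <= 1.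
  by rewrite divr_ge0 //= ler_pdivrMr ?ltr0n // mul1r ler_nat ltnW.
have dF N j x : ball x0 r x -> is_derive x (delta_mx j 0) (F N)
    (N.+1%:R^-1 * \sum_(k < N.+1) dq j x (k%:R / N.+1%:R)).
  move=> bx; have E (a b : R) : a * b = 0 * (\sum_(k < N.+1) phi (k%:R / N.+1%:R) x) + a * b by ring.
  rewrite E; refine (iderM (iderc _ _ _) (ider_sum _ _)).
  by move=> k _; apply: dphi.
exists r; first by split.
have [| | |f f0 Hf] := @unif_primitive R n x0 r F (fun N => M / N.+1%:R) (tends_harmonic M) om bx0; last first.
- by exists f.
- move=> N j x bx; rewrite /pd; have [_ ->] := dF N j x bx.
  have := @riemann_sum (fun t => t * om j (gam x t)) (dq j x) (ddq j x) M N
    (fun t => dqE j x t bx) (fun t => ddqE j x t bx) (fun t => ddqM j x t bx).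
  by rewrite mul1r mul0r subr0 /gam scale1r [x0 + _]addrC subrK.
- by move=> N j x bx; case: (dF N j x bx).
move=> N; rewrite /F big1 ?mulr0 // => k _; rewrite /phi big1 // => i _.
by rewrite subrr mxE mul0r.
Qed.

Variable cat : category.

Lemma bounded_pd_continuous (f : V -> R) (df : 'I_n -> V -> R) x (r C : R) : 0 < r ->
  (forall i y, ball x r y -> is_derive y (delta_mx i 0) f (df i y)) ->
  (forall i y, ball x r y -> `|df i y| <= C) -> {for x, continuous f}.
Proof.
move=> r0 fd dfC; apply/continuous_forP => e e0.
have K0 : 0 < n%:R * `|C| + 1 by rewrite ltr_wpDl // mulr_ge0.
exists (Order.min r (e / (n%:R * `|C| + 1))); first by rewrite lt_min r0 divr_gt0.
move=> y yb.
have yr : ball x r y by apply: ball_le_sub yb; rewrite ge_min lexx.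
have xr : ball x r x by exact: ballxx.
apply: le_trans (@lip_box R n f x r x y `|C| xr yr _ _) _.
- by move=> z i bz; case: (fd i z bz).
- by move=> z i bz; rewrite /pd; case: (fd i z bz) => _ ->; apply: le_trans (dfC i z bz) (ler_norm _).
apply: (@le_trans _ _ ((n%:R * `|C| + 1) * `|y - x|)).
  by rewrite ler_wpM2r // lerDl.
rewrite -ler_pdivlMl // mulrC; apply/ltW.
by apply/ballcvP; apply: ball_le_sub yb; rewrite ge_min lexx orbT.
Qed.

Lemma cls_poincare (U : set V) x0 (om : 'I_n -> V -> R) (a : R) : open U -> U x0 ->
  (forall i, cls cat U (om i)) ->
  (forall i j x, U x -> pd i (om j) x = pd j (om i) x) ->
  exists2 r : R, 0 < r /\ ball x0 r `<=` U & exists F : V -> R,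
    [/\ F x0 = a, cls cat (ball x0 r) F &
    forall i x, ball x0 r x -> is_derive x (delta_mx i 0) F (om i x)].
Proof.
move=> oU Ux0 omC closed_om.
have [r [r0 rU] [F F0 dF]] := poincare oU Ux0 (fun i => cls_Ck 2 (omC i)) closed_om.
exists r => //; exists (fun x => F x + a).
have dFa i x : ball x0 r x -> is_derive x (delta_mx i 0) (fun x => F x + a) (om i x).
  by move=> bx; rewrite -[om i x]addr0; exact: (iderD (dF i x bx) (iderc _ _ _)).
split=> //; first by rewrite F0 add0r.
have oB : open (ball x0 r : set V) by exact: ball_opencv.
apply: (@cls_prim R cat n (ball x0 r) _ om) => // [x bx|i].
- have [s [C [s0 C0 HC]]] := loc_bound (fun i => cls_cont (omC i) (rU x bx)).
  have [s' s'0 s'B] := open_ballcv oB bx.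
  apply: (@bounded_pd_continuous _ om x (Order.min s s') C); first by rewrite lt_min s0.
    by move=> i y yb; apply: dFa; apply: s'B; apply: ball_le_sub yb; rewrite ge_min lexx orbT.
  by move=> i y yb; apply: HC; apply: ball_le_sub yb; rewrite ge_min lexx.
- exact: cls_sub (omC i).
Qed.

End Poincare.

(** * Matrix operations within the category *)

Section MatrixClass.
Variables (R : realType) (cat : category) (n : nat).
Notation V := 'cV[R]_n.
Variables (U : set V) (oU : open U).

Lemma cls_det m (A : V -> 'M[R]_m) : (forall i j, cls cat U (fun x => A x i j)) ->
  cls cat U (fun x => \det (A x)).
Proof.
move=> HA; rewrite /determinant; apply: cls_sum => // s _.
apply: cls_mul => //; first exact: cls_cst.
by apply: cls_prod => // i _.
Qed.

Lemma cls_adj m (A : V -> 'M[R]_m) i j : (forall i j, cls cat U (fun x => A x i j)) ->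
  cls cat U (fun x => (\adj (A x)) i j).
Proof.
move=> HA; apply: (@cls_ext _ _ _ _ (fun x => (-1) ^+ (j + i) * \det (row' j (col' i (A x))))) => //.
  by move=> x _; rewrite mxE /cofactor.
apply: cls_mul => //; first exact: cls_cst.
apply: cls_det => k l; apply: (@cls_ext _ _ _ _ (fun x => A x (lift j k) (lift i l))) => //.
by move=> x _; rewrite !mxE.
Qed.

Lemma cls_invmx m (A : V -> 'M[R]_m) i j : (forall i j, cls cat U (fun x => A x i j)) ->
  (forall x, U x -> A x \in unitmx) -> cls cat U (fun x => (invmx (A x)) i j).
Proof.
move=> HA uA; apply: (@cls_ext _ _ _ _ (fun x => (\det (A x))^-1 * (\adj (A x)) i j)) => //.
  by move=> x Ux; rewrite /invmx uA // [RHS]mxE.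
apply: cls_mul => //; last exact: cls_adj.
apply: cls_inv => //; first exact: cls_det.
by move=> x /uA; rewrite unitmxE unitfE.
Qed.

Lemma cls_mulmx m p q (A : V -> 'M[R]_(m, p)) (B : V -> 'M[R]_(p, q)) i j :
  (forall i j, cls cat U (fun x => A x i j)) ->
  (forall i j, cls cat U (fun x => B x i j)) ->
  cls cat U (fun x => (A x *m B x) i j).
Proof.
move=> HA HB; apply: (@cls_ext _ _ _ _ (fun x => \sum_k A x i k * B x k j)) => //.
  by move=> x _; rewrite mxE.
by apply: cls_sum => // k _; apply: cls_mul.
Qed.

Lemma cls_neq0_near (f : V -> R) x : cls cat U f -> U x -> f x != 0 ->
  exists2 r : R, 0 < r /\ ball x r `<=` U & forall y, ball x r y -> f y != 0.
Proof.
move=> fc Ux f0; have fx := cls_cont fc Ux.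
have f0' : 0 < `|f x| / 2 by rewrite divr_gt0 // normr_gt0.
have [d d0 Hd] := iffLR (continuous_forP _ _) fx (`|f x| / 2) f0'.
have [s s0 sU] := open_ballcv oU Ux.
exists (Order.min d s); first by rewrite lt_min d0; split => //; apply: subset_trans sU; apply: ball_le_sub; rewrite ge_min lexx orbT.
move=> y yb; apply/eqP => fy0.
have := Hd y (ball_le_sub (_ : Order.min d s <= d) yb).
rewrite ge_min lexx fy0 sub0r normrN => /(_ isT).
have : 0 < `|f x| by rewrite normr_gt0.
lra.
Qed.

End MatrixClass.

HB.instance Definition _ (R : realType) (m n : nat) :=
  Uniform_isComplete.Build 'M[R]_(m, n) (@mx_complete R m n).

(** * The inverse function theorem *)

Section InverseFunction.
Variables (R : realType) (n : nat).
Notation V := 'cV[R]_n.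

Definition jac m (phi : V -> 'cV[R]_m) (x : V) : 'M[R]_(m, n) :=
  \matrix_(i, j) pd j (fun y => phi y i 0) x.

(** A crude upper bound for the operator norm. *)
Definition mxbound m p (A : 'M[R]_(m, p)) : R := \sum_i \sum_j `|A i j|.

Lemma mxbound_ge0 m p (A : 'M[R]_(m, p)) : 0 <= mxbound A.
Proof. by apply: sumr_ge0 => i _; apply: sumr_ge0. Qed.

Lemma norm_mulmx m p (A : 'M[R]_(m, p)) (w : 'cV[R]_p) : `|A *m w| <= mxbound A * `|w|.
Proof.
have A0 := mxbound_ge0 A.
apply/cvnorm_leP => [|i]; first exact: mulr_ge0.
rewrite mxE; apply: le_trans (ler_norm_sum _ _ _) _.
apply: (@le_trans _ _ (\sum_j `|A i j| * `|w|)).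
  by apply: ler_sum => j _; rewrite normrM ler_wpM2l // coord_le_cvnorm.
rewrite -mulr_suml ler_wpM2r // /mxbound (bigD1 i) //= lerDl.
by apply: sumr_ge0 => k _; apply: sumr_ge0.
Qed.

Lemma closed_normball (c : V) (r : R) : closed [set x : V | `|x - c| <= r].
Proof.
have -> : [set x : V | `|x - c| <= r] = (fun x : V => `|x - c|) @^-1` [set t | t <= r] by [].
apply: closed_comp; last exact: closed_le.
move=> x _; apply: continuous_comp; last exact: norm_continuous.
by apply: continuousB; [exact: cvg_id|exact: cst_continuous].
Qed.

Lemma fixed_point (c : V) (r : R) (g : V -> V) : 0 <= r ->
  (forall x, `|x - c| <= r -> `|g x - c| <= r) ->
  (forall x y, `|x - c| <= r -> `|y - c| <= r -> `|g x - g y| <= 2^-1 * `|x - y|) ->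
  exists2 x, `|x - c| <= r & g x = x.
Proof.
move=> r0 gS gL; pose CB := [set x : V | `|x - c| <= r].
have gF : set_fun CB CB g by move=> x; exact: gS.
pose f : {fun CB >-> CB} := mkfun gF.
have fctr : is_contraction f.
  exists (2^-1)%:nng => //; split => /=; first by rewrite invf_lt1 // ltr1n.
  by move=> [x y] /= [Cx Cy]; exact: gL.
have [|x Cx fx] := banach_fixed_point fctr (@closed_normball c r).
  by exists c; rewrite /CB /= subrr normr0.
by exists x => //; rewrite [RHS]fx.
Qed.

Variables (cat : category) (U : set V) (phi : V -> V) (x0 : V).
Hypotheses (oU : open U) (Ux0 : U x0)
  (cphi : forall i, cls cat U (fun x => phi x i 0 : R))
  (uJ : jac phi x0 \in unitmx).

Let A := invmx (jac phi x0).
Let K := mxbound A.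
(** The simplified Newton map: its derivative vanishes at x0, and the fixed points of x |-> h x + A
    y are the solutions of phi x = y. *)
Let h (x : V) : V := x - A *m phi x.

Let ch i : cls cat U (fun x => h x i 0 : R).
Proof.
apply: (@cls_ext _ _ _ _ (fun x => x i 0 - \sum_k A i k * phi x k 0)) => //.
  by move=> x _; rewrite !mxE.
apply: cls_sub_fun => //; first exact: cls_coord.
by apply: cls_sum => // k _; apply: cls_mul => //; exact: cls_cst.
Qed.

Let dh0 i j : pd j (fun x => h x i 0 : R) x0 = 0.
Proof.
have -> : (fun x : V => h x i 0 : R) = (fun x => x i 0 - \sum_k A i k * phi x k 0).
  by apply/funext => x; rewrite !mxE.
have D : is_derive x0 (delta_mx j 0) (fun x : V => x i 0 - \sum_k A i k * phi x k 0)
   ((delta_mx j 0 : V) i 0 - \sum_k (0 * phi x0 k 0 + A i k * pd j (fun x => phi x k 0 : R) x0)).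
  refine (iderB (ider_coord _ _ _) (ider_sum _ _)) => k _.
  exact: (iderM (iderc _ _ _) (cls_der j (cphi k) Ux0)).
rewrite /pd; have [_ ->] := D.
have -> : \sum_k (0 * phi x0 k 0 + A i k * pd j (fun x => phi x k 0 : R) x0) =
    (A *m jac phi x0) i j.
  by rewrite mxE; apply: eq_bigr => k _; rewrite mul0r add0r mxE.
by rewrite mulVmx // !mxE andbT subrr.
Qed.

Let radius : exists r : R, [/\ 0 < r, ball x0 r `<=` U,
  (forall x, ball x0 r x -> jac phi x \in unitmx) &
  forall x y, ball x0 r x -> ball x0 r y -> `|h y - h x| <= 2^-1 * `|y - x|].
Proof.
(* Then n * e <= 1/2, so that h halves distances; n.+1 keeps e positive for n = 0. *)
pose e : R := (2 * n.+1%:R)^-1.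
have e0 : 0 < e by rewrite invr_gt0 mulr_gt0.
have H i j : exists d : R, 0 < d /\ forall y, ball x0 d y -> `|pd j (fun x => h x i 0 : R) y| <= e.
  have [d d0 Hd] := iffLR (continuous_forP _ _) (cls_cont (cls_pd j (ch i)) Ux0) e e0.
  by exists d; split => // y /Hd; rewrite dh0 subr0.
have [d' Hd'] := choice (fun p : 'I_n * 'I_n => H p.1 p.2).
pose d i j := d' (i, j); have Hd i j := Hd' (i, j).
have Jc i j : cls cat U (fun x => jac phi x i j).
  by apply: (cls_ext oU _ (cls_pd j (cphi i))) => x _; rewrite mxE.
have [|s [s0 sU] Hs] := cls_neq0_near oU (cls_det oU Jc) Ux0.
  by rewrite -unitfE -unitmxE.
pose r := \big[Order.min/s]_(p : 'I_n * 'I_n) d p.1 p.2.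
have rs : r <= s by exact: bigmin_le_id.
have rd i j : r <= d i j by exact: (bigmin_le _ (i, j) (fun p => d p.1 p.2)).
have r0 : 0 < r by apply/bigmin_gtP; split => // p _; case: (Hd p.1 p.2).
have rU : ball x0 r `<=` U by apply: subset_trans sU; exact: ball_le_sub.
exists r; split => // [x xb|x y bx by_].
  by rewrite unitmxE unitfE; apply: Hs; exact: ball_le_sub xb.
apply/cvnorm_leP => [|i]; first by rewrite mulr_ge0 // invr_ge0.
have -> : (h y - h x) i 0 = h y i 0 - h x i 0 by rewrite !mxE.
apply: le_trans (@lip_box R n (fun x => h x i 0) x0 r x y e bx by_ _ _) _.
- by move=> z j /rU Uz; case: (cls_der j (ch i) Uz).
- by move=> z j bz; apply: (Hd i j).2; exact: (ball_le_sub (rd i j)).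
apply: ler_wpM2r => //; rewrite /e invfM mulrCA -[leRHS]mulr1 ler_wpM2l ?invr_ge0 //.
by rewrite ler_pdivrMr ?ltr0n // mul1r ler_nat.
Qed.

(** Bijectivity comes from the contraction h. The inverse psi is then Lipschitz, has the derivative
    (D phi)^-1 o psi, and hence solves a differential equation with right-hand side of the category,
    so [cls_ode] applies. *)
Lemma inverse_function : exists (W : set V) (psi : V -> V),
  [/\ open W /\ W x0, W `<=` U, open (phi @` W),
      (forall x, W x -> psi (phi x) = x) &
      forall j, cls cat (phi @` W) (fun y => psi y j 0 : R)].
Proof.
have [r [r0 rU uB hL]] := radius.
pose W : set V := ball x0 r.
have K0 : 0 <= K by exact: mxbound_ge0.
(* As x = h x + A phi x and h halves distances, phi cannot contract too much; this yields both
   injectivity and the Lipschitz bound for psi. *)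
have lower x y : W x -> W y -> `|y - x| <= 2 * K * `|phi y - phi x|.
  move=> Wx Wy.
  have -> : y - x = (h y - h x) + A *m (phi y - phi x).
    by rewrite mulmxBr /h opprB [RHS]addrC addrA addrACA; apply/colP => i; rewrite !mxE; ring.
  have h1 := hL x y Wx Wy; have h2 := norm_mulmx A (phi y - phi x).
  have h3 := ler_normD (h y - h x) (A *m (phi y - phi x)).
  have h4 : `|y - x| <= 2^-1 * `|y - x| + K * `|phi y - phi x|.
    have {1}-> : y - x = (h y - h x) + A *m (phi y - phi x).
      by rewrite mulmxBr /h; apply/colP => i; rewrite !mxE; ring.
    by apply: le_trans h3 _; rewrite lerD.
  by move: h1 h2 h3 h4; rewrite -/K; lra.
have inj x y : W x -> W y -> phi x = phi y -> x = y.
  move=> Wx Wy E; have := lower x y Wx Wy; rewrite E subrr normr0 mulr0 normr_le0.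
  by rewrite subr_eq0 => /eqP.
have surj x1 : W x1 -> exists2 d : R, 0 < d & forall y, `|y - phi x1| < d ->
    exists2 x, W x & phi x = y.
  move=> Wx1; have [s s0 sW] := open_ballcv (@ball_opencv R n x0 r) Wx1.
  pose rho := s / 2; have rho0 : 0 < rho by rewrite divr_gt0.
  have K1 : 0 < 2 * K + 1 by rewrite ltr_wpDl // mulr_ge0.
  exists (rho / (2 * K + 1)); first by rewrite divr_gt0.
  (* The radius chosen for y bounds A (y - phi x1) by rho / 2; the other half of rho is taken by the
     contraction, so g maps the closed ball into itself. *)
  move=> y yd; pose g (x : V) := h x + A *m y.
  have CW x : `|x - x1| <= rho -> W x.
    by move=> xr; apply: sW; apply/ballcvP; apply: le_lt_trans xr _; rewrite /rho; lra.
  have yK : K * `|y - phi x1| <= 2^-1 * rho.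
    have : `|y - phi x1| * (2 * K + 1) < rho by rewrite -ltr_pdivlMr.
    have := normr_ge0 (y - phi x1); set T := `|_|; nra.
  have [||x xr gx] := @fixed_point x1 rho g (ltW rho0).
  - move=> x xr; have -> : g x - x1 = (h x - h x1) + A *m (y - phi x1).
      by rewrite mulmxBr /g /h; apply/colP => i; rewrite !mxE; ring.
    apply: le_trans (ler_normD _ _) _.
    have h1 := hL x1 x Wx1 (CW x xr); have h2 := norm_mulmx A (y - phi x1).
    have h3 : 2^-1 * `|x - x1| <= 2^-1 * rho by rewrite ler_wpM2l // invr_ge0.
    by move: h1 h2 h3 yK; rewrite -/K; lra.
  - move=> x y' xr yr; have -> : g x - g y' = h x - h y'.
      by rewrite /g; apply/colP => i; rewrite !mxE; ring.
    exact: hL (CW _ yr) (CW _ xr).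
  exists x; first exact: CW.
  have : A *m (y - phi x) = 0.
    rewrite mulmxBr; have -> : A *m y = g x - h x by rewrite /g addrAC subrr add0r.
    by rewrite gx /h; apply/colP => i; rewrite !mxE; ring.
  move/(congr1 (mulmx (jac phi x0))); rewrite mulmxA mulmxV // mul1mx mulmx0.
  by move/eqP; rewrite subr_eq0 => /eqP.
have oimg : open (phi @` W).
  rewrite openE => _ [x1 Wx1 <-]; have [d d0 Hd] := surj x1 Wx1.
  apply/nbhs_ballP; exists d => // y /ballcvP /Hd[x Wx <-].
  by exists x.
pose psi (y : V) : V := xget x0 [set x | W x /\ phi x = y].
have psiE x : W x -> psi (phi x) = x.
  move=> Wx; rewrite /psi; case: xgetP => [z _ [Wz /inj]|/(_ x)[]//].
  exact: (fun H => H Wz Wx).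
have psiL y y' : (phi @` W) y -> (phi @` W) y' -> `|psi y' - psi y| <= 2 * K * `|y' - y|.
  by move=> [x Wx <-] [x' Wx' <-]; rewrite !psiE //; exact: lower.
have dpsi i j y : (phi @` W) y -> is_derive y (delta_mx i 0) (fun y => psi y j 0 : R)
    (invmx (jac phi (psi y)) j i).
  move=> Yy; have [s s0 sY] := open_ballcv oimg Yy.
  have [x Wx Ex] := Yy; rewrite -Ex psiE //.
  set B := jac phi x; have uBx : B \in unitmx by exact: uB.
  apply/is_deriveP => e e0.
  pose KB := mxbound (invmx B); have KB0 : 0 <= KB by exact: mxbound_ge0.
  pose Q := KB * n%:R * (2 * K); have Q0 : 0 <= Q by rewrite !mulr_ge0.
  pose eta := e / (Q + 1); have eta0 : 0 < eta by rewrite divr_gt0 // ltr_wpDl.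
  have [d d0 Hd] : exists2 d : R, 0 < d & forall k l z, ball x d z ->
      `|pd l (fun x => phi x k 0 : R) z - pd l (fun x => phi x k 0 : R) x| <= eta.
    have H k l : exists d : R, 0 < d /\ forall z, ball x d z ->
      `|pd l (fun x => phi x k 0 : R) z - pd l (fun x => phi x k 0 : R) x| <= eta.
      have [d d0 Hd] := iffLR (continuous_forP _ _) (cls_cont (cls_pd l (cphi k)) (rU _ Wx)) eta eta0.
      by exists d.
    have [d' Hd'] := choice (fun p : 'I_n * 'I_n => H p.1 p.2).
    pose d i j := d' (i, j); have Hd i j := Hd' (i, j).
    exists (\big[Order.min/1]_(p : 'I_n * 'I_n) d p.1 p.2).
      by apply/bigmin_gtP; split => // p _; case: (Hd p.1 p.2).
    move=> k l z zb; apply: (Hd k l).2; apply: ball_le_sub zb.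
    exact: (bigmin_le _ (k, l) (fun p => d p.1 p.2)).
  have [s' s'0 s'W] := open_ballcv (@ball_opencv R n x0 r) Wx.
  pose d2 := Order.min d s'; have d20 : 0 < d2 by rewrite lt_min d0.
  have K1 : 0 < 2 * K + 1 by rewrite ltr_wpDl // mulr_ge0.
  exists (Order.min s (d2 / (2 * K + 1))); first by rewrite lt_min s0 divr_gt0.
  move=> t; rewrite lt_min => /andP[ts td].
  have nt : `|t *: (delta_mx i 0 : V)| <= `|t|.
    apply/cvnorm_leP => // k; rewrite !mxE.
    by case: (_ && _); rewrite ?mulr1 // mulr0 normr0.
  have Yt : (phi @` W) (phi x + t *: delta_mx i 0).
    rewrite Ex; apply: sY; apply/ballcvP; rewrite addrAC subrr add0r.
    exact: le_lt_trans ts.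
  have [x' Wx' Ex'] := Yt; rewrite -Ex' !psiE //.
  have nd : `|x' - x| <= 2 * K * `|t|.
    apply: le_trans (lower x x' Wx Wx') _; rewrite Ex' addrAC subrr add0r.
    by rewrite ler_wpM2l // mulr_ge0.
  have bx' : ball x d2 x'.
    apply/ballcvP; apply: le_lt_trans nd _.
    apply: (@le_lt_trans _ _ ((2 * K + 1) * `|t|)); first by rewrite ler_wpM2r // lerDl.
    by rewrite mulrC -ltr_pdivlMr.
  have bxx : ball x d2 x by exact: ballxx.
  (* The remainder in the expansion of phi at x, since phi x' - phi x = t e_i; by the Lipschitz
     bound it is small compared with t. *)
  pose err := t *: (delta_mx i 0 : V) - B *m (x' - x).
  have nerr : `|err| <= n%:R * eta * (2 * K * `|t|).
    apply/cvnorm_leP => [|k].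
      exact: (mulr_ge0 (mulr_ge0 (ler0n _ _) (ltW eta0)) (mulr_ge0 (mulr_ge0 (ler0n _ 2) K0) (normr_ge0 t))).
    have [|xi [bxi E]] := @MVT_box R n (fun x => phi x k 0) x d2 x x' bxx bx'.
      move=> z l bz; have Uz : U z by apply: rU; apply: s'W; apply: ball_le_sub bz; rewrite ge_min lexx orbT.
      by case: (cls_der l (cphi k) Uz).
    have -> : err k 0 = \sum_l (x' - x) l 0 * (pd l (fun x => phi x k 0) (xi l) - pd l (fun x => phi x k 0) x).
      have -> : err k 0 = (phi x' k 0 - phi x k 0) - (B *m (x' - x)) k 0.
        by rewrite Ex' /err !mxE; ring.
      rewrite E mxE -sumrB; apply: eq_bigr => l _.
      by rewrite [B k l]mxE; ring.
    apply: le_trans (ler_norm_sum _ _ _) _.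
    apply: (@le_trans _ _ (\sum_(l < n) (2 * K * `|t|) * eta)).
      apply: ler_sum => l _; rewrite normrM; apply: ler_pM => //.
        exact: le_trans (coord_le_cvnorm _ _) nd.
      by apply: Hd; apply: ball_le_sub (bxi l).1; rewrite ge_min lexx.
    by rewrite sumr_const card_ord -[leLHS]mulr_natl; lra.
  have -> : x' j 0 - x j 0 - t * invmx B j i = - (invmx B *m err) j 0.
    rewrite /err mulmxBr mulmxA mulVmx // mul1mx -scalemxAr.
    have -> : (invmx B *m delta_mx i 0 : V) = col i (invmx B) by rewrite -colE.
    by rewrite !mxE; ring.
  rewrite normrN; apply: le_trans (coord_le_cvnorm _ _) _.
  apply: le_trans (norm_mulmx _ _) _; rewrite -/KB.
  apply: (@le_trans _ _ (KB * (n%:R * eta * (2 * K * `|t|)))); first by rewrite ler_wpM2l.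
  have -> : KB * (n%:R * eta * (2 * K * `|t|)) = (Q * eta) * `|t| by rewrite /Q; ring.
  rewrite ler_wpM2r //.
  have : eta * (Q + 1) = e by rewrite /eta divfK // gt_eqF // ltr_wpDl.
  by move: eta0; lra.
exists W, psi; split => //.
  by split; [exact: ball_opencv|exact: ballxx].
have oW : open W by exact: ball_opencv.
move=> j; apply: (@cls_ode R cat n n (phi @` W) W psi oimg oW _
   (fun i j x => invmx (jac phi x) j i)) => //.
- by move=> _ [x Wx <-]; rewrite psiE.
- move=> i k; apply: cls_invmx => // l m.
  apply: (@cls_ext _ _ _ _ (pd m (fun y => phi y l 0 : R))) => //; first by move=> x _; rewrite mxE.
  by apply: cls_pd; apply: cls_sub (cphi l).
- move=> y k Yy; apply/continuous_forP => e e0; have [s s0 sY] := open_ballcv oimg Yy.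
  have K1 : 0 < 2 * K + 1 by rewrite ltr_wpDl // mulr_ge0.
  exists (Order.min s (e / (2 * K + 1))); first by rewrite lt_min s0 divr_gt0.
  move=> w wb; have Yw : (phi @` W) w by apply: sY; apply: ball_le_sub wb; rewrite ge_min lexx.
  have -> : psi w k 0 - psi y k 0 = (psi w - psi y) k 0 by rewrite !mxE.
  apply: le_trans (coord_le_cvnorm _ _) _; apply: le_trans (psiL y w Yy Yw) _.
  apply: (@le_trans _ _ ((2 * K + 1) * `|w - y|)); first by rewrite ler_wpM2r // lerDl.
  rewrite mulrC -ler_pdivlMr //; apply: ltW; apply/ballcvP.
  by apply: ball_le_sub wb; rewrite ge_min lexx orbT.
Qed.

End InverseFunction.

(** * Power series and Cauchy estimates *)

Section SmoothLimit.
Variables (R : realType) (n : nat).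
Notation V := 'cV[R]_n.
Variables (x0 : V) (r : R) (ep : nat -> R).
Hypotheses (ep0 : tends ep 0) (ep_ge0 : forall N, 0 <= ep N).
Notation B := (ball x0 r : set V).

(** [ep M * w j] bounds the derivatives of order j of all later differences F N - F M, and [a j]
    those of the F N. Taking partial derivatives only shifts [w] and [a], which is what inductions
    on the order use. *)
Definition fast_cvg (F : nat -> V -> R) (f : V -> R) (w a : nat -> R) :=
  [/\ forall k N, Ck k B (F N), forall j, 0 <= w j,
    forall M N k, (M <= N)%N -> maj k B (fun j => ep M * w j) (fun y => F N y - F M y),
    forall N k, maj k B a (F N) &
    forall y, B y -> tends (fun N => F N y) (f y)].

Lemma tends_le (u : nat -> R) l c : tends u l -> (forall N, `|u N| <= c) -> `|l| <= c.
Proof.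
move=> ul uc; apply/ler_addgt0Pr => e e0; have [N HN] := ul e e0.
have h := HN N (leqnn N); have -> : l = u N - (u N - l) by ring.
by apply: le_trans (ler_normB _ _) _; rewrite lerD.
Qed.

Lemma fast_cvg_step F f w a : fast_cvg F f w a ->
  [/\ forall y, B y -> `|f y| <= a 0, forall y, B y -> {for y, continuous f} &
   forall i, (forall y, B y -> is_derive y (delta_mx i 0) f (pd i f y)) /\
     fast_cvg (fun N => pd i (F N)) (pd i f) (w \o succn) (a \o succn)].
Proof.
move=> [CF w0 dF aF Ff].
have oB : open B by exact: ball_opencv.
have pdB i M N k : (M <= N)%N -> maj k B (fun j => ep M * w j.+1) (fun y => pd i (F N) y - pd i (F M) y).
  move=> MN; apply: (maj_ext oB _ (maj_pd i (dF M N k.+1 MN))) => y By.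
  by have [_ <-] := iderB (Ck_der i (CF 1%N N) By) (Ck_der i (CF 1%N M) By).
have g_ex i y : B y -> exists l, tends (fun N => pd i (F N) y) l.
  move=> By; apply: (@cauchy_tends _ _ (fun N => ep N * w 1)).
    move=> e e0; have w1 : 0 < w 1 + 1 by rewrite ltr_wpDl.
    have [N0 HN] := ep0 (divr_gt0 e0 w1); exists N0 => N /HN; rewrite !subr0.
    rewrite ler_pdivlMr // => h; apply: le_trans h.
    by rewrite normrM ler_wpM2l // ger0_norm // lerDl.
  move=> N M; wlog MN : N M / (M <= N)%N => [W|].
    case/orP: (leq_total M N) => h; first exact: W.
    by rewrite distrC [leRHS]addrC; exact: W.
  apply: le_trans (maj0 (pdB i M N 0 MN) By) _.
  by rewrite lerDr mulr_ge0.
pose g i y := xget 0 [set l | tends (fun N => pd i (F N) y) l].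
have gP i y : B y -> tends (fun N => pd i (F N) y) (g i y).
  by move=> /(g_ex i)[l Hl]; rewrite /g; case: xgetP => // /(_ l).
have gF i N y : B y -> `|pd i (F N) y - g i y| <= ep N * w 1.
  move=> By; apply/ler_addgt0Pr => e e0; have [M0 HM] := gP i y By e e0.
  have h := HM _ (leq_maxl M0 N).
  have := maj0 (pdB i N (maxn M0 N) 0 (leq_maxr _ _)) By.
  set m := maxn M0 N in h *; rewrite distrC => h2.
  have -> : pd i (F N) y - g i y = (pd i (F N) y - pd i (F m) y) + (pd i (F m) y - g i y) by ring.
  by apply: le_trans (ler_normD _ _) _; rewrite lerD.
have df i y : B y -> is_derive y (delta_mx i 0) f (g i y).
  move=> By; apply: (@unif_lim_der R n x0 r F (fun N => ep N * w 1)) => //.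
  - move=> e e0; have w1 : 0 < w 1 + 1 by rewrite ltr_wpDl.
    have [N0 HN] := ep0 (divr_gt0 e0 w1); exists N0 => N /HN; rewrite !subr0.
    rewrite ler_pdivlMr // => h; apply: le_trans h.
    by rewrite normrM ler_wpM2l // ger0_norm // lerDl.
  - by move=> N z Bz; case: (Ck_der i (CF 1%N N) Bz).
  - by move=> N z Bz; exact: gF.
have gE i y : B y -> g i y = pd i f y by move=> By; have [_ <-] := df i y By.
have ga i y : B y -> `|g i y| <= a 1.
  move=> By; apply: (tends_le (gP i y By)) => N.
  exact: maj0 (maj_pd i (aF N 1%N)) By.
split.
- by move=> y By; apply: (tends_le (Ff y By)) => N; exact: maj0 (aF N 0%N) By.
- move=> y By; have [s s0 sB] := open_ballcv oB By.
  by apply: (@bounded_pd_continuous R n f g y s (a 1)) => // i z /sB Bz; [exact: df|exact: ga].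
- move=> i; split=> [y By|]; first by rewrite -gE //; exact: df.
  split.
  + by move=> k N; exact: Ck_pd (CF k.+1 N).
  + by move=> j; exact: w0.
  + by move=> M N k MN; exact: pdB.
  + by move=> N k; exact: maj_pd (aF N k.+1).
  + by move=> y By; rewrite -gE //; exact: gP.
Qed.

Lemma fast_cvg_lim F f w a : fast_cvg F f w a ->
  forall k, Ck k B f /\ maj k B a f.
Proof.
move=> H k; elim: k F f w a H => [|k IH] F f w a /fast_cvg_step[fa fc Hs]; first by split.
split; first by apply: CkS => // i; have [df /IH[Cf _]] := Hs i.
by split => // i; have [_ /IH[]] := Hs i.
Qed.

End SmoothLimit.

Section Monomials.
Variables (R : realType) (n : nat).
Notation V := 'cV[R]_n.
Notation mindex := {ffun 'I_n -> nat}.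

Definition cube (N : nat) : seq mindex :=
  map (fun a : {ffun 'I_n -> 'I_N} => [ffun i => (a i : nat)]) (enum {: {ffun 'I_n -> 'I_N}}).

Lemma mem_cube N (b : mindex) : (b \in cube N) = [forall i, (b i < N)%N].
Proof.
rewrite /cube; apply/mapP/forallP => [[a _ ->] i|H]; first by rewrite ffunE.
exists [ffun i => Ordinal (H i)]; first by rewrite mem_enum.
 apply/ffunP => i; by rewrite !ffunE.
Qed.

Lemma cube_uniq N : uniq (cube N).
Proof.
rewrite map_inj_uniq ?enum_uniq // => a b /ffunP E; apply/ffunP => i.
by apply: val_inj; have := E i; rewrite !ffunE.
Qed.

Lemma sum_cube N (G : mindex -> R) :
  \sum_(a : {ffun 'I_n -> 'I_N}) G [ffun i => (a i : nat)] = \sum_(b <- cube N) G b.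
Proof. by rewrite /cube big_map big_enum. Qed.

Lemma sum_cube_sub M N (G : mindex -> R) : (M <= N)%N ->
  \sum_(b <- cube M) G b = \sum_(b <- cube N | b \in cube M) G b.
Proof.
move=> MN; rewrite -[RHS]big_filter; apply: perm_big; apply: uniq_perm.
- exact: cube_uniq.
- by rewrite filter_uniq // cube_uniq.
move=> b; rewrite mem_filter; case: (boolP (b \in cube M)) => //= bM.
rewrite !mem_cube in bM *; apply/esym/forallP => i; apply: leq_trans MN.
exact: (forallP bM).
Qed.

Definition mdeg (b : mindex) : nat := \sum_i b i.

Variables (x : V) (rho : R).
Hypothesis rho0 : 0 < rho.
Notation B := (ball x rho : set V).

(* The derivatives at 0 of [rho^m exp (m t / rho)], which bound those of a
   monomial of degree m on the ball of radius rho; the choice of an exponential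
   makes these bounds multiplicative. *)
Definition expmaj (m j : nat) : R := rho ^+ m * (m%:R / rho) ^+ j.

Lemma bconv_expmaj (p q k : nat) : bconv (expmaj p) (expmaj q) k = expmaj (p + q) k.
Proof.
rewrite /bconv /expmaj natrD mulrDl addrC exprDn exprD mulr_sumr; apply: eq_bigr => i _.
by rewrite -[X in _ = _ * X]mulr_natl; ring.
Qed.

Lemma bin_le_exp2 (m k : nat) : ('C(m, k) <= 2 ^ m)%N.
Proof.
elim: m k => [|m IH] [|k]; rewrite ?bin0 ?expn_gt0 ?bin0n //.
by rewrite binS expnS mul2n -addnn leq_add.
Qed.

(** Rests on m^j <= (m + j)!/m! = j! binomial(m + j, j) <= j! 2^(m + j): the exponential bounds
    become Cauchy estimates at the cost of doubling the radius. *)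
Lemma expmaj_le (m j : nat) :
  expmaj m j <= (2 * rho) ^+ m * ((2 / rho) ^+ j * j`!%:R).
Proof.
have H : ((m ^ j)%:R : R) <= (j`! * 2 ^ (m + j))%:R.
  rewrite ler_nat; apply: (@leq_trans ((m + j) ^_ j)).
    elim: j => // j IH; rewrite expnS addnS ffactnS.
    by apply: leq_mul => //; rewrite ltnW // ltnS leq_addr.
  by rewrite -bin_ffact mulnC leq_mul2l bin_le_exp2 orbT.
rewrite /expmaj exprMn [leRHS](_ : _ = rho ^+ m * ((j`! * 2 ^ (m + j))%:R * rho^-1 ^+ j)).
  by rewrite ler_wpM2l ?exprn_ge0 ?(ltW rho0) // -natrX ler_wpM2r // exprn_ge0 // invr_ge0 ltW.
by rewrite natrM natrX exprD !exprMn; ring.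
Qed.

Lemma expmaj_ge0 (m j : nat) : 0 <= expmaj m j.
Proof. by rewrite mulr_ge0 ?exprn_ge0 ?divr_ge0 ?(ltW rho0). Qed.

Let oB : open B. Proof. exact: ball_opencv. Qed.

Lemma Ck_shift k i : Ck k B (fun y => (y - x) i 0 : R).
Proof.
apply: (@Ck_ext _ _ _ _ (fun y => y i 0 + - x i 0)) => //; first by move=> y _; rewrite !mxE.
by apply: Ck_add => //; [exact: Ck_coord|exact: Ck_cst].
Qed.

Lemma maj_shift k i : maj k B (expmaj 1) (fun y => (y - x) i 0 : R).
Proof.
case: k => [|k]; split => //.
- move=> y /ballcvP yx; rewrite /expmaj expr1 expr0 mulr1.
  exact: le_trans (coord_le_cvnorm _ _) (ltW yx).
- move=> y /ballcvP yx; rewrite /expmaj expr1 expr0 mulr1.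
  exact: le_trans (coord_le_cvnorm _ _) (ltW yx).
move=> j; apply: (@maj_ext _ _ _ _ _ (fun=> (delta_mx j 0 : V) i 0)) => // [y _|].
  apply/esym; have -> : (fun y : V => (y - x) i 0) = (fun y => y i 0 - x i 0).
    by apply/funext => z; rewrite !mxE.
  by have [_] := iderB (ider_coord y (delta_mx j 0) i) (iderc (x i 0) y (delta_mx j 0)); rewrite subr0.
apply: maj_cst => // [l|]; first exact: expmaj_ge0.
rewrite /expmaj /= !expr1 mulrCA divff ?gt_eqF // mulr1.
by rewrite mxE; case: (_ && _); rewrite ?normr1 // normr0.
Qed.

Lemma monomial_maj k (b : mindex) :
  Ck k B (fun y => \prod_i (y - x) i 0 ^+ b i) /\
  maj k B (expmaj (mdeg b)) (fun y => \prod_i (y - x) i 0 ^+ b i).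
Proof.
have H1 i m : Ck k B (fun y => (y - x) i 0 ^+ m) /\ maj k B (expmaj m) (fun y => (y - x) i 0 ^+ m).
  elim: m => [|m [IH1 IH2]].
    have -> : (fun y => (y - x) i 0 ^+ 0) = (fun=> 1) by apply/funext => y; rewrite expr0.
    split; first exact: Ck_cst.
    by apply: maj_cst => // [j|]; [exact: expmaj_ge0|rewrite /expmaj !expr0 mulr1 normr1].
  have -> : (fun y => (y - x) i 0 ^+ m.+1) = (fun y => (y - x) i 0 * (y - x) i 0 ^+ m).
    by apply/funext => y; rewrite exprS.
  split; first by apply: Ck_mul => //; exact: Ck_shift.
  apply: (@maj_le _ _ _ B _ (bconv (expmaj 1) (expmaj m))) => //.
    by move=> j; rewrite bconv_expmaj.
  by apply: maj_mul => //; [exact: Ck_shift|exact: maj_shift].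
rewrite /mdeg; elim: (index_enum _) => [|i s [IH1 IH2]].
  have -> : (fun y : V => \prod_(i <- [::]) (y - x) i 0 ^+ b i) = (fun=> 1).
    by apply/funext => y; rewrite big_nil.
  rewrite big_nil; split; first exact: Ck_cst.
  by apply: maj_cst => // [j|]; [exact: expmaj_ge0|rewrite /expmaj !expr0 mulr1 normr1].
have -> : (fun y : V => \prod_(i <- i :: s) (y - x) i 0 ^+ b i)
   = (fun y : V => (y - x) i 0 ^+ b i * \prod_(i <- s) (y - x) i 0 ^+ b i).
  by apply/funext => y; rewrite big_cons.
have [H2 H3] := H1 i (b i).
rewrite big_cons; split; first exact: Ck_mul.
apply: (@maj_le _ _ _ B _ (bconv (expmaj (b i)) (expmaj (\sum_(i <- s) b i)))) => //.
  by move=> j; rewrite bconv_expmaj.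
exact: maj_mul.
Qed.

(** The bound is a product of the absolute series at radius 2 * rho and a factor depending only on
    the order, so the tail of a single numerical series controls the tails of all derivatives. *)
Lemma sum_monomials_maj k (s : seq mindex) (P : pred mindex) (c : mindex -> R) :
  Ck k B (fun y => \sum_(b <- s | P b) monomial c (y - x) b) /\
  maj k B (fun j => (\sum_(b <- s | P b) `|c b| * (2 * rho) ^+ mdeg b) * ((2 / rho) ^+ j * j`!%:R))
    (fun y => \sum_(b <- s | P b) monomial c (y - x) b).
Proof.
have w0 j : 0 <= (2 / rho) ^+ j * j`!%:R :> R.
  by rewrite mulr_ge0 // exprn_ge0 // divr_ge0 // ltW.
have t0 b : 0 <= `|c b| * (2 * rho) ^+ mdeg b.
  by rewrite mulr_ge0 // exprn_ge0 // mulr_ge0 // ltW.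
have one b : Ck k B (fun y => monomial c (y - x) b) /\
  maj k B (fun j => (`|c b| * (2 * rho) ^+ mdeg b) * ((2 / rho) ^+ j * j`!%:R)) (fun y => monomial c (y - x) b).
  have [H1 H2] := monomial_maj k b; split.
    by apply: Ck_mul => //; exact: Ck_cst.
  (* A constant factor has a majorant concentrated in order 0. *)
  apply: (@maj_le _ _ _ B _ (bconv (fun j => if j == 0 then `|c b| else 0) (expmaj (mdeg b)))) => //.
    move=> j; rewrite /bconv big_ord_recl /= bin0 mul1r subn0 big1 ?addr0; last first.
      by move=> i _; rewrite mulr0 mul0r.
    by rewrite -mulrA ler_wpM2l // expmaj_le.
  by apply: maj_mul => //; [exact: Ck_cst|apply: maj_cst => // -[]].
elim: s => [|b s [IH1 IH2]].
  have -> : (fun y : V => \sum_(b <- [::] | P b) monomial c (y - x) b) = (fun=> 0).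
    by apply/funext => y; rewrite big_nil.
  split; first exact: Ck_cst.
  by apply: maj_cst => // [j|]; rewrite big_nil ?mul0r ?normr0.
have [H1 H2] := one b.
have E : (fun y : V => \sum_(b <- b :: s | P b) monomial c (y - x) b) =
   (fun y : V => if P b then monomial c (y - x) b + \sum_(b <- s | P b) monomial c (y - x) b
      else \sum_(b <- s | P b) monomial c (y - x) b).
  by apply/funext => y; rewrite big_cons.
rewrite E; case Pb: (P b); split => //.
- exact: Ck_add.
- apply: (@maj_le _ _ _ B _ (fun j => (`|c b| * (2 * rho) ^+ mdeg b) * ((2 / rho) ^+ j * j`!%:R) +
    (\sum_(b <- s | P b) `|c b| * (2 * rho) ^+ mdeg b) * ((2 / rho) ^+ j * j`!%:R))) => //.
    by move=> j; rewrite [in leRHS]big_cons Pb [leRHS]mulrDl.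
  exact: maj_add.
- by apply: maj_le IH2 => // j; rewrite big_cons Pb.
Qed.

End Monomials.

(** * From power series to Cauchy estimates *)

Section AnalyticToBounds.
Variables (R : realType) (n : nat).
Notation V := 'cV[R]_n.

Lemma analytic_at_maj (f : V -> R) x (U : set V) : open U -> U x -> analytic_at f x ->
  exists r A H : R, [/\ 0 < r, 0 < A, 0 < H, (ball x r : set V) `<=` U &
    forall k, Ck k (ball x r) f /\ maj k (ball x r) (fun j => A * H ^+ j * j`!%:R) f].
Proof.
move=> oU Ux [c [r [r0 Hc]]].
have [s s0 sU] := open_ballcv oU Ux.
(* A quarter of r leaves room for the point h0 with all coordinates 2 * rho, where absolute
   convergence of the series supplies the sum S that dominates every derivative on the ball of
   radius rho. *)
pose rho := Order.min (r / 4) s.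
have rho0 : 0 < rho by rewrite lt_min s0 divr_gt0.
have rhor : rho <= r / 4 by rewrite ge_min lexx.
pose h0 : V := const_mx (2 * rho).
have nh0 : `|h0| < r.
  apply/cvnorm_ltP => // i; rewrite mxE ger0_norm; last by rewrite mulr_ge0 // ltW.
  by move: rhor r0; lra.
have t0 b : 0 <= `|c b| * (2 * rho) ^+ mdeg b.
  by rewrite mulr_ge0 // exprn_ge0 // mulr_ge0 // ltW.
pose S N := \sum_(b <- cube n N) `|c b| * (2 * rho) ^+ mdeg b.
have SE N : S N = \sum_(a : {ffun 'I_n -> 'I_N}) `|monomial c h0 [ffun i => (a i : nat)]|.
  rewrite (sum_cube N (fun b => `|monomial c h0 b|)); apply: eq_bigr => b _.
  rewrite /monomial normrM; congr (_ * _); rewrite normr_prod /mdeg -prodrXr.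
    by apply: eq_bigr => i _; rewrite mxE normrX ger0_norm // mulr_ge0 // ltW.
have [cvgS _] := Hc h0 nh0.
have /cvg_ex[S_lim HS] : cvgn S by rewrite (funext SE).
have {}HS : tends S S_lim by apply/tendsP.
have Smono M N : (M <= N)%N -> S M <= S N.
  move=> MN; rewrite /S (sum_cube_sub _ MN) [leRHS](bigID (fun b => b \in cube n M)) /= lerDl.
  by apply: sumr_ge0.
have Sle M : S M <= S_lim.
  apply/ler_addgt0Pr => e e0; have [N HN] := HS e e0.
  have := HN _ (leq_maxl N M); rewrite ler_norml => /andP[_ h].
  by have := Smono _ _ (leq_maxr N M); lra.
pose F N (y : V) := \sum_(b <- cube n N) monomial c (y - x) b.
have H : fast_cvg x rho (fun N => S_lim - S N) F f
   (fun j => (2 / rho) ^+ j * j`!%:R) (fun j => (S_lim + 1) * (2 / rho) ^+ j * j`!%:R).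
  have w0 j : 0 <= (2 / rho) ^+ j * j`!%:R :> R.
    by rewrite mulr_ge0 // exprn_ge0 // divr_ge0 // ltW.
  split=> //.
  - by move=> k N; case: (sum_monomials_maj x rho0 k (cube n N) xpredT c).
  - move=> M N k MN.
    have [_ h] := sum_monomials_maj x rho0 k (cube n N) (fun b => b \notin cube n M) c.
    apply: (@maj_ext _ _ _ _ _ (fun y => \sum_(b <- cube n N | b \notin cube n M) monomial c (y - x) b)).
    + exact: ball_opencv.
    + move=> y _; rewrite /F (sum_cube_sub _ MN) [X in _ = X - _](bigID (fun b => b \in cube n M)) /=.
      by rewrite addrAC subrr add0r.
    apply: maj_le h => // j; rewrite ler_wpM2r //.
    rewrite lerBrDr; apply: le_trans (Sle N).
    by rewrite /S (sum_cube_sub _ MN) [leRHS](bigID (fun b => b \in cube n M)) /= addrC.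
  - move=> N k; have [_ h] := sum_monomials_maj x rho0 k (cube n N) xpredT c.
    apply: maj_le h => // j; rewrite -mulrA ler_wpM2r //.
    by have := Sle N; rewrite /S; lra.
  - move=> y /ballcvP yx; apply/tendsP.
    have [|_] := Hc (y - x); first by apply: lt_le_trans yx _; move: rhor r0; lra.
    have -> : x + (y - x) = y by rewrite addrC subrK.
    have -> // : (fun N => F N y) =
      (fun N => \sum_(a : {ffun 'I_n -> 'I_N}) monomial c (y - x) [ffun i => (a i : nat)]).
    by apply/funext => N; rewrite /F -(sum_cube N (fun b => monomial c (y - x) b)).
have ep0 : tends (fun N => S_lim - S N) 0.
  move=> e e0; have [N0 HN] := HS e e0; exists N0 => N /HN.
  by rewrite distrC subr0.
have epge0 N : 0 <= S_lim - S N by rewrite subr_ge0.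
exists rho, (S_lim + 1), (2 / rho); split => //.
- by rewrite ltr_wpDl // (le_trans _ (Sle 0)) // /S sumr_ge0.
- by rewrite divr_gt0.
- by apply: subset_trans sU; apply: ball_le_sub; rewrite ge_min lexx orbT.
- exact: (fast_cvg_lim ep0 epge0 H).
Qed.

Lemma Ck_local k (U : set V) f : (forall x, U x -> exists r : R, 0 < r /\ Ck k (ball x r) f) ->
  Ck k U f.
Proof.
elim: k f => [|k IH] f H.
  by split => // x /H[r [r0 /Ck_cont]]; apply; exact: ballxx.
apply: CkS => [x /H[r [r0 /Ck_cont]]|i]; first by apply; exact: ballxx.
split; last by move=> x /H[r [r0 /Ck_der]]; apply; exact: ballxx.
by apply: IH => x /H[r [r0 /Ck_pd]] => h; exists r.
Qed.

Lemma analytic_cls (U : set V) f : open U ->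
  (forall x, U x -> analytic_at f x) -> cls RealAnalytic U f.
Proof.
move=> oU fa; split=> [k|_ x Ux].
  apply: Ck_local => x Ux.
  have [r [A [H [r0 _ _ _ Hm]]]] := analytic_at_maj oU Ux (fa x Ux).
  by exists r; split => //; case: (Hm k).
have [r [A [H [r0 A0 H0 rU Hm]]]] := analytic_at_maj oU Ux (fa x Ux).
by exists r, A, H; split => // k; case: (Hm k).
Qed.

End AnalyticToBounds.

(** * From Cauchy estimates to power series *)

Section BoundsToAnalytic.
Variables (R : realType) (n : nat).
Notation V := 'cV[R]_n.
Notation mindex := {ffun 'I_n -> nat}.
Implicit Types (f : V -> R) (h x : V) (w : seq 'I_n).

Definition Eh h f : V -> R := fun y => \sum_i h i 0 * pd i f y.

Lemma ray_der (h : V) f x (t : R) : C1at f (x + t *: h) ->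
  is_derive t 1 (fun s : R => f (x + s *: h)) (Eh h f (x + t *: h)).
Proof.
move=> Cf; apply: (chain_rule (f := f) (g := fun s : R => x + s *: h)) => // i.
by apply: (@ider_seg R V (fun y : V => y i 0) x h _ t); exact: ider_coord.
Qed.

Lemma ider_exp k (s : R) : is_derive s 1 (fun s : R => s ^+ k) (k%:R * s ^+ k.-1).
Proof.
have := is_deriveX k (is_derive_id s (1 : R)).
by rewrite exprfctE [_ *: 1]mulr1.
Qed.

Lemma fact_cancel (M p : R) k :
  M * p / k`!%:R = M / (k.+1%:R * k`!%:R) * (k.+1%:R * p).
Proof.
have k0 : k.+1%:R != 0 :> R by rewrite pnatr_eq0.
by rewrite invfM; set a := k`!%:R^-1; set b := k.+1%:R in k0 *; field.
Qed.

(** The functions M t^(N+1) / (N+1)! - D and M t^(N+1) / (N+1)! + D vanish at 0 and have nonnegative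
    derivative. *)
Lemma growth_bound (D dD : R -> R) (M : R) N :
  (forall t : R, 0 <= t <= 1 -> is_derive t 1 D (dD t)) -> D 0 = 0 ->
  (forall t : R, 0 <= t <= 1 -> `|dD t| <= M * t ^+ N / N`!%:R) ->
  forall t : R, 0 <= t <= 1 -> `|D t| <= M * t ^+ N.+1 / (N.+1)`!%:R.
Proof.
move=> dDE D0 dDM t t01; have /andP[t0 t1] := t01.
have key (e : R) : e = 1 \/ e = -1 -> e * D t <= M * t ^+ N.+1 / (N.+1)`!%:R.
  move=> He.
  pose G s := M / (N.+1)`!%:R * s ^+ N.+1 - e * D s.
  have dG (s : R) : 0 <= s <= 1 -> is_derive s 1 G (M * s ^+ N / N`!%:R - e * dD s).
    move=> s01.
    have -> : M * s ^+ N / N`!%:R - e * dD s =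
       (0 * s ^+ N.+1 + M / (N.+1)`!%:R * (N.+1%:R * s ^+ N)) - (0 * D s + e * dD s).
      by rewrite !mul0r !add0r factS natrM fact_cancel.
    refine (iderB (iderM (iderc _ _ _) _) (iderM (iderc _ _ _) (dDE s s01))).
    exact: ider_exp N.+1 s.
  have [] := @MVT_segment R G (fun s => M * s ^+ N / N`!%:R - e * dD s) 0 t t0.
  - move=> s; rewrite in_itv /= => /andP[s0 st]; apply: dG.
    by rewrite ltW //= (le_trans (ltW st) t1).
  - apply: derivable_within_continuous => s; rewrite in_itv /= => /andP[s0 st].
    by case: (dG s) => //; rewrite s0 (le_trans st t1).
  move=> s; rewrite in_itv /= subr0 => /andP[s0 st].
  rewrite /G D0 mulr0 subr0 expr0n /= mulr0 subr0 => E.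
  have : 0 <= (M * s ^+ N / N`!%:R - e * dD s) * t.
    apply: mulr_ge0 => //; rewrite subr_ge0; apply: le_trans (ler_norm _) _.
    have -> : `|e * dD s| = `|dD s| by rewrite normrM; case: He => ->; rewrite ?normrN normr1 mul1r.
    by apply: dDM; rewrite s0 (le_trans st t1).
  by rewrite -E subr_ge0; have -> : M / (N.+1)`!%:R * t ^+ N.+1 = M * t ^+ N.+1 / (N.+1)`!%:R by ring.
rewrite ler_norml; apply/andP; split.
  by rewrite lerNl -mulN1r; apply: key; right.
by rewrite -[D t]mul1r; apply: key; left.
Qed.

Lemma Ck_Eh k (U : set V) h f : open U -> Ck k.+1 U f -> Ck k U (Eh h f).
Proof.
move=> oU Cf; apply: Ck_sum => // i; apply: Ck_mul => //; first exact: Ck_cst.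
exact: Ck_pd.
Qed.

(** Induction on N with [Eh h f] in place of f: the t-derivative of the remainder of f is the
    remainder, one order lower, of [Eh h f]. *)
Lemma taylor c (r : R) h x N f M : ball c r x -> ball c r (x + h) ->
  (forall k, Ck k (ball c r) f) ->
  (forall y, ball c r y -> `|iter N (Eh h) f y| <= M) ->
  forall t : R, 0 <= t <= 1 ->
  `|f (x + t *: h) - \sum_(k < N) t ^+ k / k`!%:R * iter k (Eh h) f x| <= M * t ^+ N / N`!%:R.
Proof.
move=> bx bh; have oB : open (ball c r : set V) by exact: ball_opencv.
have bt (t : R) : 0 <= t <= 1 -> ball c r (x + t *: h) by move=> t01; exact: ball_seg.
elim: N f => [|N IH] f Cf HM t t01.
  by rewrite big_ord0 subr0 expr0 fact0 divr1 mulr1; apply: HM; exact: bt.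
have CEf := fun k => Ck_Eh h oB (Cf k.+1).
apply: (@growth_bound (fun t => f (x + t *: h) - \sum_(k < N.+1) t ^+ k / k`!%:R * iter k (Eh h) f x)
  (fun t => Eh h f (x + t *: h) - \sum_(k < N) t ^+ k / k`!%:R * iter k (Eh h) (Eh h f) x) M N) => //.
- move=> s s01.
  have -> : \sum_(k < N) s ^+ k / k`!%:R * iter k (Eh h) (Eh h f) x =
    \sum_(k < N.+1) ((k%:R * s ^+ k.-1 * k`!%:R^-1 + s ^+ k * 0) * iter k (Eh h) f x + s ^+ k / k`!%:R * 0).
    rewrite big_ord_recl /= !(mul0r, mulr0, addr0) add0r; apply: eq_bigr => k _.
    rewrite /bump add1n /= !(mulr0, addr0) -iterSr factS natrM; congr (_ * _).
    have := fact_cancel 1 (s ^+ k) k; rewrite !mul1r => ->.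
    by rewrite mulrC.
  refine (iderB (ray_der _) (ider_sum _ _)).
    by apply: (Ck1_C1at oB) => //; exact: bt.
  move=> k _; refine (iderM (iderM _ (iderc _ _ _)) (iderc _ _ _)).
  exact: ider_exp.
- rewrite scale0r addr0 big_ord_recl /= expr0 fact0 divr1 mul1r big1 ?addr0 ?subrr //.
  by move=> i _; rewrite /bump add1n expr0n /= !mul0r.
- move=> s s01; apply: IH => // y By; rewrite -iterSr; exact: HM.
Qed.

(** Iterating [Eh] produces ordered mixed derivatives, indexed by words of directions. Collecting
    the words by [wtype] leads to multi-indices without permuting derivatives. *)
Fixpoint words (k : nat) : seq (seq 'I_n) :=
  if k is k'.+1 then [seq i :: w | i <- enum 'I_n, w <- words k'] else [:: [::]].

Definition dw w f : V -> R := foldr (fun i g => pd i g) f w.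
Definition hw h w : R := \prod_(i <- w) h i 0.
Definition wtype w : mindex := [ffun i => count_mem i w].

Lemma sum_words k (G : seq 'I_n -> R) :
  \sum_(w <- words k.+1) G w = \sum_i \sum_(w <- words k) G (i :: w).
Proof. by rewrite /= big_allpairs_dep big_enum. Qed.

Lemma size_words k w : w \in words k -> size w = k.
Proof. by elim: k w => [|k IH] w /=; [rewrite inE => /eqP ->|move=> /allpairsP[[i v] /= [_ /IH <- ->]]]. Qed.

Lemma hw_wtype h w : hw h w = \prod_i h i 0 ^+ wtype w i.
Proof.
rewrite /hw; elim: w => [|i w IH].
  by rewrite big_nil big1 // => i _; rewrite ffunE.
rewrite big_cons IH [RHS](bigD1 i) //= [X in _ * X = _](bigD1 i) //= mulrA.
rewrite !ffunE /= eqxx exprS; congr (_ * _); apply: eq_bigr => j ji.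
by rewrite !ffunE /= eq_sym (negbTE ji).
Qed.

Lemma mdeg_wtype w : mdeg (wtype w) = size w.
Proof.
rewrite /mdeg; elim: w => [|i w IH]; first by rewrite big1 // => i _; rewrite ffunE.
rewrite /= -IH (bigD1 i) //= [in RHS](bigD1 i) //= !ffunE /= eqxx addSn; congr (_ + _).+1.
by apply: eq_bigr => j ji; rewrite !ffunE /= eq_sym (negbTE ji).
Qed.

Lemma Ck_dw w (U : set V) f : (forall k, Ck k U f) -> forall k, Ck k U (dw w f).
Proof. by move=> Cf; elim: w => //= i w IH k; exact: Ck_pd (IH k.+1). Qed.

Lemma maj_dw w (B : set V) a f : (forall k, maj k B a f) ->
  forall k, maj k B (fun j => a (size w + j)%N) (dw w f).
Proof.
move=> Hf; elim: w => [|i w IH] k //=.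
by apply: maj_le (maj_pd i (IH k.+1)) => // j /=; rewrite addnS.
Qed.

Lemma iterEh_words k (U : set V) h f y : open U -> (forall k, Ck k U f) -> U y ->
  iter k (Eh h) f y = \sum_(w <- words k) hw h w * dw w f y.
Proof.
move=> oU Cf; elim: k y => [|k IH] y Uy.
  by rewrite /= big_seq1 /hw big_nil mul1r.
rewrite sum_words /= {1}/Eh; apply: eq_bigr => i _.
rewrite (pd_ext i oU IH Uy) /pd.
have [_ ->] : is_derive y (delta_mx i 0) (fun y => \sum_(w <- words k) hw h w * dw w f y)
   (\sum_(w <- words k) (0 * dw w f y + hw h w * pd i (dw w f) y)).
  apply: ider_sum => w _; refine (iderM (iderc _ _ _) _).
  exact: Ck_der (Ck_dw w Cf 1%N) Uy.
by rewrite mulr_sumr; apply: eq_bigr => w _; rewrite mul0r add0r mulrA /hw big_cons.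
Qed.

Lemma hw_le h w : `|hw h w| <= `|h| ^+ size w.
Proof.
rewrite /hw; elim: w => [|i w IH]; first by rewrite big_nil normr1.
by rewrite big_cons normrM exprS ler_pM // coord_le_cvnorm.
Qed.

Lemma size_words_card k : size (words k) = (n ^ k)%N.
Proof.
elim: k => // k IH; by rewrite /= size_allpairs size_enum_ord IH expnS.
Qed.

(** There are n^k words of length k, each contributing at most A (H |h|)^k, so the Taylor terms are
    bounded by A th^k with th = n H |h|. The work lies in passing from summation by degree to
    summation over cubes. *)
Lemma maj_analytic_at f x (r A H : R) : 0 < r -> 0 < A -> 0 < H ->
  (forall k, Ck k (ball x r) f) ->
  (forall k, maj k (ball x r) (fun j => A * H ^+ j * j`!%:R) f) ->
  analytic_at f x.
Proof.
move=> r0 A0 H0 Cf Hf.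
have oB : open (ball x r : set V) by exact: ball_opencv.
have bx : ball x r x by exact: ballxx.
(* The Taylor coefficient; the number of words of type b supplies the multinomial factor. *)
pose c (b : mindex) : R :=
  (\sum_(w <- words (mdeg b) | wtype w == b) dw w f x) / (mdeg b)`!%:R.
(* Ensures th <= 1/2; n.+1 keeps the inverted number positive for n = 0. *)
pose del := Order.min r (2 * n.+1%:R * H)^-1.
have nH0 : 0 < 2 * n.+1%:R * H by rewrite !mulr_gt0.
exists c, del; split; first by rewrite lt_min r0 invr_gt0.
move=> h; rewrite lt_min => /andP[hr hd].
pose th := n%:R * H * `|h|.
have th0 : 0 <= th by rewrite !mulr_ge0 // ltW.
have th2 : th <= 2^-1.
  have : `|h| * (2 * n.+1%:R * H) < 1 by rewrite -ltr_pdivlMr // mul1r.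
  have : n%:R <= n.+1%:R :> R by rewrite ler_nat.
  by have := normr_ge0 h; rewrite /th; move: H0; nra.
have bh : ball x r (x + h) by apply/ballcvP; rewrite addrAC subrr add0r.
have dwM w : `|dw w f x| <= A * H ^+ size w * (size w)`!%:R.
  by have := maj0 (maj_dw w Hf 0) bx; rewrite addn0.
pose G w := hw h w * dw w f x / (size w)`!%:R.
have GM w : `|G w| <= A * (H * `|h|) ^+ size w.
  rewrite /G normrM normfV [X in _ / X]ger0_norm // ler_pdivrMr ?ltr0n ?fact_gt0 //.
  rewrite normrM exprMn [leRHS](_ : _ = `|h| ^+ size w * (A * H ^+ size w * (size w)`!%:R)); last by ring.
  by apply: ler_pM => //; exact: hw_le.
have sumG k : \sum_(w <- words k) `|G w| <= A * th ^+ k.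
  apply: (@le_trans _ _ (\sum_(w <- words k) A * (H * `|h|) ^+ k)).
    rewrite big_seq [leRHS]big_seq; apply: ler_sum => w /size_words <-; exact: GM.
  rewrite big_const_seq count_predT size_words_card iter_addr addr0 -mulr_natl natrX /th -mulrA [X in _ <= _ * X]exprMn.
  by rewrite [leLHS](_ : _ = A * (n%:R ^+ k * (H * `|h|) ^+ k)) //; ring.
have cE b K : (mdeg b < K)%N -> monomial c h b =
    \sum_(k < K) \sum_(w <- words k | wtype w == b) G w.
  move=> bK; rewrite (bigD1 (Ordinal bK)) //= [X in _ = _ + X]big1 ?addr0; last first.
    move=> k kb; rewrite big_seq_cond big1 // => w /andP[/size_words ws /eqP wb].
    by move: kb; rewrite -(inj_eq val_inj) /= -wb mdeg_wtype ws eqxx.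
  rewrite /monomial /c mulr_suml mulr_suml [LHS]big_seq_cond [RHS]big_seq_cond.
  apply: eq_bigr => w /andP[/size_words ws /eqP wb].
  by rewrite /G hw_wtype wb ws; ring.
have cubeK N b : b \in cube n N -> (mdeg b < (n * N).+1)%N.
  rewrite mem_cube => /forallP bN; rewrite ltnS /mdeg.
  rewrite -[n in (n * N)%N]card_ord -sum_nat_const; apply: leq_sum => i _; exact: ltnW.
have sumE (F : mindex -> seq 'I_n -> R) N K :
    \sum_(b <- cube n N) \sum_(k < K) \sum_(w <- words k | wtype w == b) F b w =
    \sum_(k < K) \sum_(w <- words k | wtype w \in cube n N) F (wtype w) w.
  rewrite exchange_big; apply: eq_bigr => k _.
  under eq_bigr do rewrite big_mkcond.
  rewrite exchange_big /= [RHS]big_mkcond; apply: eq_bigr => w _.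
  case: ifP => wN.
    rewrite (bigD1_seq (wtype w)) ?cube_uniq //= eqxx big1 ?addr0 //.
    by move=> b; rewrite eq_sym => /negbTE ->.
  rewrite big_seq_cond big1 // => b /andP[bN _]; case: eqP => // E.
  by rewrite E bN in wN.
have geo m K : \sum_(k < K) A * th ^+ (m + k) <= 2 * A * th ^+ m.
  under eq_bigr do rewrite exprD mulrA.
  rewrite -mulr_sumr [leRHS](_ : _ = A * th ^+ m * 2); last by ring.
  rewrite ler_wpM2l ?mulr_ge0 ?exprn_ge0 ?(ltW A0) //.
  apply: le_trans (geometric_half R K); apply: ler_sum => k _.
  by apply: lerXn2r; rewrite ?nnegrE ?invr_ge0.
split.
  apply: nondecreasing_is_cvgn.
    move=> M N MN; rewrite !(sum_cube _ (fun b => `|monomial c h b|)).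
    rewrite (sum_cube_sub _ MN) [leRHS](bigID (fun b => b \in cube n M)) /= lerDl.
    exact: sumr_ge0.
  exists (2 * A) => _ [N _ <-]; rewrite (sum_cube _ (fun b => `|monomial c h b|)).
  apply: (@le_trans _ _ (\sum_(b <- cube n N) \sum_(k < (n * N).+1) \sum_(w <- words k | wtype w == b) `|G w|)).
    rewrite big_seq [leRHS]big_seq; apply: ler_sum => b /cubeK bK.
    rewrite (cE b _ bK); apply: le_trans (ler_norm_sum _ _ _) _; apply: ler_sum => k _.
    exact: ler_norm_sum.
  rewrite (sumE (fun _ w => `|G w|)).
  apply: (@le_trans _ _ (\sum_(k < (n * N).+1) A * th ^+ (0 + k))).
    apply: ler_sum => k _; apply: le_trans (sumG k).
    by rewrite [leRHS](bigID (fun w => wtype w \in cube n N)) /= lerDl sumr_ge0.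
  by apply: le_trans (geo _ _) _; rewrite expr0 mulr1.
have Tay K : `|f (x + h) - \sum_(k < K) \sum_(w <- words k) G w| <= A * th ^+ K.
  have MK y : ball x r y -> `|iter K (Eh h) f y| <= A * th ^+ K * K`!%:R.
    move=> By; rewrite (iterEh_words K h oB Cf By).
    apply: le_trans (ler_norm_sum _ _ _) _.
    apply: (@le_trans _ _ (\sum_(w <- words K) A * (H * `|h|) ^+ K * K`!%:R)).
      rewrite big_seq [leRHS]big_seq; apply: ler_sum => w /size_words ws.
      have := maj0 (maj_dw w Hf 0) By; rewrite addn0 ws normrM => h1.
      rewrite exprMn [leRHS](_ : _ = `|h| ^+ K * (A * H ^+ K * K`!%:R)); last by ring.
      by apply: ler_pM => //; rewrite -ws; exact: hw_le.
    rewrite big_const_seq count_predT size_words_card iter_addr addr0 -[X in X <= _]mulr_natl natrX /th.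
    by rewrite !exprMn [leLHS](_ : _ = A * (n%:R ^+ K * H ^+ K * `|h| ^+ K) * K`!%:R) //; ring.
  have := taylor bx bh Cf MK; move=> /(_ 1); rewrite ler01 lexx => /(_ isT).
  rewrite scale1r expr1n mulr1 mulfK ?pnatr_eq0 -?lt0n ?fact_gt0 //.
  congr (`|_ - _| <= _); apply: eq_bigr => k _.
  rewrite expr1n mul1r (iterEh_words k h oB Cf bx) mulr_sumr [LHS]big_seq [RHS]big_seq.
  by apply: eq_bigr => w /size_words ws; rewrite /G ws mulrC.
have main N : `|\sum_(b <- cube n N) monomial c h b - f (x + h)| <= 3 * A * th ^+ N.
  (* Large enough that every word with type in the cube has length below K; the excess over N shows
     that K is at least N, so the Taylor remainder is also small. *)
  pose K := (N + (n * N).+1)%N.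
  have -> : \sum_(b <- cube n N) monomial c h b =
      \sum_(k < K) \sum_(w <- words k | wtype w \in cube n N) G w.
    rewrite -(sumE (fun _ w => G w)) big_seq [RHS]big_seq; apply: eq_bigr => b /cubeK bK.
    by apply: cE; rewrite /K; apply: leq_trans bK _; rewrite leq_addl.
  pose T := \sum_(k < K) \sum_(w <- words k | wtype w \notin cube n N) G w.
  have TE : \sum_(k < K) \sum_(w <- words k) G w =
      \sum_(k < K) \sum_(w <- words k | wtype w \in cube n N) G w + T.
    by rewrite -big_split /=; apply: eq_bigr => k _; rewrite (bigID (fun w => wtype w \in cube n N)).
  have TM : `|T| <= 2 * A * th ^+ N.
    (* No letter of a word of length below N occurs N times, so such words lie in the cube and T
       contains only lengths N and above. *)
    rewrite /T /K big_split_ord /= [X in `|X + _|]big1 ?add0r; last first.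
      move=> k _; rewrite big_seq_cond big1 // => w /andP[/size_words ws].
      rewrite mem_cube => /negP[]; apply/forallP => i; rewrite ffunE.
      by apply: leq_ltn_trans (count_size _ _) _; rewrite ws.
    apply: le_trans (ler_norm_sum _ _ _) _; apply: le_trans (geo N (n * N).+1).
    apply: ler_sum => k _; apply: le_trans (sumG (N + k)%N).
    apply: le_trans (ler_norm_sum _ _ _) _.
    by rewrite [leRHS](bigID (fun w => wtype w \notin cube n N)) /= lerDl sumr_ge0.
  have := Tay K; rewrite TE distrC => h1.
  have h2 : A * th ^+ K <= A * th ^+ N.
    rewrite ler_wpM2l ?(ltW A0) // /K exprD ler_piMr ?exprn_ge0 //.
    by rewrite exprn_ile1 // (le_trans th2) // invf_le1 // ler1n.
  set S := \sum_(k < K) _ in h1 *.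
  have -> : S - f (x + h) = (S + T - f (x + h)) - T by ring.
  apply: le_trans (ler_normB _ _) _.
  have -> : 3 * A * th ^+ N = A * th ^+ N + 2 * A * th ^+ N by ring.
  by rewrite lerD // (le_trans h1).
apply/tendsP => e e0; have [N0 HN] := tends_harmonic (3 * A) e0; exists N0 => N /HN.
rewrite subr0 (sum_cube N (monomial c h)) => h1; apply: le_trans (main N) _; apply: le_trans h1.
apply: le_trans (ler_norm _); rewrite ler_wpM2l ?mulr_ge0 ?(ltW A0) //.
apply: (@le_trans _ _ (2^-1 ^+ N)); first by apply: lerXn2r; rewrite ?nnegrE ?invr_ge0.
by rewrite exprVn lef_pV2 ?posrE ?exprn_gt0 // -natrX ler_nat ltn_expl.
Qed.

Lemma class_onP (cat : category) (U : set V) f : open U ->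
  class_on cat U f <-> cls cat U f.
Proof.
move=> oU; split; case: cat => /=; [by split|exact: analytic_cls|by case|].
move=> [Cf /(_ erefl) fa] x Ux; have [r [A [H [r0 A0 H0 rU Hm]]]] := fa x Ux.
by apply: maj_analytic_at Hm => // k; exact: Ck_sub (Cf k).
Qed.

End BoundsToAnalytic.

(** * Spectral data of a Jordan form *)

Section JordanSpectrum.
Variable F : fieldType.

Lemma similar_char_poly n m (A : 'M[F]_n) (J : 'M[F]_m) P Q :
  P *m Q = 1%:M -> Q *m P = 1%:M -> A = P *m J *m Q -> n = m /\ char_poly A = char_poly J.
Proof.
move=> PQ QP AE.
have e : n = m by apply/eqP; rewrite eqn_leq (mulmx1_min PQ) (mulmx1_min QP).
split=> //; subst m; rewrite AE /char_poly.
have -> : char_poly_mx (P *m J *m Q) =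
    map_mx polyC P *m char_poly_mx J *m map_mx polyC Q.
  rewrite /char_poly_mx !map_mxM mulmxBr mulmxBl; congr (_ - _).
  by rewrite scalar_mxC -mulmxA -map_mxM PQ map_mx1 mulmx1.
by rewrite !det_mulmx mulrAC -det_mulmx -map_mxM PQ map_mx1 det1 mul1r.
Qed.

Lemma trig_trace_mul n (A B : 'M[F]_n) : is_trig_mx A -> is_trig_mx B ->
  is_trig_mx (A *m B) /\ forall i, (A *m B) i i = A i i * B i i.
Proof.
move=> /is_trig_mxP tA /is_trig_mxP tB; split=> [|i].
  apply/is_trig_mxP => i j ij; rewrite mxE big1 // => k _.
  have [ik|ki] := ltnP i k; first by rewrite tA // mul0r.
  by rewrite tB ?mulr0 //; apply: leq_ltn_trans ij.
rewrite mxE (bigD1 i) //= big1 ?addr0 // => k ki.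
have [ik|ik|/val_inj e] := ltngtP i k; first by rewrite tA // mul0r.
  by rewrite (tB k i) ?mulr0.
by rewrite e eqxx in ki.
Qed.

(** The Jordan blocks have their ones above the diagonal, while [is_trig_mx] means lower triangular;
    hence the transpose. *)
Lemma jordan_trig (s : seq (F * nat)) : is_trig_mx (jordan_mx s)^T.
Proof.
rewrite /jordan_mx tr_mxdiag /mxdiag; apply/is_trig_mxblockP; split=> [i j ij|i].
  by rewrite (_ : (i == j) = false) //; apply/negbTE; rewrite -val_eqE ltn_eqF.
rewrite eqxx conform_mx_id; apply/is_trig_mxP => a b ab; rewrite !mxE.
rewrite (_ : (b == a) = false); last by apply/negbTE; rewrite -val_eqE gtn_eqF.
by rewrite ltn_eqF // ltnS ltnW.
Qed.

Lemma jordan_diag (s : seq (F * nat)) k : jordan_mx s k k = (block_at s (tagnat.sig1 k)).1.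
Proof. by rewrite /jordan_mx !mxE eqxx conform_mx_id mxE eqxx. Qed.

(** Powers up to the third are what determines the differential of a nonreal eigenvalue from those
    of traces. *)
Lemma jordan_spectrum n (A : 'M[F]_n) (s : seq (F * nat)) : jordan_form A s ->
  (exists d : 'I_n -> F, [/\ char_poly A = \prod_i ('X - (d i)%:P),
    [/\ \tr A = \sum_i d i, \tr (A *m A) = \sum_i d i ^+ 2 &
        \tr (A *m (A *m A)) = \sum_i d i ^+ 3] &
    forall i, d i \in map fst s]) /\
  forall b, b \in s -> eigenvalue A b.1.
Proof.
move=> [/allP s0 [P [Q [PQ QP AE]]]].
have [e cAJ] := similar_char_poly PQ QP AE.
have cJ : char_poly A = \prod_i ('X - (jordan_mx s i i)%:P).
  have -> : char_poly A = char_poly (jordan_mx s)^T.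
    rewrite cAJ /char_poly -det_tr /char_poly_mx linearB /= tr_scalar_mx -map_trmx //.
  rewrite char_poly_trig ?jordan_trig //.
  by apply: eq_bigr => i _; rewrite mxE.
split; last first.
  move=> b bs; rewrite eigenvalue_root_char cJ.
  have b0 : (0 < (block_at s (index b s)).2)%N by rewrite /block_at nth_index // s0.
  have ib : (index b s < size s)%N by rewrite index_mem.
  pose k := @tagnat.Rank (size s) (fun i => (block_at s i).2) (Ordinal ib) (Ordinal b0).
  rewrite /root horner_prod (bigD1 k) //= !hornerE jordan_diag tagnat.Rank1K /=.
  by rewrite /block_at nth_index // subrr mul0r.
have ds k : jordan_mx s k k \in map fst s.
  by rewrite jordan_diag map_f // /block_at mem_nth.
have tJ := jordan_trig s.
have [tJ2 dJ2] := trig_trace_mul tJ tJ.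
have [tJ3 dJ3] := trig_trace_mul tJ tJ2.
have trE B : \tr (P *m B *m Q) = \tr B by rewrite mxtrace_mulC mulmxA QP mul1mx.
have A2 : A *m A = P *m (jordan_mx s *m jordan_mx s) *m Q.
  rewrite {1}AE AE -!mulmxA; do 2 congr (_ *m _).
  by rewrite mulmxA QP mul1mx.
have A3 : A *m (A *m A) = P *m (jordan_mx s *m (jordan_mx s *m jordan_mx s)) *m Q.
  rewrite {1}AE A2 -!mulmxA; do 2 congr (_ *m _).
  by rewrite mulmxA QP mul1mx.
have cast (G : F -> F) : \sum_i G (jordan_mx s i i) = \sum_i G (jordan_mx s (cast_ord e i) (cast_ord e i)).
  by rewrite (reindex (cast_ord e)) //; exists (cast_ord (esym e)) => i _; rewrite ?cast_ordK ?cast_ordKV.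
exists (fun i => jordan_mx s (cast_ord e i) (cast_ord e i)); split=> //.
- by rewrite cJ (reindex (cast_ord e)) //; exists (cast_ord (esym e)) => i _; rewrite ?cast_ordK ?cast_ordKV.
- split; first by rewrite AE trE -(cast id).
  + rewrite A2 trE -(cast (fun z => z ^+ 2)) -mxtrace_tr trmx_mul.
    by apply: eq_bigr => i _; rewrite dJ2 mxE.
  + rewrite A3 trE -(cast (fun z => z ^+ 3)) -mxtrace_tr !trmx_mul -mulmxA.
    by apply: eq_bigr => i _; rewrite dJ3 dJ2 mxE.
Qed.

Lemma jordan_block_rank k (a b : F) : (k <= \rank (jordan_block k a - b%:M)%R + (a == b))%N.
Proof.
case: eqVneq => [->|ab]; rewrite ?addn0.
  case: k => // k; rewrite addn1 ltnS; set N := _ - _.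
  (* Deleting the last row and the first column of the nilpotent block leaves the identity
     matrix. *)
  have rk : \rank (rowsub (lift ord_max) 1%:M *m N *m colsub (lift ord0) 1%:M : 'M[F]_k) = k.
    rewrite -[X in _ = X](mxrank1 F); congr (\rank _); apply/matrixP => i j.
    rewrite !mxE (bigD1 (lift ord0 j)) //= big1 => [|l lj]; last first.
      by rewrite [X in _ * X]mxE [X in _ * X]mxE (negbTE lj) mulr0.
    rewrite [X in _ * X]mxE [X in _ * X]mxE eqxx mulr1 addr0 mxE (bigD1 (lift ord_max i)) //= big1 => [|l lj].
      rewrite !mxE eqxx mul1r addr0 -!val_eqE /= /bump leqNgt ltn_ord add0n eqSS [X in X = _]/=.
      rewrite (eq_sym (val j)); case: eqVneq => [e|_]; rewrite ?subr0 ?mulr0n ?mulr1n ?subrr //.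
      by rewrite e gtn_eqF.
    by rewrite !mxE eq_sym (negbTE lj) mul0r.
  by rewrite -[X in (X <= _)%N]rk; apply: leq_trans (mxrankM_maxl _ _) (mxrankM_maxr _ _).
rewrite -mxrank_tr mxrank_unit // unitmxE unitfE det_trig.
  rewrite prodf_seq_neq0; apply/allP => i _ /=.
  by rewrite !mxE !eqxx mulr1n subr_eq0 ab.
apply/is_trig_mxP => i j ij; rewrite !mxE.
rewrite (_ : (j == i) = false); last by apply/negbTE; rewrite -val_eqE gtn_eqF.
by rewrite ltn_eqF ?subr0 // ltnS ltnW.
Qed.

(** Only a block with eigenvalue a loses rank, and it loses one; distinct blocks having distinct
    eigenvalues, there is at most one such block. Thus eigenspaces are at most lines. *)
Lemma jordan_rank n (A : 'M[F]_n) s a : jordan_form A s -> uniq (map fst s) ->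
  (n <= (\rank (A - a%:M)%R).+1)%N.
Proof.
move=> [_ [P [Q [PQ QP AE]]]] us; have [e _] := similar_char_poly PQ QP AE.
have -> : \rank (A - a%:M) = \rank (jordan_mx s - a%:M).
  have AE' : A - a%:M = P *m (jordan_mx s - a%:M) *m Q.
    by rewrite AE mulmxBr mulmxBl scalar_mxC -[a%:M *m P *m Q]mulmxA PQ mulmx1.
  have JE : jordan_mx s - a%:M = Q *m (A - a%:M) *m P.
    by rewrite AE' !mulmxA QP mul1mx -mulmxA QP mulmx1.
  apply/eqP; rewrite eqn_leq; apply/andP; split.
    by rewrite AE'; apply: leq_trans (mxrankM_maxl _ _) (mxrankM_maxr _ _).
  by rewrite JE; apply: leq_trans (mxrankM_maxl _ _) (mxrankM_maxr _ _).
rewrite e /jordan_mx -mxdiagZ -mxdiagB rank_mxdiag -addn1.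
apply: (@leq_trans (\sum_(i < size s) (\rank (jordan_block (block_at s i).2 (block_at s i).1 - a%:M)%R
   + ((block_at s i).1 == a))%N)).
  by apply: leq_sum => i _; apply: jordan_block_rank.
rewrite big_split /= leq_add2l.
have -> : (\sum_(i < size s) ((block_at s i).1 == a))%N = count_mem a (map fst s).
  rewrite -sum1_count big_map (big_nth (0, 0%N)) big_mkord [in RHS]big_mkcond.
  by apply: eq_bigr => i _; rewrite /block_at -[LHS]/(nat_of_bool (_ == _)) /=; case: (_ == a).
by rewrite count_uniq_mem //; case: (_ \in _).
Qed.

(* A nonzero row annihilated by all A^k e generates a left invariant subspace,
   hence yields a left eigenvector, proportional to some alpha_a. *)
Lemma cyclic_vector n (A : 'M[F]_n.+1) (e : 'cV[F]_n.+1) (d : seq F) (al : F -> 'rV[F]_n.+1) :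
  char_poly A = \prod_(a <- d) ('X - a%:P) ->
  (forall a, n.+1 <= (\rank (A - a%:M)%R).+1)%N ->
  (forall a, a \in d -> al a *m A = a *: al a /\ al a *m e = 1%:M) ->
  forall be : 'rV[F]_n.+1, (forall k, be *m (A ^+ k *m e) = 0) -> be = 0.
Proof.
move=> cA rA hal be kbe; apply/eqP/negPn/negP => be0.
have : be *m \prod_(a <- d) (A - a%:M) = 0.
  have := Cayley_Hamilton A; rewrite cA rmorph_prod /= => h.
  rewrite -[RHS](mulmx0 _ be) -{}[in RHS]h; congr (_ *m _); apply: eq_bigr => a _.
  by rewrite rmorphB /= horner_mx_X horner_mx_C.
have {cA} : {subset d <= d} by [].
move: {1 3}d => l; elim: l be be0 kbe => [|a l IH] be be0 kbe ld.
  by rewrite big_nil mulmx1 => /eqP; rewrite (negbTE be0).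
rewrite big_cons mulmxA; case: (eqVneq (be *m (A - a%:M)) 0) => [h _|h]; last first.
  apply: IH => // [k|x xl]; last by rewrite ld // in_cons xl orbT.
  rewrite -mulmxA mulmxBl mul_scalar_mx mulmxBr -scalemxAr kbe scaler0 subr0.
  by rewrite (mulmxA A) (_ : A *m A ^+ k = A ^+ k.+1) ?kbe // exprS.
have [alA ale] : al a *m A = a *: al a /\ al a *m e = 1%:M by apply: hal; rewrite ld ?mem_head.
have al0 : al a != 0.
  apply/eqP => z; move: ale; rewrite z mul0mx => /matrixP /(_ 0 0); rewrite !mxE /= => /esym/eqP.
  by rewrite oner_eq0.
have bK : (be <= kermx (A - a%:M))%MS by apply/sub_kermxP.
have aK : (al a <= kermx (A - a%:M))%MS.
  by apply/sub_kermxP; rewrite mulmxBr alA mul_mx_scalar subrr.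
have Ka : (kermx (A - a%:M) <= al a)%MS.
  rewrite -(geq_leqif (mxrank_leqif_sup aK)) mxrank_ker rank_rV al0.
  by move: (rA a); set r := \rank _; rewrite leq_subLR addn1.
have /sub_rVP [c bE] := submx_trans bK Ka.
have := kbe 0%N; rewrite expr0 mul1mx bE -scalemxAl ale => /matrixP /(_ 0 0).
rewrite !mxE mulr1 => c0; move: be0; rewrite bE c0 scale0r eqxx //.
Qed.
End JordanSpectrum.

Local Notation Re := complex.Re.
Local Notation Im := complex.Im.

Section ComplexNumbers.
Variable R : realType.
Local Notation C := R[i].
Implicit Types z w : C.

Definition cx : {poly R} -> {poly C} := map_poly (real_complex R).

Lemma ReD z w : Re (z + w) = Re z + Re w. Proof. by case: z; case: w. Qed.
Lemma ImD z w : Im (z + w) = Im z + Im w. Proof. by case: z; case: w. Qed.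
Lemma ReN z : Re (- z) = - Re z. Proof. by case: z. Qed.
Lemma ImN z : Im (- z) = - Im z. Proof. by case: z. Qed.
Lemma cReM z w : Re (z * w) = Re z * Re w - Im z * Im w. Proof. by case: z; case: w. Qed.
Lemma cImM z w : Im (z * w) = Re z * Im w + Im z * Re w.
Proof. by case: z => a b; case: w => c d /=; rewrite [b * c]mulrC addrC. Qed.
Lemma ReIm_eq z w : Re z = Re w -> Im z = Im w -> z = w.
Proof. by case: z => a b; case: w => c d /= -> ->. Qed.
Lemma ReC (a : R) : Re (a%:C)%C = a. Proof. by []. Qed.
Lemma ImC (a : R) : Im (a%:C)%C = 0. Proof. by []. Qed.
Lemma cRe_conj z : Re (z^*)%C = Re z. Proof. by case: z. Qed.
Lemma cIm_conj z : Im (z^*)%C = - Im z. Proof. by case: z. Qed.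

Lemma Re_sum (I : Type) (r : seq I) (P : pred I) (h : I -> C) :
  Re (\sum_(i <- r | P i) h i) = \sum_(i <- r | P i) Re (h i).
Proof. by apply: (big_morph _ ReD). Qed.
Lemma Im_sum (I : Type) (r : seq I) (P : pred I) (h : I -> C) :
  Im (\sum_(i <- r | P i) h i) = \sum_(i <- r | P i) Im (h i).
Proof. by apply: (big_morph _ ImD). Qed.

Lemma cx_conj (g : {poly R}) z : root (cx g) (z^*)%C = root (cx g) z.
Proof.
rewrite -complex_root_conj -map_poly_comp (_ : map_poly _ g = cx g) //.
by apply: eq_map_poly => a /=; rewrite oppr0.
Qed.

End ComplexNumbers.

(** * Eigenvalues expressed by traces *)

Section Spectral.
Variable R : realType.
Local Notation C := R[i].

(* mu carries the spectral information of A: in the two cases of the theorem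
   the characteristic polynomial is (X - mu)^s, with mu real, and
   (X - mu)^s (X - conj mu)^s. *)
Definition spectral (s n : nat) (A : 'M[R]_n) (mu : C) : Prop :=
  [/\ forall g : {poly R}, (('X - mu%:P) ^+ s %| cx g) = (char_poly A %| g),
      forall z, root (cx (char_poly A)) z -> z = mu \/ z = (mu^*)%C &
      [/\ \tr A = n%:R * Re mu, \tr (A *m A) = n%:R * Re (mu ^+ 2) &
          \tr (A *m (A *m A)) = n%:R * Re (mu ^+ 3)]].

Lemma cx_char_poly n (A : 'M[R]_n) : cx (char_poly A) = char_poly (complexify A).
Proof. exact: map_char_poly. Qed.

Lemma segre_size n (A : 'M[R]_n) sigma (l : seq C) : segre A sigma -> eigenvalues_are l A ->
  (size sigma <= size l)%N.
Proof.
move=> [s js <-] hl; rewrite size_map; apply: uniq_leq_size; first exact: undup_uniq.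
move=> a; rewrite mem_undup => /mapP [b bs ->]; rewrite -hl.
by case: (jordan_spectrum js) => _; apply.
Qed.

Lemma segre_spectrum n (A : 'M[R]_n) sigma : segre A sigma ->
  exists (d : 'I_n -> C) l, [/\ (size l <= size sigma)%N, forall i, d i \in l,
     char_poly (complexify A) = \prod_i ('X - (d i)%:P) &
    [/\ (\tr A)%:C%C = \sum_i d i, (\tr (A *m A))%:C%C = \sum_i d i ^+ 2 &
        (\tr (A *m (A *m A)))%:C%C = \sum_i d i ^+ 3]].
Proof.
move=> [s js <-]; have [[d [cA [t1 t2 t3] ds]] _] := jordan_spectrum js.
exists d, (undup (map fst s)); split=> //; first by rewrite size_map.
  by move=> i; rewrite mem_undup.
by split; rewrite -?t1 -?t2 -?t3 /complexify -?map_mxM trace_map_mx.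
Qed.

Lemma root_spectrum n (A : 'M[R]_n) (d : 'I_n -> C) z :
  char_poly (complexify A) = \prod_i ('X - (d i)%:P) ->
  reflect (exists i, z = d i) (root (char_poly (complexify A)) z).
Proof.
move=> ->; rewrite -(big_map d predT (fun a => 'X - a%:P)) root_prod_XsubC.
by apply: (iffP mapP) => [[i _ ->]|[i ->]]; exists i; rewrite ?mem_index_enum.
Qed.

Lemma spectral_single n (A : 'M[R]_n.+1) sigma : segre A sigma -> (size sigma <= 1)%N ->
  spectral n.+1 A (\tr A / n.+1%:R)%:C%C.
Proof.
move=> sg s1; have [d [l [ls dl cA [t1 t2 t3]]]] := segre_spectrum sg.
have n0 : n.+1%:R != 0 :> R by rewrite pnatr_eq0.
set mu := (_%:C)%C; have dmu i : d i = mu.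
  have dc : d = fun=> d ord0.
    apply/funext => j; have := leq_trans ls s1; have := dl j; have := dl ord0.
    by case: (l) => [|a [|]] //; rewrite !inE => /eqP -> /eqP ->.
  rewrite /mu; move: t1; rewrite dc sumr_const card_ord => t1.
  apply: (@mulfI _ n.+1%:R); first by rewrite pnatr_eq0.
  have nC : n.+1%:R = (n.+1%:R)%:C%C :> C by rewrite rmorph_nat.
  by rewrite [LHS]mulr_natl -t1 nC -rmorphM /= mulrC divfK.
have cA' : char_poly (complexify A) = ('X - mu%:P) ^+ n.+1.
  by rewrite cA (eq_bigr (fun=> 'X - mu%:P)) ?prodr_const ?card_ord // => i _; rewrite dmu.
split.
- by move=> g; rewrite -cA' -cx_char_poly /cx dvdp_map.
- by move=> z; rewrite cx_char_poly => /(root_spectrum _ cA) [i ->]; left.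
- have tE k (t : R) : t%:C%C = \sum_i d i ^+ k -> t = n.+1%:R * Re (mu ^+ k).
    move=> /(congr1 (@complex.Re R)); rewrite Re_sum (eq_bigr (fun=> Re (mu ^+ k))); last first.
      by move=> i _; rewrite dmu.
    by rewrite sumr_const card_ord mulr_natl.
  by split; [rewrite -[mu]expr1|idtac..]; apply: tE.
Qed.

(** The imaginary part of the real trace shows that [mu] and its conjugate occur equally often. For
    a real polynomial, divisibility by (X - mu)^s implies that by the conjugate power, and the two
    are coprime. *)
Lemma conj_spectrum n (A : 'M[R]_n) (d : 'I_n -> C) mu : Im mu != 0 ->
  char_poly (complexify A) = \prod_i ('X - (d i)%:P) ->
  (forall i, d i = mu \/ d i = (mu^*)%C) ->
  (\tr A)%:C%C = \sum_i d i -> (\tr (A *m A))%:C%C = \sum_i d i ^+ 2 ->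
  (\tr (A *m (A *m A)))%:C%C = \sum_i d i ^+ 3 ->
  exists2 s : nat, n = (2 * s)%N & spectral s A mu.
Proof.
move=> mu0 cA dmu t1 t2 t3.
have neq : (mu^*)%C != mu.
  by apply/eqP => /(congr1 (@complex.Im R)); rewrite cIm_conj => h; move/negP: mu0; apply; apply/eqP; lra.
pose s := #|[pred i | d i == mu]|; pose s' := #|[pred i | d i != mu]|.
have dE i : d i != mu -> d i = (mu^*)%C by case: (dmu i) => ->; rewrite ?eqxx.
have sE (G : C -> R) : \sum_i G (d i) = s%:R * G mu + s'%:R * G (mu^*)%C.
  rewrite (bigID [pred i | d i == mu]) /=; congr (_ + _).
    rewrite (eq_bigr (fun=> G mu)) ?sumr_const ?mulr_natl // => i /eqP -> //.
  by rewrite (eq_bigr (fun=> G (mu^*)%C)) ?sumr_const ?mulr_natl // => i /dE ->.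
have ss : s = s'.
  have := congr1 (@complex.Im R) t1; rewrite Im_sum ImC sE cIm_conj mulrN => /esym/eqP.
  rewrite subr_eq0 => /eqP /(mulIf mu0) /eqP; rewrite eqr_nat => /eqP //.
have ns : n = (2 * s)%N.
  by rewrite -[LHS]card_ord -(cardC [pred i | d i == mu]) mul2n -addnn {2}ss.
exists s => //.
have cA' : cx (char_poly A) = ('X - mu%:P) ^+ s * ('X - ((mu^*)%C)%:P) ^+ s.
  rewrite cx_char_poly cA (bigID [pred i | d i == mu]) /=; congr (_ * _).
    by rewrite (eq_bigr (fun=> 'X - mu%:P)) ?prodr_const // => i /eqP ->.
  by rewrite (eq_bigr (fun=> 'X - ((mu^*)%C)%:P)) ?prodr_const ?ss // => i /dE ->.
split.
- move=> g; rewrite -(dvdp_map (real_complex R)) -/cx -[map_poly _ _]/(cx _) -[in RHS]/(cx g) cA'.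
  rewrite Gauss_dvdp; last first.
    rewrite coprimep_expl // coprimep_expr // coprimep_XsubC root_XsubC.
    exact: neq.
  case h : (_ %| _) => //=; symmetry.
  have cj : map_poly (@conjc R) (cx g) = cx g.
    by rewrite /cx -map_poly_comp; apply: eq_map_poly => a /=; rewrite oppr0.
  rewrite -cj.
  have -> : ('X - ((mu^*)%C)%:P) ^+ s = map_poly (@conjc R) (('X - mu%:P) ^+ s).
    by rewrite rmorphXn /= rmorphB /= map_polyX map_polyC.
  by rewrite dvdp_map.
- by move=> z; rewrite cx_char_poly => /(root_spectrum _ cA) [i ->].
- have tE k (t : R) : t%:C%C = \sum_i d i ^+ k -> t = n%:R * Re (mu ^+ k).
    move=> /(congr1 (@complex.Re R)); rewrite Re_sum (sE (fun z => Re (z ^+ k))) -rmorphXn /= cRe_conj.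
    by rewrite -ss -mulrDl -natrD addnn -mul2n -ns.
  by split; [rewrite -[mu]expr1|idtac..]; apply: tE.
Qed.

(** The variance of the eigenvalues is nonnegative. The failure of this inequality is an open
    condition that detects a nonreal eigenvalue. *)
Lemma real_trace_sqr n (A : 'M[R]_n) (d : 'I_n -> C) :
  (\tr A)%:C%C = \sum_i d i -> (\tr (A *m A))%:C%C = \sum_i d i ^+ 2 ->
  (forall i, Im (d i) = 0) -> (\tr A) ^+ 2 <= n%:R * \tr (A *m A).
Proof.
move=> /(congr1 (@complex.Re R)); rewrite Re_sum ReC => t1.
move=> /(congr1 (@complex.Re R)); rewrite Re_sum ReC => t2 d0.
case: n A d t1 t2 d0 => [|n] A d t1 t2 d0.
  by rewrite t1 big_ord0 expr0n mul0r.
have t2' : \tr (A *m A) = \sum_i Re (d i) ^+ 2.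
  by rewrite t2; apply: eq_bigr => i _; rewrite expr2 cReM d0 mul0r subr0 expr2.
pose m := \tr A / n.+1%:R.
have n0 : (0 : R) < n.+1%:R by rewrite ltr0n.
have : 0 <= \sum_i (Re (d i) - m) ^+ 2 by apply: sumr_ge0 => i _; apply: sqr_ge0.
have -> : \sum_i (Re (d i) - m) ^+ 2 = \tr (A *m A) - 2 * m * \tr A + n.+1%:R * m ^+ 2.
  have -> : n.+1%:R * m ^+ 2 = \sum_(i < n.+1) m ^+ 2 by rewrite sumr_const card_ord mulr_natl.
  rewrite t2' t1 mulr_sumr -sumrB -big_split /=.
  by apply: eq_bigr => i _; ring.
have -> : \tr (A *m A) - 2 * m * \tr A + n.+1%:R * m ^+ 2 = (n.+1%:R * \tr (A *m A) - (\tr A) ^+ 2) / n.+1%:R.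
  by rewrite /m; field; rewrite gt_eqF.
by rewrite pmulr_lge0 ?invr_gt0 // subr_ge0.
Qed.

(** For eigenvalues a + ib and a - ib of equal multiplicity, tr A^2 / n = a^2 - b^2, which yields
    b^2; the sign of b0 selects one of the two conjugates consistently. *)
Definition conj_mu n (b0 : R) (A : 'M[R]_n) : C :=
  let a := \tr A / n%:R in
  (a +i* (Num.sg b0 * Num.sqrt (a ^+ 2 - \tr (A *m A) / n%:R)))%C.

Lemma spectral_conj n (A : 'M[R]_n.+1) sigma b0 : segre A sigma -> (size sigma <= 2)%N ->
  n.+1%:R * \tr (A *m A) < (\tr A) ^+ 2 -> b0 != 0 ->
  exists2 s : nat, n.+1 = (2 * s)%N & spectral s A (conj_mu b0 A).
Proof.
move=> sg s2 tA b00; have [d [l [ls dl cA [t1 t2 t3]]]] := segre_spectrum sg.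
have [i0 di0] : exists i, Im (d i) != 0.
  apply: contrapT => h; have := real_trace_sqr t1 t2; rewrite leNgt tA => H.
  by have // : false by apply: H => i; apply/eqP/negPn/negP => hi; apply: h; exists i.
have [mu [m0 mr]] : exists mu : C, Im mu * b0 > 0 /\ root (cx (char_poly A)) mu.
  have r0 : root (cx (char_poly A)) (d i0).
    by rewrite cx_char_poly; apply/(root_spectrum _ cA); exists i0.
  have : Im (d i0) * b0 != 0 by rewrite mulf_neq0.
  rewrite neq_lt => /orP[h|h]; last by exists (d i0).
  by exists ((d i0)^*)%C; rewrite cx_conj cIm_conj mulNr oppr_gt0.
have mu0 : Im mu != 0 by apply: contraTneq m0 => ->; rewrite mul0r ltxx.
have dmu i : d i = mu \/ d i = (mu^*)%C.
  have mem z : root (cx (char_poly A)) z -> z \in l.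
    by rewrite cx_char_poly => /(root_spectrum _ cA) [j ->].
  have l1 := mem _ mr; have l2 : (mu^*)%C \in l by apply: mem; rewrite cx_conj.
  have neq : (mu^*)%C != mu.
    by apply/eqP => /(congr1 (@complex.Im R)); rewrite cIm_conj => h; move/negP: mu0; apply; apply/eqP; lra.
  have sub : {subset [:: mu; (mu^*)%C] <= l} by move=> z; rewrite !inE => /orP[] /eqP ->.
  have [||_ e] := uniq_min_size _ sub.
  - by rewrite /= inE eq_sym neq.
  - exact: leq_trans ls s2.
  by have := dl i; rewrite -e !inE => /orP[] /eqP ->; [left|right].
have [s ns sp] := conj_spectrum mu0 cA dmu t1 t2 t3; exists s => //.
suff -> : conj_mu b0 A = mu by [].
case: sp => _ _ [e1 e2 _]; have n0 : n.+1%:R != 0 :> R by rewrite pnatr_eq0.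
rewrite /conj_mu e1 e2 ![_ * _ / _]mulrAC mulfV // !mul1r; apply: ReIm_eq => //=.
rewrite expr2 cReM opprB addrC subrK -expr2 sqrtr_sqr.
have [b|b] := ltrP 0 b0.
  by rewrite gtr0_sg // mul1r gtr0_norm // -(pmulr_lgt0 _ b).
have {}b : b0 < 0 by rewrite lt_neqAle b00.
by rewrite ltr0_sg // mulN1r ltr0_norm ?opprK // -(nmulr_lgt0 _ b).
Qed.

Lemma conj_trace_sqr n (A : 'M[R]_n.+1) sigma a0 b0 : segre A sigma -> b0 != 0 ->
  eigenvalues_are [:: (a0 +i* b0)%C; (a0 -i* b0)%C] A ->
  n.+1%:R * \tr (A *m A) < (\tr A) ^+ 2 /\ conj_mu b0 A = (a0 +i* b0)%C.
Proof.
move=> sg b00 ea; have [d [l [ls dl cA [t1 t2 t3]]]] := segre_spectrum sg.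
have dmu i : d i = (a0 +i* b0)%C \/ d i = ((a0 +i* b0)^*)%C.
  have : eigenvalue (complexify A) (d i).
    by rewrite eigenvalue_root_char; apply/(root_spectrum _ cA); exists i.
  by rewrite ea !inE => /orP[] /eqP ->; [left|right].
have [s ns sp] := conj_spectrum (mu := (a0 +i* b0)%C) b00 cA dmu t1 t2 t3.
have n0 : (0 : R) < n.+1%:R by rewrite ltr0n.
case: (sp) => _ _ [e1 e2 _].
rewrite /conj_mu e1 e2 ![_ * _ / _]mulrAC mulfV ?gt_eqF // !mul1r expr2 cReM /=; split.
  rewrite [X in _ < X](_ : _ = n.+1%:R * (n.+1%:R * (a0 * a0 - b0 * b0)) + (n.+1%:R * b0) ^+ 2); last by ring.
  by rewrite ltrDl exprn_even_gt0 //= mulf_neq0 // gt_eqF.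
by rewrite -expr2 opprB addrC subrK -expr2 sqrtr_sqr -numEsg.
Qed.

End Spectral.

(** * The fields X_g = g(L) e *)

Section MatrixDerivative.
Variables (R : realType) (n : nat).
Notation V := 'cV[R]_n.

(** Linear in v by construction, unlike the relation [mder]; [mder_cls] identifies the two on
    functions of the category. *)
Definition dmx p q (A : V -> 'M[R]_(p, q)) (x v : V) : 'M[R]_(p, q) :=
  \matrix_(i, j) \sum_k v k 0 * pd k (fun y => A y i j) x.

Definition mder p q (x v : V) (A : V -> 'M[R]_(p, q)) (D : 'M[R]_(p, q)) : Prop :=
  forall i j, is_derive x v (fun y => A y i j : R) (D i j).

Definition mcls cat (U : set V) p q (A : V -> 'M[R]_(p, q)) : Prop :=
  forall i j, cls cat U (fun y => A y i j : R).

Lemma dmxD p q (A : V -> 'M[R]_(p, q)) x v w : dmx A x (v + w) = dmx A x v + dmx A x w.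
Proof.
apply/matrixP => i j; rewrite !mxE -big_split; apply: eq_bigr => k _.
by rewrite /= !mxE mulrDl.
Qed.

Lemma dmxZ p q (A : V -> 'M[R]_(p, q)) x a v : dmx A x (a *: v) = a *: dmx A x v.
Proof.
by apply/matrixP => i j; rewrite !mxE mulr_sumr; apply: eq_bigr => k _; rewrite !mxE mulrA.
Qed.

Lemma dmx0 p q (A : V -> 'M[R]_(p, q)) x : dmx A x 0 = 0.
Proof. by rewrite -(scale0r (0 : V)) dmxZ scale0r. Qed.

Lemma dmx_jac p (F : V -> 'cV[R]_p) x v : dmx F x v = jac F x *m v.
Proof.
apply/matrixP => i j; rewrite !mxE; apply: eq_bigr => k _.
by rewrite mxE mulrC !(ord1 j).
Qed.

Lemma mder_uniq p q x v (A : V -> 'M[R]_(p, q)) D D' :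
  mder x v A D -> mder x v A D' -> D = D'.
Proof.
by move=> h h'; apply/matrixP => i j; apply: is_derive_uniq (h i j) (h' i j).
Qed.

Lemma mder_mul p q r x v (A : V -> 'M[R]_(p, q)) (B : V -> 'M[R]_(q, r)) DA DB :
  mder x v A DA -> mder x v B DB ->
  mder x v (fun y => A y *m B y) (DA *m B x + A x *m DB).
Proof.
move=> dA dB i j; rewrite !mxE -big_split /=.
have -> : (fun y => (A y *m B y) i j) = (fun y => \sum_k A y i k * B y k j).
  by apply/funext => y; rewrite mxE.
by apply: ider_sum => k _; apply: iderM.
Qed.

Lemma mder_add p q x v (A B : V -> 'M[R]_(p, q)) DA DB :
  mder x v A DA -> mder x v B DB -> mder x v (fun y => A y + B y) (DA + DB).
Proof.
move=> dA dB i j; rewrite mxE.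
by under eq_fun do rewrite mxE; exact: iderD (dA i j) (dB i j).
Qed.

Lemma mder_scale p q x v (c : R) (A : V -> 'M[R]_(p, q)) DA :
  mder x v A DA -> mder x v (fun y => c *: A y) (c *: DA).
Proof.
move=> dA i j; rewrite mxE; under eq_fun do rewrite mxE.
rewrite -[c * DA i j]add0r -[0](mul0r (A x i j)).
exact: (iderM (iderc c x v) (dA i j)).
Qed.

Lemma mder_trace p x v (A : V -> 'M[R]_p) DA :
  mder x v A DA -> is_derive x v (fun y => \tr (A y) : R) (\tr DA).
Proof. by move=> dA; apply: ider_sum => i _; exact: dA. Qed.

Variables (cat : category) (U : set V) (oU : open U).

Lemma mder_cls p q (A : V -> 'M[R]_(p, q)) x v : mcls cat U A -> U x ->
  mder x v A (dmx A x v).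
Proof. by move=> cA Ux i j; rewrite mxE; apply: cls_ider (cA i j) Ux. Qed.

Lemma mcls_mul p q r (A : V -> 'M[R]_(p, q)) (B : V -> 'M[R]_(q, r)) :
  mcls cat U A -> mcls cat U B -> mcls cat U (fun y => A y *m B y).
Proof. by move=> cA cB i j; apply: cls_mulmx. Qed.

Lemma mcls_add p q (A B : V -> 'M[R]_(p, q)) :
  mcls cat U A -> mcls cat U B -> mcls cat U (fun y => A y + B y).
Proof. by move=> cA cB i j; under eq_fun do rewrite mxE; apply: cls_add. Qed.

Lemma mcls_scale p q (c : R) (A : V -> 'M[R]_(p, q)) :
  mcls cat U A -> mcls cat U (fun y => c *: A y).
Proof.
move=> cA i j; under eq_fun do rewrite mxE.
by apply: cls_mul => //; exact: cls_cst.
Qed.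

Lemma dmx_mul p q r (A : V -> 'M[R]_(p, q)) (B : V -> 'M[R]_(q, r)) x v :
  mcls cat U A -> mcls cat U B -> U x ->
  dmx (fun y => A y *m B y) x v = dmx A x v *m B x + A x *m dmx B x v.
Proof.
move=> cA cB Ux; apply: (@mder_uniq _ _ x v (fun y => A y *m B y)).
  by apply: mder_cls => //; exact: mcls_mul.
by apply: mder_mul; apply: mder_cls.
Qed.

End MatrixDerivative.

Section Frame.
Variables (R : realType) (cat : category) (n : nat).
Notation V := 'cV[R]_n.+1.
Variables (U : set V) (oU : open U) (L : V -> 'M[R]_n.+1) (E : V -> V).
Hypotheses (cL : mcls cat U L) (cE : mcls cat U E).

(* The first identity is the vanishing of the Nijenhuis torsion of L on the
   constant fields v, w; the second one is the equation Lie_E L = Id. *)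
Hypothesis torsion0 : forall x v w, U x ->
  dmx L x (L x *m v) *m w - L x *m (dmx L x v *m w) =
  dmx L x (L x *m w) *m v - L x *m (dmx L x w *m v).
Hypothesis unity1 : forall x v, U x ->
  dmx L x (E x) *m v + L x *m dmx E x v - dmx E x (L x *m v) = v.

Definition Xf (g : {poly R}) (x : V) : V := horner_mx (L x) g *m E x.

Lemma Xf0 x : Xf 0 x = 0.
Proof. by rewrite /Xf rmorph0 mul0mx. Qed.

Lemma XfD f g x : Xf (f + g) x = Xf f x + Xf g x.
Proof. by rewrite /Xf rmorphD mulmxDl. Qed.

Lemma XfZ a f x : Xf (a *: f) x = a *: Xf f x.
Proof. by rewrite /Xf linearZ /= scalemxAl. Qed.

Lemma Xf1 x : Xf 1 x = E x.
Proof. by rewrite /Xf rmorph1 mul1mx. Qed.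

Lemma XfMX g x : Xf (g * 'X) x = L x *m Xf g x.
Proof. by rewrite /Xf mulrC rmorphM /= horner_mx_X mulmxA. Qed.

Lemma Xf_cons g c x : Xf (g * 'X + c%:P) x = L x *m Xf g x + c *: E x.
Proof. by rewrite XfD XfMX -[c%:P]mulr1 mul_polyC XfZ Xf1. Qed.

Lemma horner_mxMX g x : horner_mx (L x) (g * 'X) = L x *m horner_mx (L x) g.
Proof. by rewrite mulrC rmorphM /= horner_mx_X. Qed.

Lemma Xf_cls g : mcls cat U (Xf g).
Proof.
elim/poly_ind: g => [|g c IH].
  move=> i j; have -> : (fun y => Xf 0 y i j) = (fun=> 0).
    by apply/funext => y; rewrite /Xf rmorph0 mul0mx mxE.
  exact: cls_cst.
have -> : Xf (g * 'X + c%:P) = (fun x => L x *m Xf g x + c *: E x).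
  by apply/funext => x; exact: Xf_cons.
by apply: mcls_add => //; [apply: mcls_mul|apply: mcls_scale].
Qed.

Lemma dXf_cons g c x v : U x ->
  dmx (Xf (g * 'X + c%:P)) x v =
    dmx L x v *m Xf g x + L x *m dmx (Xf g) x v + c *: dmx E x v.
Proof.
move=> Ux; have -> : Xf (g * 'X + c%:P) = (fun x => L x *m Xf g x + c *: E x).
  by apply/funext => y; exact: Xf_cons.
apply: (@mder_uniq _ _ _ _ x v (fun x => L x *m Xf g x + c *: E x)).
  apply: (@mder_cls _ _ cat U) => //.
  by apply: mcls_add => //; [apply: mcls_mul => //; exact: Xf_cls|apply: mcls_scale].
apply: mder_add; last by apply: mder_scale; exact: (@mder_cls _ _ cat U).
by apply: mder_mul; apply: (@mder_cls _ _ cat U) => //; exact: Xf_cls.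
Qed.

Lemma dXf0 x v : dmx (Xf 0) x v = 0.
Proof.
have -> : Xf 0 = fun=> 0 by apply/funext => y; rewrite /Xf rmorph0 mul0mx.
apply/matrixP => i j; rewrite !mxE big1 // => k _.
rewrite (_ : pd _ _ _ = 0) ?mulr0 //.
exact: derive_cst.
Qed.

(** The left side is (Lie_{X_g} L) v. Vanishing torsion means Lie_{L X} L = L Lie_X L for every
    field X; the induction follows X_{g X + c} = L X_g + c e, the unity handling the constant. *)
Lemma lie_Xf g x v : U x ->
  dmx L x (Xf g x) *m v - dmx (Xf g) x (L x *m v) + L x *m dmx (Xf g) x v =
  horner_mx (L x) g *m v.
Proof.
move=> Ux; elim/poly_ind: g v => [|g c IH] v.
  by rewrite !dXf0 Xf0 dmx0 rmorph0 !mul0mx mulmx0 subrr addr0.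
rewrite !dXf_cons // Xf_cons dmxD dmxZ rmorphD /= horner_mxMX horner_mx_C.
have t := torsion0 (Xf g x) v Ux; have u := unity1 v Ux.
have {}IH := congr1 (fun w => L x *m w) (IH v).
move: IH t u; rewrite !mulmxDl !mulmxDr mulmxN -!mulmxA mul_scalar_mx -!scalemxAl -!scalemxAr.
set a := L x *m (dmx L x (Xf g x) *m v); set b := L x *m dmx (Xf g) x (L x *m v).
set d := L x *m (L x *m _); set a' := dmx L x (L x *m Xf g x) *m v.
set h := L x *m (horner_mx _ _ *m v).
move=> IH t u; rewrite -{}IH -[X in _ = _ + c *: X]u.
set t1 := dmx L x (L x *m v) *m _ in t *; set t2 := L x *m (dmx L x v *m _) in t *.
have {}t : a' = a + t1 - t2 by rewrite -addrA -t addrC subrK.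
rewrite {}t; apply/matrixP => i j; rewrite !mxE; ring.
Qed.

(** The bracket [X_f, e]; it supplies the constant terms in the induction for [X_f, X_g]. *)
Lemma unity_Xf f x : U x -> dmx E x (Xf f x) - dmx (Xf f) x (E x) = - Xf f^`() x.
Proof.
move=> Ux; elim/poly_ind: f => [|f c IH].
  by rewrite dXf0 derivC Xf0 dmx0 subrr oppr0.
rewrite dXf_cons // Xf_cons dmxD dmxZ derivD derivC addr0 derivM derivX mulr1 XfD XfMX.
have u := unity1 (Xf f x) Ux.
have {}IH := congr1 (fun w => L x *m w) IH; move: IH u.
rewrite mulmxDr !mulmxN => IH u.
set a := dmx E x (L x *m _) in u *; set b := dmx L x _ *m _ in u *.
have {}u : a = b + L x *m dmx E x (Xf f x) - Xf f x by rewrite -[X in _ - X]u; apply/matrixP => i j; rewrite !mxE; ring.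
have {}IH : L x *m Xf f^`() x = L x *m dmx (Xf f) x (E x) - L x *m dmx E x (Xf f x).
  by rewrite -[LHS]opprK -IH opprB.
by rewrite u IH; apply/matrixP => i j; rewrite !mxE; ring.
Qed.

(** Induction on g by the product rule [X_f, L X_g] = (Lie_{X_f} L) X_g + L [X_f, X_g], where
    Lie_{X_f} L = f(L). *)
Lemma bracket_Xf f g x : U x ->
  dmx (Xf g) x (Xf f x) - dmx (Xf f) x (Xf g x) = Xf (f * g^`() - f^`() * g) x.
Proof.
move=> Ux; elim/poly_ind: g => [|g c IH].
  by rewrite dXf0 derivC !mulr0 subrr Xf0 dmx0 subrr.
rewrite dXf_cons // Xf_cons dmxD dmxZ.
have -> : f * (g * 'X + c%:P)^`() - f^`() * (g * 'X + c%:P) =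
    (f * g^`() - f^`() * g) * 'X + f * g - c *: f^`().
  by rewrite derivD derivC addr0 derivM derivX mulr1 -mul_polyC; ring.
have h := lie_Xf f (Xf g x) Ux; have u := unity_Xf f Ux.
have {}IH := congr1 (fun w => L x *m w) IH; move: IH.
set B := f * g^`() - _; rewrite -scaleNr (XfD (B * 'X + f * g)) (XfD (B * 'X)) XfMX XfZ => <-.
rewrite mulmxBr.
have -> : Xf (f * g) x = horner_mx (L x) f *m Xf g x.
  by rewrite /Xf rmorphM /= mulmxA.
rewrite -h -[Xf f^`() x]opprK -u.
set a1 := dmx L x (Xf f x) *m Xf g x; set a2 := L x *m dmx (Xf g) x (Xf f x).
set a3 := dmx (Xf f) x (L x *m Xf g x); set a4 := L x *m dmx (Xf f) x (Xf g x).
set a5 := dmx E x (Xf f x); set a6 := dmx (Xf f) x (E x); clearbody a1 a2 a3 a4 a5 a6.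
by apply/matrixP => i j; rewrite !mxE; ring.
Qed.

End Frame.

(** * Derivatives of traces of powers *)

Section Traces.
Variables (R : realType) (cat : category) (n : nat).
Notation V := 'cV[R]_n.+1.
Variables (U : set V) (oU : open U) (L : V -> 'M[R]_n.+1) (E : V -> V).
Hypotheses (cL : mcls cat U L) (cE : mcls cat U E).
Hypothesis torsion0 : forall x v w, U x ->
  dmx L x (L x *m v) *m w - L x *m (dmx L x v *m w) =
  dmx L x (L x *m w) *m v - L x *m (dmx L x w *m v).
Hypothesis unity1 : forall x v, U x ->
  dmx L x (E x) *m v + L x *m dmx E x v - dmx E x (L x *m v) = v.

(** The derivative of tr L^(k+1) / (k+1) along v. *)
Definition dtr (k : nat) (x v : V) : R := \tr (L x ^+ k *m dmx L x v).

(** With M w = dL(w) v, the torsion identity says dL(L v) - L dL(v) = M L - L M, and a commutator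
    with L has trace zero against L^k. *)
Lemma dtr_torsion k x v : U x -> dtr k x (L x *m v) = dtr k.+1 x v.
Proof.
move=> Ux; pose M : 'M[R]_n.+1 := \matrix_(i, j) (dmx L x (delta_mx j 0) *m v) i 0.
have ME w : M *m w = dmx L x w *m v.
  rewrite [in RHS](_ : w = \sum_j w j 0 *: delta_mx j 0); last first.
    by rewrite [LHS]matrix_sum_delta; apply: eq_bigr => j _; rewrite big_ord1.
  have dS (r : seq 'I_n.+1) : dmx L x (\sum_(j <- r) w j 0 *: delta_mx j 0) =
      \sum_(j <- r) w j 0 *: dmx L x (delta_mx j 0).
    elim: r => [|j r IH]; first by rewrite !big_nil dmx0.
    by rewrite !big_cons dmxD dmxZ IH.
  rewrite dS mulmx_suml; apply/matrixP => i j; rewrite !(ord1 j) mxE summxE.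
  by apply: eq_bigr => l _; rewrite -scalemxAl [RHS]mxE [in LHS]mxE mulrC.
have key : dmx L x (L x *m v) - L x *m dmx L x v = M *m L x - L x *m M.
  apply/matrixP => i j.
  have := congr1 (fun w : V => w i 0) (torsion0 v (delta_mx j 0) Ux).
  rewrite -!ME !mulmxA -!mulmxBl.
  have colE (A : 'M[R]_n.+1) : (A *m delta_mx j 0 : V) i 0 = A i j.
    by rewrite -colE mxE.
  by rewrite !colE.
have : \tr (L x ^+ k *m (M *m L x - L x *m M)) = 0.
  rewrite mulmxBr raddfB /= [X in X - _]mxtrace_mulC mulmxA [X in _ - X]mxtrace_mulC -mulmxA.
  rewrite (_ : L x ^+ k *m L x = L x *m L x ^+ k) ?subrr //.
  by rewrite !mulmxE -exprSr -exprS.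
rewrite -key mulmxBr raddfB /= => /eqP; rewrite subr_eq0 => /eqP.
by rewrite /dtr => ->; rewrite mulmxA exprSr.
Qed.

(** The unity equation is dL(E) = Id plus the commutator of the Jacobian of E with L, invisible to
    the trace against L^k. *)
Lemma dtr_unity k x : U x -> dtr k x (E x) = \tr (L x ^+ k).
Proof.
move=> Ux.
have key : dmx L x (E x) = 1%:M + jac E x *m L x - L x *m jac E x.
  apply/matrixP => i j.
  have := congr1 (fun w : V => w i 0) (unity1 (delta_mx j 0) Ux).
  rewrite !dmx_jac !mulmxA.
  have colE (A : 'M[R]_n.+1) : (A *m delta_mx j 0 : V) i 0 = A i j.
    by rewrite -colE mxE.
  move: (L x *m jac E x) (jac E x *m L x) (dmx L x (E x)) => A B D.
  by rewrite -mulmxDl -mulmxBl colE !mxE eqxx andbT => h; lra.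
rewrite /dtr key mulmxBr mulmxDr mulmx1 raddfB /= mxtraceD.
have -> : \tr (L x ^+ k *m (jac E x *m L x)) = \tr (L x ^+ k *m (L x *m jac E x)).
  rewrite mulmxA mxtrace_mulC !mulmxA (_ : L x *m L x ^+ k = L x ^+ k *m L x) //.
  by rewrite !mulmxE -exprSr -exprS.
by rewrite addrK.
Qed.

Lemma ider_trace x v : U x -> [/\ is_derive x v (fun y => \tr (L y) : R) (dtr 0 x v),
  is_derive x v (fun y => \tr (L y *m L y) : R) (2 * dtr 1 x v) &
  is_derive x v (fun y => \tr (L y *m (L y *m L y)) : R) (3 * dtr 2 x v)].
Proof.
move=> Ux; have dL : mder x v L (dmx L x v) by apply: (@mder_cls _ _ cat U).
have dL2 := mder_mul dL dL; have dL3 := mder_mul dL dL2.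
split.
- by have := mder_trace dL; rewrite /dtr expr0 mul1mx.
- have := mder_trace dL2; rewrite mxtraceD [X in X + _]mxtrace_mulC -mulr2n -[_ *+ 2]mulr_natl.
  by rewrite /dtr expr1.
- have := mder_trace dL3; rewrite mulmxDr !mxtraceD [X in X + _]mxtrace_mulC.
  rewrite [X in _ + (X + _)]mxtrace_mulC -(mulmxA (dmx L x v)).
  rewrite [X in _ + (X + _)]mxtrace_mulC [L x *m (L x *m _)]mulmxA.
  set t := \tr _; rewrite (_ : t + (t + t) = 3 * t); last by ring.
  by rewrite /t /dtr expr2.
Qed.

End Traces.

(** * Charts *)

Section VectorDerivative.
Variables (R : realType) (n : nat).
Notation V := 'cV[R]_n.

Lemma mder_derive m (F : V -> 'cV[R]_m) x v D : mder x v F D -> 'D_v F x = D.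
Proof.
move=> dF; apply: cvg_lim; first exact: norm_hausdorff.
have FF : Filter ((0 : R)^') by typeclasses eauto.
apply: (@cvg_coordP _ _ _ _ FF) => i.
have [h1 h2] := dF i 0; move: h1; rewrite /derivable => /cvgP; rewrite -[X in _ --> X]/('D_v (fun y => F y i 0) x) h2.
apply: cvg_trans; apply: near_eq_cvg; near=> t; rewrite !mxE //.
Unshelve. all: by end_near.
Qed.

Variable cat : category.

Lemma dmx_comp m p q (W : set V) (U : set 'cV[R]_m) (G : V -> 'cV[R]_m)
    (F : 'cV[R]_m -> 'M[R]_(p, q)) x v : open W -> open U -> W x ->
  (forall y, W y -> U (G y)) -> mcls cat W G -> mcls cat U F ->
  mder x v (F \o G) (dmx F (G x) (dmx G x v)).
Proof.
move=> oW oU Wx GU cG cF i j; rewrite mxE.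
apply: (@ider_comp _ _ _ W U G oU GU (fun y => F y i j)) => // [|k].
  exact: cls_Ck.
by apply: (mder_cls oW v cG Wx).
Qed.

Lemma mcls_comp m p q (W : set V) (U : set 'cV[R]_m) (G : V -> 'cV[R]_m)
    (F : 'cV[R]_m -> 'M[R]_(p, q)) : open W -> open U ->
  (forall y, W y -> U (G y)) -> mcls cat W G -> mcls cat U F -> mcls cat W (F \o G).
Proof.
move=> oW oU GU cG cF i j; apply: (@cls_comp _ cat _ _ W U G oW oU GU (fun y => F y i j)) => //.
Qed.

Lemma mcls_ext p q (W : set V) (F G : V -> 'M[R]_(p, q)) : open W ->
  (forall y, W y -> F y = G y) -> mcls cat W F -> mcls cat W G.
Proof. by move=> oW FG cF i j; apply: cls_ext (cF i j) => // y /FG ->. Qed.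

Lemma mcls_sub p q (U W : set V) (F : V -> 'M[R]_(p, q)) : open W -> W `<=` U ->
  mcls cat U F -> mcls cat W F.
Proof. by move=> oW WU cF i j; apply: cls_sub (cF i j). Qed.

Lemma mcls_continuous p (W : set V) (F : V -> 'cV[R]_p) x : mcls cat W F -> W x ->
  {for x, continuous F}.
Proof.
move=> cF Wx; apply: (@cvg_coordP _ _ _ _ (nbhs_filter x)) => i.
exact: (cls_cont (cF i 0) Wx).
Qed.

Lemma mx_class_onP p q (W : set V) (F : V -> 'M[R]_(p, q)) : open W ->
  mx_class_on cat W F <-> mcls cat W F.
Proof. by move=> oW; split=> h i j; apply/class_onP => //; apply: h. Qed.

Lemma mder_near p q (F G : V -> 'M[R]_(p, q)) x v D : (\forall y \near x, F y = G y) ->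
  mder x v F D -> mder x v G D.
Proof.
by move=> FG dF i j; apply: ider_near (dF i j); apply: filterS FG => y ->.
Qed.

End VectorDerivative.

Section ChartTheory.
Variables (R : realType) (cat : category) (n : nat) (M : manifold R cat n).
Notation V := 'cV[R]_n.
Implicit Types (c u : chart R n M) (q p : M) (W : set M).

Definition image c W : set V := coord c @` (dom c `&` W).

Lemma open_nbhs_mem (T : topologicalType) (A : set T) x : open A -> A x -> nbhs x A.
Proof. by move=> oA Ax; exact: open_nbhs_nbhs. Qed.

Lemma imageE c W : is_chart c ->
  image c W = [set x | (coord c @` dom c) x /\ W (param c x)].
Proof.
move=> [_ _ pK _ _]; apply/seteqP; split=> [_ [q [dq Wq] <-]|_ [[q dq <-]]] /=.
  by rewrite pK //; split => //; exists q.
by rewrite pK // => Wq; exists q.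
Qed.

Lemma open_image c W : is_chart c -> open W -> open (image c W).
Proof.
move=> hc oW; rewrite imageE //; case: hc => _ oI pK _ cp.
rewrite openE => x [Ix Wx]; rewrite /interior.
have h := cp x Ix _ (open_nbhs_mem oW Wx).
by apply: filterS2 (open_nbhs_mem oI Ix) h => y.
Qed.

Lemma transitionE c c' q : is_chart c -> dom c q -> transition c c' (coord c q) = coord c' q.
Proof. by move=> [_ _ pK _ _] dq; rewrite /transition /= pK. Qed.

Lemma open_dom c : is_chart c -> open (dom c).
Proof. by case. Qed.

Lemma compatibleP c c' : is_chart c -> is_chart c' ->
  compatible cat c c' <-> mcls cat (image c (dom c')) (transition c c') /\
                          mcls cat (image c' (dom c)) (transition c' c).
Proof.
move=> hc hc'; rewrite /compatible.
have -> : coord c' @` (dom c `&` dom c') = image c' (dom c) by rewrite /image setIC.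
by split=> -[h1 h2]; split; apply/mx_class_onP => //;
  apply: open_image => //; apply: open_dom.
Qed.

(** Charts are only known to be compatible with the atlas, so the transition is factored locally
    through a chart of the atlas. *)
Lemma transition_cls c c' : charts c -> charts c' ->
  mcls cat (image c (dom c')) (transition c c').
Proof.
move=> [hc cc] [hc' cc'] i j; apply: cls_loc; last first.
  by apply: open_image => //; apply: open_dom.
move=> _ [q [dq dq'] <-].
have [a aa da] := atlas_cover q; have ha := atlas_chart aa.
have [t1 _] := (compatibleP hc ha).1 (cc a aa).
have [_ t2] := (compatibleP hc' ha).1 (cc' a aa).
have oW := open_dom; pose W := dom c' `&` dom a.
have oWW : open W by apply: openI; apply: oW.
exists (image c W); first exact: open_image.
split; first by exists q.
apply: (@mcls_ext _ _ _ _ _ _ (transition a c' \o transition c a)).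
- exact: open_image.
- move=> _ [q' [d1 [d2 d3]] <-] /=.
  by rewrite !(transitionE _ _ d1) // (transitionE _ _ d3).
- apply: (@mcls_comp _ _ _ _ _ _ _ (image a (dom c'))) => //.
  + exact: open_image.
  + by apply: open_image => //; apply: oW.
  + by move=> _ [q' [d1 [d2 d3]] <-]; rewrite (transitionE _ _ d1) //; exists q'.
  + apply: mcls_sub t1; first exact: open_image.
    by move=> _ [q' [d1 [d2 d3]] <-]; exists q'.
Qed.

Lemma changeE c c' q v : charts c -> charts c' -> dom c q -> dom c' q ->
  change_of_components c c' q v = dmx (transition c c') (coord c q) v.
Proof.
move=> hc hc' dq dq'; apply: mder_derive; apply: (@mder_cls _ _ cat (image c (dom c'))).
- by apply: open_image; [case: hc|apply: open_dom; case: hc'].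
- exact: transition_cls.
- by exists q.
Qed.

Lemma transition_id c q v : charts c -> dom c q ->
  dmx (transition c c) (coord c q) v = v.
Proof.
move=> hc dq; apply: (@mder_uniq _ _ _ _ (coord c q) v (transition c c)).
  apply: (@mder_cls _ _ cat (image c (dom c))); last by exists q.
    by apply: open_image; [case: hc|apply: open_dom; case: hc].
  exact: transition_cls.
have hcc := hc.1; apply: (@mder_near _ _ _ _ id).
  have oI : open (image c setT) by apply: open_image => //; exact: openT.
  apply: filterS (open_nbhs_mem oI _); last by exists q.
  by move=> _ [q' [d1 _] <-]; rewrite (transitionE _ _ d1).
by move=> i j; rewrite !(ord1 j); exact: ider_coord.
Qed.

Lemma change_comp c c' c'' q v : charts c -> charts c' -> charts c'' ->
  dom c q -> dom c' q -> dom c'' q ->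
  dmx (transition c c'') (coord c q) v =
  dmx (transition c' c'') (coord c' q) (dmx (transition c c') (coord c q) v).
Proof.
move=> hc hc' hc'' dq dq' dq''; pose W := dom c' `&` dom c''.
have [h h' h''] : [/\ is_chart c, is_chart c' & is_chart c''] by case: hc; case: hc'; case: hc''.
have oWW : open W by apply: openI; apply: open_dom.
have oI : open (image c W) by exact: open_image.
have Ix : image c W (coord c q) by exists q.
apply: (@mder_uniq _ _ _ _ (coord c q) v (transition c c'')).
  apply: (@mder_cls _ _ cat (image c (dom c''))); last by exists q.
    by apply: open_image => //; apply: open_dom.
  exact: transition_cls.
rewrite -(transitionE c' h dq).
apply: (@mder_near _ _ _ _ (transition c' c'' \o transition c c')).
  apply: filterS (open_nbhs_mem oI Ix) => _ [q' [d1 [d2 d3]] <-] /=.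
  by rewrite !(transitionE _ _ d1) // (transitionE _ _ d2).
apply: (@dmx_comp _ _ cat _ _ _ (image c W) (image c' (dom c''))) => //.
- by apply: open_image => //; apply: open_dom.
- by move=> _ [q' [d1 [d2 d3]] <-]; rewrite (transitionE _ _ d1) //; exists q'.
- apply: mcls_sub (transition_cls hc hc') => //.
  by move=> _ [q' [d1 [d2 d3]] <-]; exists q'.
- exact: transition_cls.
Qed.

(** The field with constant components v in c, written in all charts; tested on such fields, the
    tensor identities become identities for matrices. *)
Definition const_field c (v : V) : vfamily M := fun c' q => change_of_components c c' q v.

Lemma const_field_vector_field c v : charts c -> vector_field (dom c) (const_field c v).
Proof.
move=> hc c' hc'; have [h h'] : is_chart c /\ is_chart c' by case: hc; case: hc'.
split; last first.
  move=> c'' hc'' q d' d'' d; rewrite /const_field !changeE //.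
  exact: change_comp.
have oI : open (image c' (dom c)) by apply: open_image => //; apply: open_dom.
apply/mx_class_onP => //.
apply: (@mcls_ext _ _ _ _ _ _ ((fun x => dmx (transition c c') x v) \o transition c' c)) => //.
  move=> _ [q [d1 d2] <-]; rewrite /const_field /=.
  by case: (h') => _ _ pK _ _; rewrite (transitionE _ _ d1) // pK // changeE.
apply: (@mcls_comp _ _ _ _ _ _ _ (image c (dom c'))) => //.
- by apply: open_image => //; apply: open_dom.
- by move=> _ [q' [d1 d2] <-]; rewrite (transitionE _ _ d1) //; exists q'.
- exact: transition_cls.
- have oI' : open (image c (dom c')) by apply: open_image => //; apply: open_dom.
  move=> i j; under eq_fun do rewrite mxE.
  apply: cls_sum => // k _; apply: cls_mul => //; first exact: cls_cst.
  by apply: cls_pd; apply: transition_cls.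
Qed.

Lemma const_fieldE c v q : charts c -> dom c q -> const_field c v c q = v.
Proof. by move=> hc dq; rewrite /const_field changeE // transition_id. Qed.

Section InChart.
Variables (c : chart R n M) (hc : charts c) (L : ofamily M) (e : vfamily M).
Hypothesis hLe : nijenhuis_with_unity L e.

Let Om : set V := coord c @` dom c.
Let Lc (x : V) := L c (param c x).
Let Ec (x : V) := e c (param c x).

Lemma Om_open : open Om.
Proof. by case: hc => -[]. Qed.

Lemma Om_param x : Om x -> dom c (param c x) /\ coord c (param c x) = x.
Proof. by case: hc => -[_ _ pK _ _] _ [q dq <-]; rewrite pK. Qed.

Lemma Lc_cls : mcls cat Om Lc.
Proof.
by case: hLe => -[hL _] _; apply/mx_class_onP; [exact: Om_open|apply: (hL c hc).1].
Qed.

Lemma Ec_cls : mcls cat Om Ec.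
Proof.
case: hLe => _ [he _]; have := (he c hc).1; rewrite setIT.
by move/mx_class_onP => h; apply: h; exact: Om_open.
Qed.

Lemma bracket_chart (X Y : vfamily M) (FX FY : V -> V) x : Om x ->
  mcls cat Om FX -> mcls cat Om FY ->
  (forall y, Om y -> X c (param c y) = FX y) -> (forall y, Om y -> Y c (param c y) = FY y) ->
  bracket X Y c (param c x) = dmx FY x (FX x) - dmx FX x (FY x).
Proof.
move=> Ox cX cY hX hY; have [_ cx] := Om_param Ox.
rewrite /bracket cx !hX // !hY //.
have D (Z : vfamily M) (FZ : V -> V) v : mcls cat Om FZ ->
    (forall y, Om y -> Z c (param c y) = FZ y) -> 'D_v (Z c \o param c) x = dmx FZ x v.
  move=> cZ hZ; apply: mder_derive; apply: (@mder_near _ _ _ _ FZ).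
    by apply: filterS (open_nbhs_mem Om_open Ox) => y /hZ <-.
  exact: (mder_cls Om_open).
by rewrite (D _ _ _ cX hX) (D _ _ _ cY hY).
Qed.

Let cst_cls (v : V) : mcls cat Om (fun=> v).
Proof. by move=> i j; apply: cls_cst; exact: Om_open. Qed.

Let Lv_cls (v : V) : mcls cat Om (fun x => Lc x *m v).
Proof. by apply: mcls_mul; [exact: Om_open|exact: Lc_cls|exact: cst_cls]. Qed.

Let dcst (v w : V) x : dmx (fun=> v : V) x w = 0.
Proof.
apply/matrixP => i j; rewrite !mxE big1 // => k _.
by rewrite (_ : pd _ _ _ = 0) ?mulr0 //; exact: derive_cst.
Qed.

Let dLv (v w : V) x : Om x -> dmx (fun x => Lc x *m v) x w = dmx Lc x w *m v.
Proof.
move=> Ox; rewrite (dmx_mul Om_open w Lc_cls (cst_cls v) Ox) dcst.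
by rewrite mulmx0 addr0.
Qed.

Lemma torsion_chart x v w : Om x ->
  dmx Lc x (Lc x *m v) *m w - Lc x *m (dmx Lc x v *m w) =
  dmx Lc x (Lc x *m w) *m v - Lc x *m (dmx Lc x w *m v).
Proof.
move=> Ox; have [dx cx] := Om_param Ox.
case: hLe => -[_ hN] _.
have := hN _ (open_dom hc.1) _ _ (const_field_vector_field v hc) (const_field_vector_field w hc)
  c (param c x) hc dx dx.
have cE a y : Om y -> const_field c a c (param c y) = a.
  by move=> /Om_param[dy _]; exact: const_fieldE.
have aE a y : Om y -> apply_field L (const_field c a) c (param c y) = Lc y *m a.
  by move=> Oy; rewrite /apply_field cE.
rewrite /nijenhuis_torsion -[LHS]/(bracket _ _ c (param c x)
  + L c (param c x) *m (L c (param c x) *m bracket _ _ c (param c x))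
  - L c (param c x) *m bracket _ _ c (param c x) - L c (param c x) *m bracket _ _ c (param c x)).
rewrite (bracket_chart Ox (Lv_cls v) (Lv_cls w) (aE v) (aE w)).
rewrite (bracket_chart Ox (cst_cls v) (cst_cls w) (cE v) (cE w)).
rewrite (bracket_chart Ox (Lv_cls v) (cst_cls w) (aE v) (cE w)).
rewrite (bracket_chart Ox (cst_cls v) (Lv_cls w) (cE v) (aE w)).
rewrite !dcst !dLv // -/(Lc x) subrr !mulmx0 addr0 sub0r subr0 mulmxN opprK => h.
apply/matrixP => i j; have := congr1 (fun A : V => A i j) h; rewrite !mxE => /eqP hij.
by apply/eqP; rewrite -subr_eq0 -[X in _ == X](eqP hij); apply/eqP; ring.
Qed.

Lemma unity_chart x v : Om x ->
  dmx Lc x (Ec x) *m v + Lc x *m dmx Ec x v - dmx Ec x (Lc x *m v) = v.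
Proof.
move=> Ox; have [dx cx] := Om_param Ox.
case: hLe => _ [_ hU].
have := hU _ (open_dom hc.1) _ (const_field_vector_field v hc) c (param c x) hc dx dx.
have cE a y : Om y -> const_field c a c (param c y) = a.
  by move=> /Om_param[dy _]; exact: const_fieldE.
have aE a y : Om y -> apply_field L (const_field c a) c (param c y) = Lc y *m a.
  by move=> Oy; rewrite /apply_field cE.
rewrite /lie_derivative -[LHS]/(bracket _ _ c (param c x) - L c (param c x) *m bracket _ _ c (param c x)).
rewrite cE // (@bracket_chart e _ Ec _ _ Ox Ec_cls (Lv_cls v) _ (aE v)) //.
rewrite (@bracket_chart e _ Ec _ _ Ox Ec_cls (cst_cls v) _ (cE v)) //.
rewrite !dcst !dLv // sub0r mulmxN opprK => h.
by rewrite -[RHS]h addrAC.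
Qed.

End InChart.

Section NewChart.
Variables (c : chart R n M) (hc : charts c) (W : set V) (phi psi : V -> V).
Hypotheses (oW : open W) (WO : W `<=` coord c @` dom c) (cphi : mcls cat W phi).
Hypotheses (oI : open (phi @` W)) (psiK : forall x, W x -> psi (phi x) = x).
Hypothesis cpsi : mcls cat (phi @` W) psi.

Definition new_chart : chart R n M :=
  Chart [set q | dom c q /\ W (coord c q)] (phi \o coord c) (param c \o psi).

Let u := new_chart.

Lemma image_new_chart : coord u @` dom u = phi @` W.
Proof.
have [_ _ pK _ _] := hc.1.
apply/seteqP; split=> [_ [q [dq Wq] <-]|_ [x Wx <-]]; first by exists (coord c q).
have [q dq qx] := WO Wx; exists q; first by split=> //; rewrite qx.
by rewrite /= qx.
Qed.

Lemma new_chart_is_chart : is_chart u.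
Proof.
have [oD oC pK cc cp] := hc.1; split.
- rewrite openE => q [dq Wq]; rewrite /interior.
  have h := cc q dq _ (open_nbhs_mem oW Wq).
  by apply: filterS2 (open_nbhs_mem oD dq) h => y.
- by rewrite image_new_chart.
- by move=> q [dq Wq] /=; rewrite psiK // pK.
- move=> q [dq Wq]; apply: (@continuous_comp _ _ _ (coord c) phi); first exact: cc.
  exact: (mcls_continuous cphi Wq).
- rewrite image_new_chart => _ [x Wx <-]; apply: (@continuous_comp _ _ _ psi (param c)).
    by apply: (mcls_continuous cpsi); exists x.
  by rewrite psiK //; apply: cp; exact: WO.
Qed.

Lemma new_chart_charts : charts u.
Proof.
have hu := new_chart_is_chart; split=> // a aa; have ha := atlas_chart aa.
have [_ _ pK _ _] := hc.1.
have [t1 t2] := (compatibleP hc.1 ha).1 (hc.2 a aa).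
apply/compatibleP => //; split.
- apply: (@mcls_ext _ _ _ _ _ _ (transition c a \o psi)).
  + by apply: open_image => //; apply: open_dom.
  + by move=> _ [q [[dq Wq] aq] <-].
  + apply: (@mcls_comp _ _ _ _ _ _ _ (image c (dom a))) => //.
    * by apply: open_image => //; apply: open_dom.
    * by apply: open_image; [case: hc|apply: open_dom].
    * by move=> _ [q [[dq Wq] aq] <-] /=; rewrite psiK //; exists q.
    * apply: mcls_sub cpsi; first by apply: open_image => //; apply: open_dom.
      by rewrite -image_new_chart => _ [q [dq aq] <-]; exists q.
- have oIa : open (image a (dom u)) by apply: open_image => //; exact: open_dom hu.
  apply: (@mcls_ext _ _ _ _ _ _ (phi \o transition a c)) => //.
  apply: (@mcls_comp _ _ _ _ _ _ _ W) => //.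
  + by move=> _ [q [aq [dq Wq]] <-]; rewrite (transitionE _ _ aq).
  + by apply: mcls_sub t2 => // _ [q [aq [dq Wq]] <-]; exists q.
Qed.

Lemma new_chart_change q v : dom u q ->
  change_of_components c u q v = dmx phi (coord c q) v.
Proof.
have [_ _ pK _ _] := hc.1.
move=> [dq Wq]; apply: mder_derive; apply: (@mder_near _ _ _ _ phi).
  apply: filterS (open_nbhs_mem oW Wq) => x Wx.
  by have [q' dq' <-] := WO Wx; rewrite /transition /= pK.
exact: (mder_cls oW v cphi).
Qed.

End NewChart.
End ChartTheory.

(** * Composition of polynomials modulo powers of t *)

Section PolyComp.
Variable F : fieldType.
Implicit Types h P Q D : {poly F}.

Lemma comp_taylor h Q D : exists K, h \Po (Q + D) = h \Po Q + (h^`() \Po Q) * D + D ^+ 2 * K.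
Proof.
elim/poly_ind: h => [|h c [K IH]]; first by exists 0; rewrite derivC !comp_poly0; ring.
exists (K * (Q + D) + (h^`() \Po Q)).
rewrite !comp_poly_MXaddC IH derivD derivC addr0 derivM derivX mulr1 comp_polyD comp_polyM comp_polyX.
by ring.
Qed.

Lemma comp_coef0 h Q : (h \Po Q)`_0 = h.[Q`_0].
Proof. by rewrite -!horner_coef0 horner_comp. Qed.

Lemma agree_decomp P Q j : (forall i, (i < j)%N -> P`_i = Q`_i) ->
  exists2 D, P = Q + D * 'X^j & D`_0 = P`_j - Q`_j.
Proof.
move=> PQ; exists (drop_poly j (P - Q)); last by rewrite coef_drop_poly add0n coefB.
have t0 : take_poly j (P - Q) = 0; last first.
  by have := poly_take_drop j (P - Q); rewrite t0 add0r => ->; rewrite addrC subrK.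
apply/polyP => i; rewrite coef_take_poly coef0; case: ltnP => // ij.
by rewrite coefB PQ ?subrr.
Qed.

(** The reason why the equations for the coefficients of U are linear one at a time: changing the
    coefficient of t^j changes that of h(P) in proportion to h' at the constant term. *)
Lemma comp_agree h P Q j : (0 < j)%N -> (forall i, (i < j)%N -> P`_i = Q`_i) ->
  (forall i, (i < j)%N -> (h \Po P)`_i = (h \Po Q)`_i) /\
  (h \Po P)`_j - (h \Po Q)`_j = h^`().[Q`_0] * (P`_j - Q`_j).
Proof.
move=> j0 PQ; have [D -> D0] := agree_decomp PQ.
have [K ->] := comp_taylor h Q (D * 'X^j).
have -> : h \Po Q + (h^`() \Po Q) * (D * 'X^j) + (D * 'X^j) ^+ 2 * K =
    h \Po Q + ((h^`() \Po Q) * D + D ^+ 2 * 'X^j * K) * 'X^j by ring.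
split=> [i ij|]; first by rewrite coefD coefMXn ij addr0.
rewrite !coefD !coefMXn ltnn subnn [Q`_j + _]addrC addrK [_`_j + _]addrC addrK coefD.
by rewrite (_ : D ^+ 2 * 'X^j * K = D ^+ 2 * K * 'X^j) ?coefMXn ?j0 ?addr0 ?coef0M ?comp_coef0 //; ring.
Qed.

Lemma comp_kill h Q mu s : ('X - mu%:P) ^+ s %| h -> Q`_0 = mu ->
  forall i, (i < s)%N -> (h \Po Q)`_i = 0.
Proof.
move=> /dvdpP [q ->] Q0 i si; rewrite comp_polyM rmorphXn /= comp_polyB comp_polyX comp_polyC.
have [|D -> _] := @agree_decomp Q mu%:P 1; first by case=> // _; rewrite coefC.
by rewrite [mu%:P + _]addrC addrK exprMn mulrA -exprM mul1n coefMXn si.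
Qed.

(** Substitution of X - mu for X undoes the translation. This is the source of the invertibility of
    the Jacobian of the normal coordinates. *)
Lemma comp_kill_conv h mu s : (forall i, (i < s)%N -> (h \Po (mu%:P + 'X))`_i = 0) ->
  ('X - mu%:P) ^+ s %| h.
Proof.
move=> hs; have [D hD _] := @agree_decomp (h \Po (mu%:P + 'X)) 0 s (fun i si => etrans (hs i si) (esym (coef0 _ i))).
rewrite add0r in hD.
have -> : h = (h \Po (mu%:P + 'X)) \Po ('X - mu%:P).
  by rewrite -comp_polyA comp_polyD comp_polyC comp_polyX addrC subrK comp_polyXr.
by rewrite hD comp_polyM rmorphXn /= comp_polyX dvdp_mull.
Qed.

End PolyComp.

(** * Complex-valued functions of real variables *)

Section ComplexCalculus.
Variables (R : realType) (n : nat).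
Notation V := 'cV[R]_n.
Local Notation C := R[i].
Implicit Types (z w : V -> C) (x v : V).

Definition cder x v z (d : C) : Prop :=
  is_derive x v (fun y => Re (z y) : R) (Re d) /\ is_derive x v (fun y => Im (z y) : R) (Im d).

Definition ccls cat (U : set V) z : Prop :=
  cls cat U (fun y => Re (z y) : R) /\ cls cat U (fun y => Im (z y) : R).

Definition cdf z x v : C :=
  ((\sum_i v i 0 * pd i (fun y => Re (z y) : R) x) +i*
   (\sum_i v i 0 * pd i (fun y => Im (z y) : R) x))%C.

Lemma cder_uniq x v z d d' : cder x v z d -> cder x v z d' -> d = d'.
Proof.
move=> [a b] [a' b']; apply: ReIm_eq; first exact: is_derive_uniq a a'.
exact: is_derive_uniq b b'.
Qed.

Lemma cder_cst x v (c : C) : cder x v (fun=> c) 0.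
Proof. by split; exact: iderc. Qed.

Lemma cder_add x v z w d d' : cder x v z d -> cder x v w d' ->
  cder x v (fun y => z y + w y) (d + d').
Proof.
move=> [a b] [a' b']; split.
  by rewrite ReD; under eq_fun do rewrite ReD; exact: iderD a a'.
by rewrite ImD; under eq_fun do rewrite ImD; exact: iderD b b'.
Qed.

Lemma cder_mul x v z w d d' : cder x v z d -> cder x v w d' ->
  cder x v (fun y => z y * w y) (d * w x + z x * d').
Proof.
move=> [a b] [a' b']; split.
  rewrite ReD !cReM; under eq_fun do rewrite cReM.
  rewrite addrACA -opprD; exact: iderB (iderM a a') (iderM b b').
rewrite ImD !cImM; under eq_fun do rewrite cImM.
rewrite addrACA; exact: iderD (iderM a b') (iderM b a').
Qed.

Lemma cder_opp x v z d : cder x v z d -> cder x v (fun y => - z y) (- d).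
Proof.
move=> [a b]; split.
  by rewrite ReN; under eq_fun do rewrite ReN; exact: iderN a.
by rewrite ImN; under eq_fun do rewrite ImN; exact: iderN b.
Qed.

Lemma cder_sub x v z w d d' : cder x v z d -> cder x v w d' ->
  cder x v (fun y => z y - w y) (d - d').
Proof. by move=> h h'; apply: cder_add => //; exact: cder_opp. Qed.

Lemma cder_sum (I : Type) (r : seq I) (h : I -> V -> C) (dh : I -> C) x v :
  (forall i, cder x v (h i) (dh i)) ->
  cder x v (fun y => \sum_(i <- r) h i y) (\sum_(i <- r) dh i).
Proof.
move=> H; elim: r => [|i r IH].
  by under eq_fun do rewrite big_nil; rewrite big_nil; exact: cder_cst.
by under eq_fun do rewrite big_cons; rewrite big_cons; exact: cder_add.
Qed.

Lemma cder_near x v z w d : (\forall y \near x, z y = w y) -> cder x v z d -> cder x v w d.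
Proof.
by move=> zw [a b]; split; [apply: ider_near a|apply: ider_near b]; apply: filterS zw => y ->.
Qed.

Lemma cder_open (U : set V) x v z w d : open U -> U x -> (forall y, U y -> z y = w y) ->
  cder x v z d -> cder x v w d.
Proof.
by move=> oU Ux zw; apply: cder_near; apply: filterS (open_nbhs_mem oU Ux) => y /zw.
Qed.

Lemma cdfD z x v v' : cdf z x (v + v') = cdf z x v + cdf z x v'.
Proof.
by apply: ReIm_eq; rewrite ?ReD ?ImD /= -big_split; apply: eq_bigr => i _; rewrite mxE mulrDl.
Qed.

Lemma cdfZ z x (a : R) v : cdf z x (a *: v) = a%:C%C * cdf z x v.
Proof.
apply: ReIm_eq; rewrite ?cReM ?cImM /= mul0r ?subr0 ?addr0 mulr_sumr;
  by apply: eq_bigr => i _; rewrite mxE mulrA.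
Qed.

Lemma cdf_sum z x (I : Type) (r : seq I) (h : I -> V) :
  cdf z x (\sum_(i <- r) h i) = \sum_(i <- r) cdf z x (h i).
Proof.
elim: r => [|i r IH]; last by rewrite !big_cons cdfD IH.
by rewrite !big_nil -(scale0r (0 : V)) cdfZ mul0r.
Qed.

Variables (cat : category) (U : set V) (oU : open U).

Lemma cder_cls z x v : ccls cat U z -> U x -> cder x v z (cdf z x v).
Proof.
by move=> [a b] Ux; split; [apply: (cls_ider _ oU a Ux)|apply: (cls_ider _ oU b Ux)].
Qed.

Lemma ccls_cst (c : C) : ccls cat U (fun=> c).
Proof. by split; apply: cls_cst. Qed.

Lemma ccls_ext z w : (forall y, U y -> z y = w y) -> ccls cat U z -> ccls cat U w.
Proof.
by move=> zw [a b]; split; [apply: cls_ext a|apply: cls_ext b] => // y /zw ->.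
Qed.

Lemma ccls_add z w : ccls cat U z -> ccls cat U w -> ccls cat U (fun y => z y + w y).
Proof.
move=> [a b] [a' b']; split.
  by under eq_fun do rewrite ReD; exact: cls_add.
by under eq_fun do rewrite ImD; exact: cls_add.
Qed.

Lemma ccls_opp z : ccls cat U z -> ccls cat U (fun y => - z y).
Proof.
move=> [a b]; split.
  by under eq_fun do rewrite ReN; exact: cls_opp.
by under eq_fun do rewrite ImN; exact: cls_opp.
Qed.

Lemma ccls_mul z w : ccls cat U z -> ccls cat U w -> ccls cat U (fun y => z y * w y).
Proof.
move=> [a b] [a' b']; split.
  under eq_fun do rewrite cReM.
  by apply: cls_sub_fun => //; apply: cls_mul.
under eq_fun do rewrite cImM.
by apply: cls_add => //; apply: cls_mul.
Qed.

Lemma ccls_sum (I : Type) (r : seq I) (h : I -> V -> C) : (forall i, ccls cat U (h i)) ->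
  ccls cat U (fun y => \sum_(i <- r) h i y).
Proof.
move=> H; elim: r => [|i r IH].
  by under eq_fun do rewrite big_nil; exact: ccls_cst.
by under eq_fun do rewrite big_cons; exact: ccls_add.
Qed.

Lemma ccls_sub (W : set V) z : open W -> W `<=` U -> ccls cat U z -> ccls cat W z.
Proof. by move=> oW WU [a b]; split; [apply: cls_sub a|apply: cls_sub b]. Qed.

End ComplexCalculus.

Section ComplexExp.
Variables (R : realType) (n : nat).
Notation V := 'cV[R]_n.
Local Notation C := R[i].

Lemma ider_line (f : V -> R) (x v : V) (d : R) :
  is_derive (0 : R) 1 (fun t : R => f (x + t *: v) : R) d -> is_derive x v f d.
Proof.
move=> /is_deriveP H; apply/is_deriveP => e e0; have [del del0 Hd] := H e e0.
by exists del => // t /Hd; rewrite scale0r addr0 add0r [t%:A]mulr1.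
Qed.

Lemma ider_comp1 (h : R -> R) (f : V -> R) (x v : V) (a d : R) :
  is_derive (f x) 1 h d -> is_derive x v f a -> is_derive x v (fun y => h (f y) : R) (d * a).
Proof.
move=> dh df; apply: ider_line.
apply: (@is_derive1_comp _ h (fun t : R => f (x + t *: v))).
  by rewrite scale0r addr0.
by apply: ider_seg; rewrite scale0r addr0.
Qed.

Definition cexp (z : C) : C := (expR (Re z) * cos (Im z) +i* (expR (Re z) * sin (Im z)))%C.

Lemma cexpN z : cexp (- z) * cexp z = 1.
Proof.
case: z => a b; apply: ReIm_eq; rewrite ?cReM ?cImM /= sinN cosN expRN.
  have := cos2Dsin2 b; have e0 : expR a != 0 by rewrite gt_eqF ?expR_gt0.
  by move=> h; rewrite -[RHS]h; field.
by field; rewrite gt_eqF ?expR_gt0.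
Qed.

Lemma cexp0 : cexp 0 = 1.
Proof. by apply: ReIm_eq; rewrite /= expR0 ?cos0 ?sin0 mul1r. Qed.

Lemma cexp_real z : Im z = 0 -> Im (cexp z) = 0.
Proof. by move=> /= ->; rewrite sin0 mulr0. Qed.

Lemma cder_exp x v (z : V -> C) d : cder x v z d -> cder x v (fun y => cexp (z y)) (d * cexp (z x)).
Proof.
move=> [a b]; have eR := ider_comp1 (is_derive_expR _) a.
have cR := ider_comp1 (is_derive_cos _) b; have sR := ider_comp1 (is_derive_sin _) b.
split; rewrite ?cReM ?cImM [X in is_derive _ _ _ X]/=.
  rewrite (_ : _ - _ = expR (Re (z x)) * Re d * cos (Im (z x)) + expR (Re (z x)) * (- sin (Im (z x)) * Im d)); last by ring.
  exact: (iderM eR cR).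
rewrite (_ : _ + _ = expR (Re (z x)) * Re d * sin (Im (z x)) + expR (Re (z x)) * (cos (Im (z x)) * Im d)); last by ring.
exact: (iderM eR sR).
Qed.

Lemma ccls_exp cat (U : set V) (z : V -> C) : open U -> ccls cat U z ->
  ccls cat U (fun y => cexp (z y)).
Proof.
move=> oU [a b]; split; apply: cls_mul => //; first [exact: cls_exp|exact: cls_cos|exact: cls_sin].
Qed.

End ComplexExp.

Section PolyDer.
Variables (R : realType) (n : nat).
Notation V := 'cV[R]_n.
Local Notation C := R[i].
Implicit Type g : {poly R}.

Lemma cx_cons g c : cx (g * 'X + c%:P) = cx g * 'X + (c%:C%C)%:P.
Proof. by rewrite /cx rmorphD rmorphM /= map_polyX map_polyC. Qed.

Lemma cx_deriv g : cx g^`() = (cx g)^`().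
Proof. by rewrite /cx deriv_map. Qed.

Lemma cxZ (a : R) g : cx (a *: g) = (a%:C%C) *: cx g.
Proof. by rewrite /cx linearZ. Qed.

Lemma cxD g g' : cx (g + g') = cx g + cx g'.
Proof. by rewrite /cx rmorphD. Qed.

Lemma cxM g g' : cx (g * g') = cx g * cx g'.
Proof. by rewrite /cx rmorphM. Qed.

Lemma cxB g g' : cx (g - g') = cx g - cx g'.
Proof. by rewrite /cx rmorphB. Qed.

Lemma pcomp_der (P : V -> {poly C}) (D : {poly C}) x v g :
  (forall j, cder x v (fun y => (P y)`_j) D`_j) ->
  forall j, cder x v (fun y => ((cx g) \Po P y)`_j) (((cx g^`()) \Po P x) * D)`_j.
Proof.
move=> dP; elim/poly_ind: g => [|g c IH] j.
  rewrite derivC /cx rmorph0 comp_poly0 mul0r coef0.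
  by under eq_fun do rewrite comp_poly0 coef0; exact: cder_cst.
under eq_fun do rewrite cx_cons comp_poly_MXaddC coefD coefC.
rewrite -[X in cder _ _ _ X]addr0; apply: cder_add; last exact: cder_cst.
rewrite derivD derivC addr0 derivM derivX mulr1 cxD comp_polyD /cx rmorphM /= map_polyX comp_polyM comp_polyX -/(cx _) -/(cx _).
rewrite (_ : _ * D = ((cx g^`() \Po P x) * D) * P x + (cx g \Po P x) * D); last by ring.
rewrite coefD !coefM -big_split /=.
under eq_fun do rewrite coefM.
by apply: cder_sum => i; apply: cder_mul.
Qed.

Lemma pcomp_cls cat (U : set V) (P : V -> {poly C}) g : open U ->
  (forall j, ccls cat U (fun y => (P y)`_j)) ->
  forall j, ccls cat U (fun y => ((cx g) \Po P y)`_j).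
Proof.
move=> oU cP; elim/poly_ind: g => [|g c IH] j.
  by under eq_fun do rewrite /cx rmorph0 comp_poly0 coef0; exact: ccls_cst.
under eq_fun do rewrite cx_cons comp_poly_MXaddC coefD coefC.
apply: ccls_add => //; last exact: ccls_cst.
under eq_fun do rewrite coefM.
by apply: ccls_sum => // i; apply: ccls_mul.
Qed.

Lemma pcomp_real (P : {poly C}) g : (forall j, Im P`_j = 0) -> forall j, Im ((cx g) \Po P)`_j = 0.
Proof.
move=> rP; elim/poly_ind: g => [|g c IH] j.
  by rewrite /cx rmorph0 comp_poly0 coef0.
rewrite cx_cons comp_poly_MXaddC coefD coefC ImD (_ : Im (if _ then _ else _) = 0); last by case: ifP.
rewrite addr0 coefM Im_sum big1 // => i _.
by rewrite cImM IH rP mulr0 mul0r addr0.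
Qed.

End PolyDer.

(** * The equations X_g U = g(U) *)

Section Core.
Variables (R : realType) (cat : category) (n : nat).
Notation V := 'cV[R]_n.+1.
Local Notation C := R[i].
Variables (L : V -> 'M[R]_n.+1) (E : V -> V) (s : nat) (mu : V -> C) (re : bool).
Local Notation X := (Xf L E).

Definition frame (x : V) : 'M[R]_n.+1 := \matrix_(i, k) (X 'X^k x) i 0.

(** Collected in one predicate that passes to smaller open sets, as every integration shrinks the
    domain. *)
Record adapted (Om : set V) : Prop := Adapted {
  ad_open : open Om;
  ad_L : mcls cat Om L;
  ad_E : mcls cat Om E;
  ad_torsion : forall x v w, Om x ->
    dmx L x (L x *m v) *m w - L x *m (dmx L x v *m w) =
    dmx L x (L x *m w) *m v - L x *m (dmx L x w *m v);
  ad_unity : forall x v, Om x ->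
    dmx L x (E x) *m v + L x *m dmx E x v - dmx E x (L x *m v) = v;
  ad_frame : forall x, Om x -> frame x \in unitmx;
  ad_mu : ccls cat Om mu;
  ad_spec : forall x, Om x -> spectral s (L x) (mu x);
  ad_dmu : forall x g, Om x -> cder x (X g x) mu (cx g).[mu x];
  ad_re : forall x, Om x -> if re then Im (mu x) = 0 else Im (mu x) != 0 }.

Lemma adapted_sub Om W : adapted Om -> open W -> W `<=` Om -> adapted W.
Proof.
move=> [oO cL cE tO uO fO cm sO dO rO] oW WO; split=> //.
- exact: mcls_sub cL.
- exact: mcls_sub cE.
- by move=> x v w /WO; exact: tO.
- by move=> x v /WO; exact: uO.
- by move=> x /WO; exact: fO.
- exact: ccls_sub cm.
- by move=> x /WO; exact: sO.
- by move=> x g /WO; exact: dO.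
- by move=> x /WO; exact: rO.
Qed.

Lemma Xf_sum (c : nat -> R) m x :
  X (\poly_(k < m) c k) x = \sum_(k < m) c k *: X 'X^k x.
Proof.
rewrite poly_def; elim: m => [|m IH]; first by rewrite !big_ord0 Xf0.
by rewrite !big_ord_recr /= XfD XfZ IH.
Qed.

Lemma Xf_frame (g : {poly R}) x : (size g <= n.+1)%N ->
  X g x = frame x *m \col_k g`_k.
Proof.
move=> sg; have -> : g = \poly_(k < n.+1) g`_k.
  by apply/polyP => i; rewrite coef_poly; case: ltnP => // h; rewrite nth_default // (leq_trans sg).
rewrite Xf_sum; apply/matrixP => i j; rewrite summxE [RHS]mxE; apply: eq_bigr => k _.
by rewrite !mxE !(ord1 j) coef_poly ltn_ord mulrC.
Qed.

(** The components of v in the frame at x, read as the coefficients of a polynomial g with X_g = v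
    at x; [inord] is exact in the range of k. *)
Definition repr (x v : V) : {poly R} := \poly_(k < n.+1) (invmx (frame x) *m v) (inord k) 0.

Lemma reprK Om x v : adapted Om -> Om x -> X (repr x v) x = v.
Proof.
move=> aO Ox; rewrite Xf_frame ?size_poly //.
rewrite (_ : \col_k _ = invmx (frame x) *m v) ?mulKVmx ?(ad_frame aO Ox) //.
by apply/matrixP => i j; rewrite !(ord1 j) mxE coef_poly ltn_ord inord_val.
Qed.

Lemma Xf_char g x : char_poly (L x) %| g -> X g x = 0.
Proof.
move=> /dvdpP [q ->]; rewrite /Xf rmorphM /=.
by rewrite (Cayley_Hamilton (L x)) mulr0 mul0mx.
Qed.

(** As the columns of the frame are independent, only multiples of the characteristic polynomial
    annihilate E: reduce g modulo it and compare coefficients. *)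
Lemma Xf_eq0 Om x g : adapted Om -> Om x ->
  X g x = 0 <-> ('X - (mu x)%:P) ^+ s %| cx g.
Proof.
move=> aO Ox; have [-> _ _] := ad_spec aO Ox; split; last exact: Xf_char.
have ch0 : char_poly (L x) != 0 by apply: monic_neq0; exact: char_poly_monic.
have sg : (size (g %% char_poly (L x))%R <= n.+1)%N.
  by have := ltn_modp g (char_poly (L x)); rewrite ch0 size_char_poly.
rewrite {1}(divp_eq g (char_poly (L x))) XfD Xf_char ?dvdp_mull // add0r Xf_frame //.
move=> /(congr1 (fun w => invmx (frame x) *m w)); rewrite mulKmx ?(ad_frame aO Ox) // mulmx0 => h.
apply/modp_eq0P.
apply/polyP => i; rewrite coef0; case: (ltnP i n.+1) => hi.
  by have := congr1 (fun w : V => w (Ordinal hi) 0) h; rewrite !mxE.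
by rewrite nth_default // (leq_trans sg).
Qed.

(** Linearity and vanishing for X_g = 0 turn [rho] into a one-form om with om(X_g) = rho g. The last
    hypothesis is X_f om(X_g) - X_g om(X_f) = om([X_f, X_g]), which by Cartan's formula is d om =
    0. *)
Lemma solve_real Om x0 (rho : V -> {poly R} -> R) a : adapted Om -> Om x0 ->
  (forall x, Om x -> forall b f g, rho x (b *: f + g) = b * rho x f + rho x g) ->
  (forall x g, Om x -> X g x = 0 -> rho x g = 0) ->
  (forall k, cls cat Om (rho ^~ 'X^k)) ->
  (forall x f g, Om x -> exists d d', [/\ is_derive x (X f x) (rho ^~ g) d,
     is_derive x (X g x) (rho ^~ f) d' & d - d' = rho x (f * g^`() - f^`() * g)]) ->
  exists2 r : R, 0 < r /\ ball x0 r `<=` Om & exists F : V -> R,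
    [/\ F x0 = a, cls cat (ball x0 r) F &
        forall x g, ball x0 r x -> is_derive x (X g x) F (rho x g)].
Proof.
move=> aO O0 rlin rker rcls rder; have oO := ad_open aO.
pose om j (x : V) : R := \sum_(k < n.+1) invmx (frame x) k j * rho x 'X^k.
have rS x : Om x -> forall (m : nat) (c : nat -> R), rho x (\poly_(k < m) c k) = \sum_(k < m) c k * rho x 'X^k.
  move=> Ox m c; have r0 : rho x 0 = 0 by apply: rker => //; exact: Xf0.
  rewrite poly_def; elim: m => [|m IH]; first by rewrite !big_ord0.
  by rewrite !big_ord_recr /= addrC rlin // IH addrC.
have omE x (v : V) : Om x -> \sum_j v j 0 * om j x = rho x (repr x v).
  move=> Ox; rewrite rS //; under eq_bigr do rewrite mulr_sumr.
  rewrite exchange_big; apply: eq_bigr => k _ /=; rewrite inord_val mxE mulr_suml.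
  by apply: eq_bigr => j _; rewrite mulrA [v j 0 * _]mulrC.
have omX x g : Om x -> \sum_j (X g x) j 0 * om j x = rho x g.
  move=> Ox; rewrite omE //; set h := repr _ _.
  have : rho x (h - g) = 0.
    by apply: rker => //; rewrite -scaleN1r XfD XfZ (reprK _ aO) // scaleN1r subrr.
  by rewrite -scaleN1r addrC rlin // mulN1r addrC => /subr0_eq.
have frcls : mcls cat Om frame.
  move=> i k; apply: cls_ext (Xf_cls oO (ad_L aO) (ad_E aO) 'X^k i 0) => // x _.
  by rewrite [RHS]mxE.
have omcls j : cls cat Om (om j).
  apply: cls_sum => // k _; apply: cls_mul => //.
  by apply: cls_invmx => // x; exact: ad_frame.
have closed i j x : Om x -> pd i (om j) x = pd j (om i) x.
  (* X_f and X_g are the coordinate vectors only at the point x; their bracket there accounts for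
     the difference and cancels against the last hypothesis. *)
  move=> Ox; pose f := repr x (delta_mx i 0); pose g := repr x (delta_mx j 0).
  have der f' g' d : is_derive x (X f' x) (rho ^~ g') d ->
      d = \sum_k (X g' x) k 0 * (\sum_l (X f' x) l 0 * pd l (om k) x) +
          \sum_k (dmx (X g') x (X f' x)) k 0 * om k x.
    move=> h; apply: (is_derive_uniq h).
    apply: (@ider_near _ _ (fun y => \sum_k (X g' y) k 0 * om k y)).
      by apply: filterS (open_nbhs_mem oO Ox) => y Oy; rewrite omX.
    rewrite addrC -big_split; apply: ider_sum => k _.
    apply: iderM; last exact: (cls_ider _ oO (omcls k) Ox).
    exact: (mder_cls oO _ (Xf_cls oO (ad_L aO) (ad_E aO) g') Ox).
  have [d [d' [h h' dd]]] := rder x f g Ox.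
  have e1 := der _ _ _ h; have e2 := der _ _ _ h'.
  rewrite -omX // -(bracket_Xf oO (ad_L aO) (ad_E aO) (ad_torsion aO) (ad_unity aO)) // in dd.
  have deltaS (G : 'I_n.+1 -> R) k : \sum_l (delta_mx k 0 : V) l 0 * G l = G k.
    rewrite (bigD1 k) //= big1 ?addr0 ?mxE ?eqxx ?mul1r // => l lk.
    by rewrite mxE (negbTE lk) mul0r.
  move: dd; rewrite e1 e2 /f /g !(reprK _ aO) // !deltaS.
  under [X in _ = X -> _]eq_bigr do rewrite mxE [X in (_ + X) * _]mxE mulrDl.
  rewrite big_split /=; under [X in _ = _ + X -> _]eq_bigr do rewrite mulNr.
  have cancel (a1 a2 p q : R) : a1 + p - (a2 + q) = p - q -> a1 = a2.
    by move=> h0; apply: (addIr (p - q)); rewrite -[in RHS]h0; ring.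
  by rewrite sumrN; apply: cancel.
have [r rO [F [F0 Fc dF]]] := cls_poincare a oO O0 omcls closed.
exists r => //; exists F; split=> // x g bx.
rewrite -(omX x g) ?(rO.2) //; last exact: rO.2.
have -> : \sum_j (X g x) j 0 * om j x = \sum_j (X g x) j 0 * pd j F x.
  by apply: eq_bigr => j _; congr (_ * _); have [_] := dF j x bx.
by apply: (cls_ider _ _ Fc bx); exact: ball_opencv.
Qed.

Lemma solve Om x0 (rho : V -> {poly R} -> C) a : adapted Om -> Om x0 ->
  (forall x, Om x -> forall b f g, rho x (b *: f + g) = b%:C%C * rho x f + rho x g) ->
  (forall x g, Om x -> X g x = 0 -> rho x g = 0) ->
  (forall k, ccls cat Om (rho ^~ 'X^k)) ->
  (forall x f g, Om x -> exists d d', [/\ cder x (X f x) (rho ^~ g) d,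
     cder x (X g x) (rho ^~ f) d' & d - d' = rho x (f * g^`() - f^`() * g)]) ->
  exists2 r : R, 0 < r /\ ball x0 r `<=` Om & exists F : V -> C,
    [/\ F x0 = a, ccls cat (ball x0 r) F,
        forall x g, ball x0 r x -> cder x (X g x) F (rho x g) &
        (forall x g, Om x -> Im (rho x g) = 0) -> Im a = 0 -> forall x, Im (F x) = 0].
Proof.
move=> aO O0 rlin rker rcls rder.
have [r1 [r10 r1O] [F1 [F10 F1c dF1]]] : exists2 r : R, 0 < r /\ ball x0 r `<=` Om &
    exists F : V -> R, [/\ F x0 = Re a, cls cat (ball x0 r) F &
        forall x g, ball x0 r x -> is_derive x (X g x) F (Re (rho x g))].
  apply: (@solve_real Om x0 (fun x g => Re (rho x g))) => //.
  - by move=> x Ox b f g; rewrite rlin // ReD cReM /= mul0r subr0.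
  - by move=> x g Ox /(rker _ _ Ox) ->.
  - by move=> k; case: (rcls k).
  - move=> x f g Ox; have [d [d' [h h' e]]] := rder x f g Ox.
    by exists (Re d), (Re d'); rewrite -e ReD ReN; case: h; case: h'.
(* For real data the imaginary part is taken to be 0 outright, so the solution is real at every
   point, also outside the ball. *)
have [rI|rI] := pselect ((forall x g, Om x -> Im (rho x g) = 0) /\ Im a = 0).
  exists r1 => //; exists (fun x => (F1 x)%:C%C); split=> //.
  - by rewrite F10; apply: ReIm_eq => //=; rewrite rI.2.
  - by split => //; apply: cls_cst; exact: ball_opencv.
  - by move=> x g bx; split; [exact: dF1|rewrite (rI.1 x g (r1O x bx)); exact: (iderc (0 : R) x (X g x))].
have [r2 [r20 r2O] [F2 [F20 F2c dF2]]] : exists2 r : R, 0 < r /\ ball x0 r `<=` Om &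
    exists F : V -> R, [/\ F x0 = Im a, cls cat (ball x0 r) F &
        forall x g, ball x0 r x -> is_derive x (X g x) F (Im (rho x g))].
  apply: (@solve_real Om x0 (fun x g => Im (rho x g))) => //.
  - by move=> x Ox b f g; rewrite rlin // ImD cImM /= mul0r addr0.
  - by move=> x g Ox /(rker _ _ Ox) ->.
  - by move=> k; case: (rcls k).
  - move=> x f g Ox; have [d [d' [h h' e]]] := rder x f g Ox.
    by exists (Im d), (Im d'); rewrite -e ImD ImN; case: h; case: h'.
have b1 : (ball x0 (Order.min r1 r2) : set V) `<=` ball x0 r1.
  by apply: ball_le_sub; rewrite ge_min lexx.
have b2 : (ball x0 (Order.min r1 r2) : set V) `<=` ball x0 r2.
  by apply: ball_le_sub; rewrite ge_min lexx orbT.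
exists (Order.min r1 r2); first by split; [rewrite lt_min r10|apply: subset_trans r1O].
exists (fun x => (F1 x +i* F2 x)%C); split.
- by apply: ReIm_eq.
- by split; [apply: cls_sub F1c => //|apply: cls_sub F2c => //]; exact: ball_opencv.
- by move=> x g bx; split; [apply: dF1; exact: b1|apply: dF2; exact: b2].
- by move=> h h'; case: rI.
Qed.

Lemma eval_comp (g : {poly R}) (a : C) : (cx g).[a] = (cx g \Po a%:P)`_0.
Proof. by rewrite comp_coef0 coefC. Qed.

Lemma eval_cls (U : set V) (z : V -> C) (g : {poly R}) : open U -> ccls cat U z ->
  ccls cat U (fun y => (cx g).[z y]).
Proof.
move=> oU cz; under eq_fun do rewrite eval_comp.
apply: pcomp_cls => // -[|j]; first by under eq_fun do rewrite coefC.
by under eq_fun do rewrite coefC /=; exact: ccls_cst.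
Qed.

Lemma eval_der (x v : V) (z : V -> C) d (g : {poly R}) : cder x v z d ->
  cder x v (fun y => (cx g).[z y]) ((cx g^`()).[z x] * d).
Proof.
move=> dz; under eq_fun do rewrite eval_comp.
have := @pcomp_der _ _ (fun y => (z y)%:P) d%:P x v g.
rewrite eval_comp => /(_ _ 0); rewrite coef0M coefC /=; apply.
by case=> [|j]; under eq_fun do rewrite coefC /=; rewrite coefC //=; exact: cder_cst.
Qed.

Lemma eval_real (a : C) (g : {poly R}) : Im a = 0 -> Im (cx g).[a] = 0.
Proof.
by move=> a0; rewrite eval_comp; apply: pcomp_real => -[|j]; rewrite coefC.
Qed.

Lemma comp_coef1 (h : {poly C}) (a : C) : (h \Po (a%:P + 'X))`_1 = h^`().[a].
Proof.
have [|_ ] := @comp_agree _ h (a%:P + 'X) a%:P 1 isT.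
  by case=> // _; rewrite coefD coefX addr0.
by rewrite comp_polyCr coefD !coefC coefX /= !subr0 add0r mulr1.
Qed.

(** For s > 1 the value g'(mu) depends only on X_g, since X_g = 0 forces a multiple root of g at mu.
    The function w, the inverse of v, serves as integrating factor. *)
Lemma exp_solution Om x0 : (1 < s)%N -> adapted Om -> Om x0 ->
  exists2 r : R, 0 < r /\ ball x0 r `<=` Om & exists v w : V -> C,
  [/\ v x0 = 1, ccls cat (ball x0 r) v /\ ccls cat (ball x0 r) w,
      forall x, w x * v x = 1,
      forall x g, ball x0 r x -> cder x (X g x) v ((cx g^`()).[mu x] * v x) /\
                                 cder x (X g x) w (- (cx g^`()).[mu x] * w x) &
      re -> forall x, Im (v x) = 0 /\ Im (w x) = 0].
Proof.
move=> s1 aO O0.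
have [|||| r rO [z [z0 cz dz rz]]] := @solve Om x0 (fun x g => (cx g^`()).[mu x]) 0 aO O0.
- by move=> x Ox b f g; rewrite derivD derivZ cxD cxZ hornerD hornerZ.
- move=> x g Ox /(Xf_eq0 _ aO Ox) dv; rewrite cx_deriv -comp_coef1.
  by apply: (comp_kill dv) => //; rewrite coefD coefC coefX addr0.
- move=> k; exact: eval_cls (ad_open aO) (ad_mu aO).
- move=> x f g Ox.
  exists ((cx g^`()^`()).[mu x] * (cx f).[mu x]), ((cx f^`()^`()).[mu x] * (cx g).[mu x]); split.
  + exact: eval_der (ad_dmu aO f Ox).
  + exact: eval_der (ad_dmu aO g Ox).
  + by rewrite derivB !derivM cxB !cxD !cxM hornerD hornerN !hornerD !hornerM; ring.
exists r => //; exists (fun x => cexp (z x)), (fun x => cexp (- z x)); split.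
- by rewrite z0 cexp0.
- have oB : open (ball x0 r : set V) by exact: ball_opencv.
  by split; apply: ccls_exp => //; apply: ccls_opp.
- by move=> x; exact: cexpN.
- move=> x g bx; split; first exact: cder_exp (dz x g bx).
  exact: cder_exp (cder_opp (dz x g bx)).
- move=> hre x; have r0 : Im (z x) = 0.
    apply: rz => // y g Oy; apply: eval_real.
    by have := ad_re aO Oy; rewrite hre.
  by split; apply: cexp_real => //; rewrite ImN r0 oppr0.
Qed.

(* P solves X_g P = g(P) modulo t^j, with P = mu_0 + t mod t^j at x0. *)
Definition flow_jet x0 (j : nat) (W : set V) (P : V -> {poly C}) : Prop :=
  [/\ forall x i, W x -> (j <= i)%N -> (P x)`_i = 0,
      forall x, W x -> (P x)`_0 = mu x,
      forall i, ccls cat W (fun x => (P x)`_i),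
      forall x g i, W x -> (i < j)%N -> cder x (X g x) (fun y => (P y)`_i) ((cx g \Po P x)`_i) &
      (forall i, (i < j)%N -> (P x0)`_i = ((mu x0)%:P + 'X)`_i) /\
      (re -> forall x i, W x -> Im (P x)`_i = 0)].

Lemma flow_jet1 Om x0 : adapted Om -> flow_jet x0 1 Om (fun x => (mu x)%:P).
Proof.
move=> aO; split.
- by move=> x [|i] // _ _; rewrite coefC.
- by move=> x _; rewrite coefC.
- case=> [|i]; under eq_fun do rewrite coefC /=; first exact: ad_mu aO.
  by apply: ccls_cst; exact: ad_open aO.
- move=> x g [|] // Ox _; under eq_fun do rewrite coefC /=.
  by rewrite comp_coef0 coefC /=; have := ad_dmu aO g Ox.
- split; first by case=> // _; rewrite coefD coefX addr0.
  move=> hre x i Ox; rewrite coefC; case: ifP => // _.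
  by have := ad_re aO Ox; rewrite hre.
Qed.

(** The new coefficient y has to satisfy X_g y = g'(mu) y + (g(P))_j. For j = 1 the inhomogeneity
    vanishes and v is the solution; for j > 1 the ansatz y = v z leaves X_g z = (g(P))_j w, which
    [solve] integrates. *)
Lemma flow_jetS Om x0 j P v w : (0 < j < s)%N -> adapted Om -> Om x0 ->
  v x0 = 1 -> ccls cat Om v -> ccls cat Om w -> (forall x, w x * v x = 1) ->
  (forall x g, Om x -> cder x (X g x) v ((cx g^`()).[mu x] * v x)) ->
  (forall x g, Om x -> cder x (X g x) w (- (cx g^`()).[mu x] * w x)) ->
  (re -> forall x, Im (v x) = 0 /\ Im (w x) = 0) ->
  flow_jet x0 j Om P ->
  exists2 r : R, 0 < r /\ ball x0 r `<=` Om &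
    exists P', flow_jet x0 j.+1 (ball x0 r) P'.
Proof.
move=> /andP[j0 js] aO O0 v1 cv cw wv dv dw rvw [Pj P0 Pc Pd [Pi Pr]].
have oO := ad_open aO.
have sub_deg (z : V -> C) (W : set V) : open W -> W `<=` Om -> ccls cat W z ->
    (forall x g, W x -> cder x (X g x) z ((cx g^`()).[mu x] * z x + (cx g \Po P x)`_j)) ->
    z x0 = ((mu x0)%:P + 'X)`_j -> (re -> forall x, W x -> Im (z x) = 0) -> W x0 ->
    flow_jet x0 j.+1 W (fun x => P x + (z x)%:P * 'X^j).
  move=> oW WO cz dz z0 rz W0.
  have PE x i : W x -> (P x + (z x)%:P * 'X^j)`_i = if i == j then z x else (P x)`_i.
    move=> Wx; rewrite coefD coefMXn coefC; case: (ltngtP i j) => [ij|ij|->].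
    - by rewrite addr0.
    - by rewrite subn_eq0 leqNgt ij addr0.
    - by rewrite subnn /= Pj ?add0r //; exact: WO.
  split.
  - move=> x i Wx ji; rewrite PE // gtn_eqF // Pj //; [exact: WO|exact: ltnW].
  - by move=> x Wx; rewrite PE // ltn_eqF // P0 //; exact: WO.
  - move=> i; have [->|ij] := eqVneq i j.
      by apply: (ccls_ext oW _ cz) => y Wy; rewrite PE // eqxx.
    apply: (ccls_ext oW _ (ccls_sub oW WO (Pc i))) => y Wy.
    by rewrite PE // (negbTE ij).
  - move=> x g i Wx ij1.
    have [|h1 h2] := @comp_agree _ (cx g) (P x + (z x)%:P * 'X^j) (P x) j j0.
      by move=> l lj; rewrite PE // ltn_eqF.
    have [ij|ij] := eqVneq i j.
      rewrite ij; apply: (cder_open oW Wx (z := z)); first by move=> y Wy; rewrite PE // eqxx.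
      have -> : (cx g \Po (P x + (z x)%:P * 'X^j))`_j = (cx g^`()).[mu x] * z x + (cx g \Po P x)`_j.
        have := h2; rewrite PE // eqxx (Pj x j) ?subr0 //; last exact: WO.
        by rewrite cx_deriv (P0 x (WO x Wx)) => <-; rewrite subrK.
      exact: dz.
    have {}ij1 : (i < j)%N by move: ij1; rewrite ltnS leq_eqVlt (negbTE ij).
    rewrite h1 //; apply: (cder_open oW Wx (z := fun y => (P y)`_i)); last by apply: Pd => //; exact: WO.
    by move=> y Wy; rewrite PE // (negbTE ij).
  - split=> [i|hre x i Wx].
      rewrite ltnS leq_eqVlt PE // => /predU1P[->|ij]; first by rewrite eqxx.
      by rewrite ltn_eqF // Pi.
    rewrite PE //; case: ifP => _; first exact: rz.
    by apply: Pr => //; exact: WO.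
have [j1|j1] := eqVneq j 1%N.
  have [r r0 rO] := open_ballcv oO O0; exists r => //.
  have oB : open (ball x0 r : set V) by exact: ball_opencv.
  exists (fun x => P x + (v x)%:P * 'X^j); apply: sub_deg => //.
  - exact: ccls_sub cv.
  - move=> x g /rO Ox; have -> : (cx g \Po P x)`_j = 0.
      have [|_ h] := @comp_agree _ (cx g) (P x) (mu x)%:P j j0.
        by rewrite j1; case=> // _; rewrite coefC /= P0.
      move: h; rewrite comp_polyCr !coefC (gtn_eqF j0) !subr0 Pj // mulr0 => ->.
      by [].
    by rewrite addr0; exact: dv.
  - by rewrite j1 coefD coefC coefX add0r v1.
  - by move=> hre x _; case: (rvw hre x).
  - exact: ballxx.
have [|||| r rO [z [z0 cz dz rz]]] := @solve Om x0 (fun x g => (cx g \Po P x)`_j * w x) 0 aO O0.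
- move=> x Ox b f g.
  by rewrite cxD cxZ comp_polyD comp_polyZ coefD coefZ mulrDl mulrA.
- move=> x g Ox /(Xf_eq0 _ aO Ox) dvd; rewrite (comp_kill dvd) ?mul0r //; exact: P0.
- by move=> k; apply: ccls_mul => //; apply: pcomp_cls.
- move=> x f g Ox.
  (* P has no term of degree j, so its derivative along X_f is f(P) truncated below t^j. The missing
     coefficient leaves a term - g'(mu) (f(P))_j w; together with the derivative of w it is
     symmetric in f and g and drops out of the difference. *)
  have der f' g' : cder x (X f' x) (fun y => (cx g' \Po P y)`_j * w y)
     ((((cx g'^`() * cx f') \Po P x)`_j - (cx g'^`()).[mu x] * (cx f' \Po P x)`_j) * w x +
       (cx g' \Po P x)`_j * (- (cx f'^`()).[mu x] * w x)).
    apply: cder_mul; last exact: dw.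
    have := @pcomp_der _ _ P (take_poly j (cx f' \Po P x)) x (X f' x) g' _ j.
    rewrite (_ : (_ * take_poly _ _)`_j = ((cx g'^`() * cx f') \Po P x)`_j - (cx g'^`()).[mu x] * (cx f' \Po P x)`_j).
      apply=> i; rewrite coef_take_poly; case: ltnP => ij; first exact: Pd.
      apply: (cder_open oO Ox (z := fun=> 0)); first by move=> y Oy; rewrite Pj.
      exact: cder_cst.
    rewrite -[in RHS](P0 x Ox) -comp_coef0 comp_polyM.
    set G := _ \Po _; set H := _ \Po _.
    have -> : G * H = G * take_poly j H + G * drop_poly j H * 'X^j.
      by rewrite -{1}(poly_take_drop j H) mulrDr mulrA.
    rewrite coefD.
    by rewrite coefMXn ltnn subnn coef0M coef_drop_poly add0n addrK.
  refine (ex_intro _ _ (ex_intro _ _ (And3 (der f g) (der g f) _))).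
  rewrite cxB !cxM comp_polyB coefB [cx f * _]mulrC; ring.
have oB : open (ball x0 r : set V) by exact: ball_opencv.
exists r => //; exists (fun x => P x + (v x * z x)%:P * 'X^j); apply: sub_deg => //.
- exact: rO.2.
- by apply: ccls_mul => //; apply: ccls_sub cv => //; exact: rO.2.
- move=> x g bx; have := cder_mul (dv x g (rO.2 x bx)) (dz x g bx).
  rewrite (_ : v x * (_ * w x) = (cx g \Po P x)`_j); first by rewrite mulrA.
  by rewrite mulrCA [v x * _]mulrC wv mulr1.
- by rewrite z0 mulr0 coefD coefC coefX (gtn_eqF j0) (negbTE j1) addr0.
- move=> hre x bx; have [r1 _] := rvw hre x.
  rewrite cImM r1 mul0r addr0 rz ?mulr0 // => y g Oy.
  have [_ r2] := rvw hre y.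
  by rewrite cImM r2 mulr0 add0r pcomp_real ?mul0r // => i; exact: Pr.
- by apply: ballxx; exact: rO.1.
Qed.

Lemma flow_jet_sub Om W x0 j P : open W -> W `<=` Om -> flow_jet x0 j Om P -> flow_jet x0 j W P.
Proof.
move=> oW WO [h1 h2 h3 h4 [h5 h6]]; split.
- by move=> x i /WO; exact: h1.
- by move=> x /WO; exact: h2.
- by move=> i; exact: ccls_sub (h3 i).
- by move=> x g i /WO; exact: h4.
- by split=> // hre x i /WO; exact: h6.
Qed.

Lemma flow_jet_exists Om x0 : (0 < s)%N -> adapted Om -> Om x0 ->
  exists2 r : R, 0 < r /\ ball x0 r `<=` Om & exists P, flow_jet x0 s (ball x0 r) P.
Proof.
move=> s0 aO O0; have [s1|s1] := leqP s 1.
  have -> : s = 1%N by apply/eqP; rewrite eqn_leq s1.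
  have [r r0 rO] := open_ballcv (ad_open aO) O0; exists r => //; exists (fun x => (mu x)%:P).
  by apply: (flow_jet_sub _ rO (flow_jet1 x0 aO)); exact: ball_opencv.
have [r [r0 rO] [v [w [v1 [cv cw] wv dvw rvw]]]] := exp_solution s1 aO O0.
suff H j : (0 < j <= s)%N -> exists2 r' : R, 0 < r' /\ ball x0 r' `<=` ball x0 r &
    exists P, flow_jet x0 j (ball x0 r') P.
  have [|r' [r'0 r'r] HP] := H s; first by rewrite s0 leqnn.
  by exists r' => //; split=> //; apply: subset_trans rO.
have aB r' : ball x0 r' `<=` ball x0 r -> adapted (ball x0 r').
  by move=> h; apply: (adapted_sub aO); [exact: ball_opencv|apply: subset_trans rO].
elim: j => // -[_ _|j IH /andP[_ js]].
  have ar : adapted (ball x0 r) by apply: aB.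
  by exists r; [split|exists (fun x => (mu x)%:P); exact: (flow_jet1 x0 ar)].
have [|r' [r'0 r'r] [P HP]] := IH; first by rewrite /= ltnW.
have [|||||r'' [r''0 h] HP''] := @flow_jetS (ball x0 r') x0 j.+1 P v w _ (aB _ r'r) (ballxx _ r'0) v1 _ _ wv _ _ rvw HP.
- by rewrite /= js.
- by apply: ccls_sub cv => //; exact: ball_opencv.
- by apply: ccls_sub cw => //; exact: ball_opencv.
- by move=> x g /r'r bx; case: (dvw x g bx).
- by move=> x g /r'r bx; case: (dvw x g bx).
- by exists r'' => //; split=> //; apply: subset_trans r'r.
Qed.

End Core.

(** * Normal coordinates in a chart *)

Section Adapted.
Variables (R : realType) (cat : category) (n : nat).
Notation V := 'cV[R]_n.+1.
Local Notation C := R[i].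
Variables (L : V -> 'M[R]_n.+1) (E : V -> V) (s : nat) (mu : V -> C) (re : bool).
Local Notation X := (Xf L E).
Variable Om : set V.
Hypotheses (oO : open Om) (cL : mcls cat Om L) (cE : mcls cat Om E).
Hypothesis torsion0 : forall x v w, Om x ->
  dmx L x (L x *m v) *m w - L x *m (dmx L x v *m w) =
  dmx L x (L x *m w) *m v - L x *m (dmx L x w *m v).
Hypothesis unity1 : forall x v, Om x ->
  dmx L x (E x) *m v + L x *m dmx E x v - dmx E x (L x *m v) = v.
Hypothesis cmu : ccls cat Om mu.
Hypothesis spec : forall x, Om x -> spectral s (L x) (mu x).
Hypothesis hre : forall x, Om x -> if re then Im (mu x) = 0 else Im (mu x) != 0.

Let N : R := n.+1%:R.
Let N0 : N != 0. Proof. by rewrite pnatr_eq0. Qed.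

Lemma dtr_mu x v : Om x -> [/\ dtr L 0 x v = N * Re (cdf mu x v),
  dtr L 1 x v = N * Re (mu x * cdf mu x v) &
  dtr L 2 x v = N * Re (mu x ^+ 2 * cdf mu x v)].
Proof.
move=> Ox; have [t0 t1 t2] := ider_trace oO cL v Ox.
have d1 := cder_cls oO v cmu Ox; have d2 := cder_mul d1 d1; have d3 := cder_mul d1 d2.
have key (f : V -> R) (z : V -> C) d e : is_derive x v f d -> cder x v z e ->
    (forall y, Om y -> f y = N * Re (z y)) -> d = N * Re e.
  move=> df [dz _] fz; apply: (is_derive_uniq df).
  have zf : \forall y \near x, N * Re (z y) = f y.
    by apply: filterS (open_nbhs_mem oO Ox) => y /fz ->.
  have dN : is_derive x v (fun y => N * Re (z y)) (N * Re e).
    by rewrite -[N * Re e]add0r -[0](mul0r (Re (z x))); exact: (iderM (iderc N x v) dz).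
  exact: (ider_near zf dN).
have e0 := key _ _ _ _ t0 d1 (fun y Oy => let: And3 _ _ (And3 h _ _) := spec Oy in h).
have e1 : 2 * dtr L 1 x v = N * Re (cdf mu x v * mu x + mu x * cdf mu x v).
  by apply: key t1 d2 _ => y Oy; have [_ _ [_ h _]] := spec Oy; rewrite h expr2.
have e2 : 3 * dtr L 2 x v = N * Re (cdf mu x v * (mu x * mu x) + mu x * (cdf mu x v * mu x + mu x * cdf mu x v)).
  by apply: key t2 d3 _ => y Oy; have [_ _ [_ _ h]] := spec Oy; rewrite h !exprS expr0 mulr1.
split=> //.
  apply: (@mulfI _ 2) => //; rewrite e1 [cdf _ _ _ * _]mulrC ReD; ring.
apply: (@mulfI _ 3) => //; rewrite e2.
rewrite (_ : _ + _ = mu x ^+ 2 * cdf mu x v + (mu x ^+ 2 * cdf mu x v + mu x ^+ 2 * cdf mu x v)); last by ring.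
by rewrite !ReD; ring.
Qed.

(** Consecutive traces give this identity in real part, and its multiple by mu in real part as well.
    If Im mu is nonzero, the second relation determines the imaginary part; if mu is real, so is its
    differential. *)
Lemma cdf_mu_L x v : Om x -> cdf mu x (L x *m v) = mu x * cdf mu x v.
Proof.
move=> Ox; have [a0 a1 a2] := dtr_mu v Ox; have [b0 b1 b2] := dtr_mu (L x *m v) Ox.
have t k := dtr_torsion torsion0 k v Ox.
have e0 : Re (cdf mu x (L x *m v)) = Re (mu x * cdf mu x v).
  by apply: (mulfI N0); rewrite -b0 -a1 t.
have e1 : Re (mu x * cdf mu x (L x *m v)) = Re (mu x ^+ 2 * cdf mu x v).
  by apply: (mulfI N0); rewrite -b1 -a2 t.
apply: ReIm_eq => //.
have := hre Ox; have := hre; case: ifP => _ hre' hr.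
  have Im0 w : Im (cdf mu x w) = 0.
    have [_ d2] := cder_cls oO w cmu Ox; apply: (is_derive_uniq d2).
    have z0 : \forall y \near x, (0 : R) = Im (mu y).
      by apply: filterS (open_nbhs_mem oO Ox) => y /hre' ->.
    exact: (ider_near z0 (iderc (0 : R) x w)).
  by rewrite Im0 cImM Im0 hr mul0r mulr0 addr0.
apply: (mulfI hr); move: e0 e1.
rewrite expr2 !cReM !cImM; set a := Re _; set b := Im _; set p := Re _; set q := Im _.
set p' := Re _; set q' := Im _ => -> e1.
have {}e1 : b * q' = p * (p * p' - b * q) - ((p * p - b * b) * p' - (p * b + b * p) * q).
  by rewrite -e1; ring.
by rewrite e1; ring.
Qed.

Lemma cdf_mu_E x : Om x -> cdf mu x (E x) = 1.
Proof.
move=> Ox; have [a0 a1 _] := dtr_mu (E x) Ox; have [_ _ [s1 _ _]] := spec Ox.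
have e0 : Re (cdf mu x (E x)) = 1.
  by apply: (mulfI N0); rewrite -a0 (dtr_unity unity1) // expr0 mxtrace1 mulr1.
have e1 : Im (mu x) * Im (cdf mu x (E x)) = 0.
  have : N * Re (mu x * cdf mu x (E x)) = N * Re (mu x).
    by rewrite -a1 (dtr_unity unity1) // expr1.
  by move/(mulfI N0); rewrite cReM e0 mulr1 => h; lra.
apply: ReIm_eq => //; have := hre Ox; case: ifP => hr0 hr; last first.
  by apply: (mulfI hr); rewrite e1 mulr0.
have [_ d2] := cder_cls oO (E x) cmu Ox; apply: (is_derive_uniq d2).
have z0 : \forall y \near x, (0 : R) = Im (mu y).
  by apply: filterS (open_nbhs_mem oO Ox) => y /hre; rewrite hr0 => ->.
exact: (ider_near z0 (iderc (0 : R) x (E x))).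
Qed.

Lemma cdf_mu_X x g : Om x -> cdf mu x (X g x) = (cx g).[mu x].
Proof.
move=> Ox; elim/poly_ind: g => [|g c IH].
  by rewrite Xf0 /cx rmorph0 horner0 -(scale0r (0 : V)) cdfZ mul0r.
by rewrite Xf_cons cdfD cdfZ cdf_mu_L // cdf_mu_E // IH cx_cons hornerMXaddC mulr1 mulrC.
Qed.

(** The row dmu is a left eigenvector for mu with value 1 on E, and its conjugate is one for the
    conjugate eigenvalue; as eigenspaces are lines, [cyclic_vector] applies. Powers beyond n are
    reduced by the characteristic polynomial. *)
Lemma frame_unit x sg : Om x -> jordan_form (complexify (L x)) sg -> uniq (map fst sg) ->
  frame L E x \in unitmx.
Proof.
move=> Ox js us; have [[d [cA _ _]] _] := jordan_spectrum js.
pose r : 'rV[C]_n.+1 := \row_j cdf mu x (delta_mx j 0).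
have rv (v : V) : r *m map_mx (real_complex R) v = (cdf mu x v)%:M.
  apply/matrixP => i j; rewrite !(ord1 i) !(ord1 j) !mxE eqxx mulr1n.
  rewrite [in RHS](_ : v = \sum_k v k 0 *: delta_mx k 0); last first.
    by rewrite [LHS]matrix_sum_delta; apply: eq_bigr => k _; rewrite big_ord1.
  by rewrite cdf_sum; apply: eq_bigr => k _; rewrite cdfZ !mxE mulrC.
have rA : r *m complexify (L x) = mu x *: r.
  apply/matrixP => i j; rewrite !(ord1 i).
  have := rv (L x *m delta_mx j 0); rewrite map_mxM mulmxA -/(complexify _) => /matrixP /(_ 0 0).
  rewrite map_delta_mx -colE [LHS]mxE => ->.
  by rewrite !mxE eqxx mulr1n cdf_mu_L.
have rE : r *m map_mx (real_complex R) (E x) = 1%:M by rewrite rv cdf_mu_E.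
pose al a := if a == mu x then r else map_mx (@conjc R) r.
have conj_cx p q (A : 'M[R]_(p, q)) : map_mx (@conjc R) (map_mx (real_complex R) A) = map_mx (real_complex R) A.
  by apply/matrixP => i j; rewrite !mxE /= oppr0.
have hal a : a \in map d (enum 'I_n.+1) -> al a *m complexify (L x) = a *: al a /\
    al a *m map_mx (real_complex R) (E x) = 1%:M.
  move=> /mapP [i _ ad]; have ra : root (cx (char_poly (L x))) a.
    by rewrite cx_char_poly; apply/(root_spectrum _ cA); exists i.
  rewrite /al; have [_ sp _] := spec Ox.
  case: eqVneq => [->|na]; first by split.
  have [ea|->] := sp a ra; first by rewrite ea eqxx in na.
  rewrite -[complexify _]conj_cx -[map_mx _ (E x)]conj_cx -!map_mxM.
  rewrite -/(complexify _) rA rE map_mxZ; split => //.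
  by rewrite map_scalar_mx rmorph1.
have cA' : char_poly (complexify (L x)) = \prod_(a <- map d (enum 'I_n.+1)) ('X - a%:P).
  by rewrite cA big_map big_enum.
have cyc := cyclic_vector cA' (fun a => jordan_rank a js us) hal.
rewrite -row_free_unit; apply: inj_row_free => be hbe.
have kX k : be *m X 'X^k x = 0.
  rewrite (divp_eq 'X^k (char_poly (L x))) XfD Xf_char ?dvdp_mull // add0r Xf_frame.
    by rewrite mulmxA hbe mul0mx.
  have := ltn_modp ('X^k : {poly R}) (char_poly (L x)).
  by rewrite monic_neq0 ?char_poly_monic // size_char_poly.
suff : map_mx (real_complex R) be = 0.
  by move=> h; apply/matrixP => i j; have /matrixP/(_ i j) := h; rewrite !mxE => /complexI.
apply: cyc => k; have := congr1 (map_mx (real_complex R)) (kX k).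
by rewrite /Xf rmorphXn /= horner_mx_X !map_mxM rmorphXn /= map_mx0.
Qed.

Lemma adapted_near x0 sg : Om x0 -> jordan_form (complexify (L x0)) sg -> uniq (map fst sg) ->
  exists W, [/\ W x0, W `<=` Om & adapted cat L E s mu re W].
Proof.
move=> O0 js us; have u0 := frame_unit O0 js us.
have frcls : mcls cat Om (frame L E).
  move=> i k; apply: cls_ext (Xf_cls oO cL cE 'X^k i 0) => // x _.
  by rewrite [RHS]mxE.
have d0 : \det (frame L E x0) != 0 by rewrite -unitfE -unitmxE.
have [r [r0 rO hr]] := cls_neq0_near oO (cls_det oO frcls) O0 d0.
have oB : open (ball x0 r : set V) by exact: ball_opencv.
exists (ball x0 r); split=> //; first exact: ballxx.
split=> //.
- exact: mcls_sub cL.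
- exact: mcls_sub cE.
- by move=> x v w /rO; exact: torsion0.
- by move=> x v /rO; exact: unity1.
- by move=> x bx; rewrite unitmxE unitfE; exact: hr.
- exact: ccls_sub cmu.
- by move=> x /rO; exact: spec.
- by move=> x g /rO Ox; rewrite -cdf_mu_X //; exact: (cder_cls oO (X g x) cmu Ox).
- by move=> x /rO; exact: hre.
Qed.

End Adapted.

(** * Coordinates as truncated polynomials *)

Section Coordinates.
Variables (R : realType) (cat : category) (n : nat).
Notation V := 'cV[R]_n.+1.
Local Notation C := R[i].
Variables (L : V -> 'M[R]_n.+1) (E : V -> V) (s : nat) (mu : V -> C) (re : bool).
Local Notation X := (Xf L E).
Local Notation adapted := (adapted cat L E s mu re).
Variables (x0 : V) (T : V -> 'M[R]_n.+1) (E1 : V).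
Variables (a : nat -> 'I_n.+1 -> C) (b : 'I_n.+1 -> C) (m : 'I_n.+1 -> nat).

(* theta j v is the coefficient of t^j in the truncated polynomial attached to
   the column v, so that in the coordinates u of the theorem T u acts as the
   multiplication by theta u + mu_0 + t modulo t^s. *)
Definition theta (j : nat) (v : V) : C := \sum_k (v k 0)%:C%C * a j k.
(** Coordinate k is the real or the imaginary part of the coefficient [m k]: the factor [b k] is 1
    or - i, and Re (- i z) = Im z. *)
Definition theta_inv (z : nat -> C) : V := \col_k Re (b k * z (m k)).
(** The coefficients of U at the base point; subtracting them centres the coordinates. *)
Definition shift0 (j : nat) : C := ((mu x0)%:P + 'X)`_j.

Hypothesis theta_T : forall u w j, (j < s)%N ->
  theta j (T u *m w) = \sum_(i < j.+1) (theta i u + shift0 i) * theta (j - i)%N w.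
Hypothesis theta_E1 : forall j, (j < s)%N -> theta j E1 = (j == 0%N)%:R.
Hypothesis theta_inj : forall v, (forall j, (j < s)%N -> theta j v = 0) -> v = 0.
Hypothesis theta_invK : forall z, (re -> forall j, Im (z j) = 0) ->
  forall j, (j < s)%N -> theta j (theta_inv z) = z j.
Hypothesis s0 : (0 < s)%N.

Definition straightens (W : set V) (phi : V -> V) : Prop :=
  mcls cat W phi /\ forall x, W x -> dmx phi x (E x) = E1 /\
    forall v, T (phi x) *m dmx phi x v = dmx phi x (L x *m v).

Lemma thetaD j v w : theta j (v + w) = theta j v + theta j w.
Proof.
by rewrite /theta -big_split; apply: eq_bigr => k _; rewrite mxE rmorphD mulrDl.
Qed.

Lemma thetaZ j (c : R) v : theta j (c *: v) = c%:C%C * theta j v.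
Proof.
by rewrite /theta mulr_sumr; apply: eq_bigr => k _; rewrite mxE rmorphM mulrA.
Qed.

Lemma thetaB j v w : theta j (v - w) = theta j v - theta j w.
Proof. by rewrite thetaD -scaleN1r thetaZ rmorphN rmorph1 mulN1r. Qed.

Lemma theta_eq v w : (forall j, (j < s)%N -> theta j v = theta j w) -> v = w.
Proof.
move=> h; apply: subr0_eq; apply: theta_inj => j js.
by rewrite thetaB h // subrr.
Qed.

Lemma theta_der j (x v : V) (phi : V -> V) D : mder x v phi D -> cder x v (fun y => theta j (phi y)) (theta j D).
Proof.
move=> dphi; apply: cder_sum => k.
have d : cder x v (fun y => (phi y k 0)%:C%C) (D k 0)%:C%C.
  by split; [exact: dphi|exact: (iderc (0 : R) x v)].
by have := cder_mul d (cder_cst x v (a j k)); rewrite mulr0 addr0.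
Qed.

Lemma theta_cls j (W : set V) phi : open W -> mcls cat W phi ->
  ccls cat W (fun y => theta j (phi y)).
Proof.
move=> oW cphi; apply: ccls_sum => // k; apply: ccls_mul => //; last exact: ccls_cst.
by split; [exact: cphi|apply: cls_cst].
Qed.

Lemma theta_inv_cls (W : set V) (z : nat -> V -> C) : open W -> (forall j, ccls cat W (z j)) ->
  mcls cat W (fun x => theta_inv (fun j => z j x)).
Proof.
move=> oW cz k l; under eq_fun do rewrite mxE.
by case: (ccls_mul oW (ccls_cst cat oW (b k)) (cz (m k))).
Qed.

Lemma normal_coordinates Om : adapted Om -> Om x0 ->
  exists W phi, [/\ open W, W x0 /\ W `<=` Om, phi x0 = 0, jac phi x0 \in unitmx &
    straightens W phi].
Proof.
move=> aO O0; have [r [r0 rO] [P [Pj P0 Pc Pd [Pi Pr]]]] := flow_jet_exists s0 aO O0.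
have oB : open (ball x0 r : set V) by exact: ball_opencv.
have bx0 : ball x0 r x0 by exact: ballxx.
pose phi x := theta_inv (fun j => (P x)`_j - shift0 j).
have phiE x j : ball x0 r x -> (j < s)%N -> theta j (phi x) = (P x)`_j - shift0 j.
  move=> bx js; apply: (theta_invK _ js) => hre i.
  rewrite ImD ImN Pr // sub0r /shift0 coefD coefC coefX ImD.
  have := ad_re aO O0; rewrite hre => hm.
  by case: i => [|[|i]] /=; rewrite ?hm ?addr0 ?add0r ?oppr0.
have cphi : mcls cat (ball x0 r) phi.
  apply: theta_inv_cls => // j; apply: ccls_add => //; exact: ccls_cst.
have dphi x g j : ball x0 r x -> (j < s)%N -> theta j (dmx phi x (X g x)) = (cx g \Po P x)`_j.
  move=> bx js; have d1 := theta_der j (mder_cls oB (X g x) cphi bx).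
  apply: (cder_uniq d1); apply: (@cder_open _ _ _ _ _ (fun y => (P y)`_j - shift0 j) _ _ oB bx).
    by move=> y by_; rewrite phiE.
  by rewrite -[_`_j]subr0; apply: cder_sub; [exact: Pd|exact: cder_cst].
exists (ball x0 r), phi; split=> //.
- apply: theta_inj => j js; rewrite phiE // Pi // subrr //.
- apply/negPn/negP => nu.
  have [v v0 jv] : exists2 v : V, v != 0 & jac phi x0 *m v = 0.
    move: nu; rewrite -unitmx_tr -row_free_unit -kermx_eq0 => /rowV0Pn [w wk w0].
    exists w^T; first by rewrite trmx_eq0.
    by apply: trmx_inj; rewrite trmx_mul trmxK trmx0; apply/sub_kermxP.
  (* If the Jacobian kills X_g, then g(mu_0 + t) = 0 modulo t^s, so g has a root of order s at mu_0
     and X_g vanishes. *)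
  move/eqP: v0; apply; rewrite -(reprK v aO O0); apply/(Xf_eq0 _ aO O0).
  apply: comp_kill_conv => i si.
  have [|h _] := @comp_agree _ (cx (repr L E x0 v)) (P x0) ((mu x0)%:P + 'X) s s0.
    by move=> l ls; rewrite Pi.
  rewrite -h // -dphi // (reprK v aO O0) dmx_jac jv.
  by rewrite -(scale0r (0 : V)) thetaZ mul0r.
- split=> // x bx; have Ox := rO x bx; split.
    apply: theta_eq => j js; rewrite theta_E1 // -(Xf1 L E) dphi //.
    by rewrite /cx rmorph1 -[1]/(1%:P) comp_polyC coefC; case: eqP.
  move=> v; rewrite -(reprK v aO Ox); set g := repr _ _ _ _.
  rewrite -XfMX; apply: theta_eq => j js; rewrite theta_T // dphi //.
  rewrite cxM /cx map_polyX comp_polyM comp_polyX mulrC coefM; apply: eq_bigr => i _.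
  have ij : (i < s)%N by apply: leq_ltn_trans js; rewrite -ltnS.
  by rewrite phiE // subrK dphi // (leq_ltn_trans _ js) ?leq_subr.
Qed.

Definition jet (phi : V -> V) (x : V) : {poly C} :=
  \poly_(j < s) (theta j (phi x) + shift0 j).

(** Through [theta], the image of L under phi acts as multiplication by the jet and the image of E
    is 1; hence the image of g(L) E is g of the jet. *)
Lemma jet_der Om W phi x g j : adapted Om -> open W -> W `<=` Om -> straightens W phi ->
  W x -> (j < s)%N -> cder x (X g x) (fun y => (jet phi y)`_j) ((cx g \Po jet phi x)`_j).
Proof.
move=> aO oW WO [cphi hphi] Wx js; have [hE hT] := hphi x Wx.
have key g' i : (i < s)%N -> theta i (dmx phi x (X g' x)) = (cx g' \Po jet phi x)`_i.
  elim/poly_ind: g' i => [|g' c IH] i si.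
    by rewrite Xf0 dmx0 /cx rmorph0 comp_poly0 coef0 -(scale0r (0 : V)) thetaZ mul0r.
  rewrite Xf_cons dmxD dmxZ thetaD thetaZ hE theta_E1 // -hT theta_T //.
  rewrite cx_cons comp_poly_MXaddC coefD coefC mulrC; congr (_ + _); last first.
    by case: i {si} => [|i] /=; rewrite ?mul1r ?mul0r.
  rewrite mulrC coefM; apply: eq_bigr => k _.
  have ik : (k < s)%N by apply: leq_ltn_trans si; rewrite -ltnS.
  by rewrite coef_poly ik IH // (leq_ltn_trans _ si) ?leq_subr.
rewrite -key //; have d := theta_der j (mder_cls oW (X g x) cphi Wx).
under eq_fun do rewrite coef_poly js.
by rewrite -[X in cder _ _ _ X]addr0; apply: cder_add; [exact: d|exact: cder_cst].
Qed.

Lemma jet_cls W phi j : open W -> mcls cat W phi -> ccls cat W (fun y => (jet phi y)`_j).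
Proof.
move=> oW cphi; under eq_fun do rewrite coef_poly.
case: ltnP => _; last exact: ccls_cst.
by apply: ccls_add => //; [exact: theta_cls|exact: ccls_cst].
Qed.

Lemma jet_x0 phi : phi x0 = 0 -> forall j, (j < s)%N -> (jet phi x0)`_j = shift0 j.
Proof.
by move=> p0 j js; rewrite coef_poly js p0 -(scale0r (0 : V)) thetaZ mul0r add0r.
Qed.

(** For the characteristic polynomial chi one has X_chi = 0, so the equation for the jet makes its
    constant term a root of chi, that is, mu or its conjugate. *)
Lemma jet_eigenvalue Om W phi : adapted Om -> open W -> W x0 -> W `<=` Om -> straightens W phi ->
  phi x0 = 0 -> exists2 r : R, 0 < r /\ ball x0 r `<=` W &
    forall x, ball x0 r x -> (jet phi x)`_0 = mu x.
Proof.
move=> aO oW W0 WO hphi p0.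
have root_mu x : W x -> (jet phi x)`_0 = mu x \/ (jet phi x)`_0 = ((mu x)^*)%C.
  move=> Wx; have Ox := WO x Wx; have [_ + _] := ad_spec aO Ox; apply.
  have := jet_der (char_poly (L x)) aO oW WO hphi Wx s0.
  rewrite Xf_char ?dvdpp // comp_coef0 => h; apply/eqP/esym; apply: (cder_uniq _ h).
  have cj := jet_cls 0 oW hphi.1.
  have c0 : cdf (fun y => (jet phi y)`_0) x 0 = 0 by rewrite -(scale0r (0 : V)) cdfZ mul0r.
  by have := cder_cls oW (0 : V) cj Wx; rewrite c0.
have [hre|hre] := boolP re.
  have [r r0 rW] := open_ballcv oW W0; exists r => // x /rW Wx.
  have := ad_re aO (WO x Wx); rewrite hre => Im0.
  case: (root_mu x Wx) => // ->; apply: ReIm_eq; rewrite ?cRe_conj // cIm_conj Im0 oppr0 //.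
have Im0 x : W x -> Im (mu x) != 0.
  by move=> Wx; have := ad_re aO (WO x Wx); rewrite (negbTE hre).
have [_ cI] := ccls_add oW (jet_cls 0 oW hphi.1) (ccls_sub oW WO (ad_mu aO)).
(* The sum of the constant term and mu has imaginary part 2 Im mu at x0; it would be 0 wherever the
   constant term is the conjugate of mu. *)
have [|r [r0 rW] hr] := cls_neq0_near oW cI W0.
  rewrite jet_x0 // /shift0 coefD coefC coefX addr0 ImD.
  have := Im0 x0 W0; apply: contraNneq => h; apply/eqP; lra.
exists r => // x bx; case: (root_mu x (rW x bx)) => // e.
by have := hr x bx; rewrite e ImD cIm_conj addNr eqxx.
Qed.

Lemma cder0_cst Om r z : adapted Om -> ball x0 r `<=` Om -> ccls cat (ball x0 r) z ->
  (forall x g, ball x0 r x -> cder x (X g x) z 0) -> forall x, ball x0 r x -> z x = z x0.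
Proof.
move=> aO rO cz dz x bx; have r0 := ball_gt0r bx.
have der0 y v : ball x0 r y -> cder y v z 0.
  by move=> by_; rewrite -(reprK v aO (rO y by_)); exact: dz.
have cst0 (f : V -> R) : (forall y v, ball x0 r y -> is_derive y v f 0) -> f x = f x0.
  move=> df; have [] := @MVT_dir _ _ f x0 (x - x0) (fun=> 0).
    move=> t t01; apply: df; apply: ball_seg => //; first exact: ballxx.
    by rewrite addrC subrK.
  by move=> t _; rewrite [x0 + _]addrC subrK => /subr0_eq.
apply: ReIm_eq.
  by apply: (cst0 (fun y => Re (z y))) => y v by_; case: (der0 y v by_).
by apply: (cst0 (fun y => Im (z y))) => y v by_; case: (der0 y v by_).
Qed.

Lemma straightens_unique Om W phi psi : adapted Om -> open W -> W x0 -> W `<=` Om ->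
  straightens W phi -> straightens W psi -> phi x0 = 0 -> psi x0 = 0 ->
  exists2 r : R, 0 < r & forall x, ball x0 r x -> phi x = psi x.
Proof.
move=> aO oW W0 WO hp hq p0 q0.
have [r1 [r10 r1W] P1] := jet_eigenvalue aO oW W0 WO hp p0.
have [r2 [r20 r2W] P2] := jet_eigenvalue aO oW W0 WO hq q0.
have O0 := WO x0 W0.
have [r3 [r30 [v [w [cw wv dw]]]]] : exists r : R, [/\ 0 < r & exists v w : V -> C,
   [/\ ccls cat (ball x0 r) w, (1 < s)%N -> forall x, w x * v x = 1 &
     (1 < s)%N -> forall x g, ball x0 r x -> cder x (X g x) w (- (cx g^`()).[mu x] * w x)]].
  have [s1|s1] := leqP s 1.
    (* For s = 1 only the constant terms are compared, and v, w are placeholders. *)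
    by exists 1; split=> //; exists (fun=> 0), (fun=> 0); split=> //; apply: ccls_cst; exact: ball_opencv.
  have [r [r0 _] [v [w [_ [_ cw] wv dvw _]]]] := exp_solution s1 aO O0.
  by exists r; split=> //; exists v, w; split=> // _ x g bx; case: (dvw x g bx).
pose r := Order.min r1 (Order.min r2 r3).
have r0 : 0 < r by rewrite !lt_min r10 r20 r30.
have b1 : (ball x0 r : set V) `<=` ball x0 r1 by apply: ball_le_sub; rewrite ge_min lexx.
have b2 : (ball x0 r : set V) `<=` ball x0 r2 by apply: ball_le_sub; rewrite !ge_min lexx orbT.
have b3 : (ball x0 r : set V) `<=` ball x0 r3 by apply: ball_le_sub; rewrite !ge_min lexx !orbT.
have bW : (ball x0 r : set V) `<=` W by apply: subset_trans r1W.
have oB : open (ball x0 r : set V) by exact: ball_opencv.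
have eq_jet j : (j < s)%N -> forall x, ball x0 r x -> (jet phi x)`_j = (jet psi x)`_j.
  elim/ltn_ind: j => -[_ _ x bx|j IH js x bx].
    by rewrite P1 ?P2 //; [exact: b2|exact: b1].
  have s1 : (1 < s)%N by exact: leq_trans js.
  pose z y := ((jet phi y)`_j.+1 - (jet psi y)`_j.+1) * w y.
  have cz : ccls cat (ball x0 r) z.
    apply: ccls_mul => //; last by apply: ccls_sub cw.
    apply: ccls_add => //.
      by apply: (ccls_sub oB bW); apply: jet_cls => //; case: hp.
    by apply: ccls_opp => //; apply: (ccls_sub oB bW); apply: jet_cls => //; case: hq.
  have dz y g : ball x0 r y -> cder y (X g y) z 0.
    move=> by_; have Wy := bW y by_.
    have d := cder_mul (cder_sub (jet_der g aO oW WO hp Wy js) (jet_der g aO oW WO hq Wy js)) (dw s1 y g (b3 y by_)).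
    have [|_ h] := @comp_agree _ (cx g) (jet phi y) (jet psi y) j.+1 isT.
      by move=> i ij; apply: IH => //; exact: ltn_trans js.
    move: d; rewrite h P2 ?cx_deriv; last exact: b2.
    by rewrite [X in cder _ _ _ X](_ : _ = 0) //; ring.
  have := cder0_cst aO (subset_trans bW WO) cz dz bx.
  rewrite /z (jet_x0 p0 js) (jet_x0 q0 js) subrr mul0r => /eqP; rewrite mulf_eq0 subr_eq0 => /orP[/eqP //|/eqP w0].
  by have := wv s1 x; rewrite w0 mul0r => /eqP; rewrite eq_sym oner_eq0.
exists r => // x bx; apply: theta_eq => j js.
by have := eq_jet j js x bx; rewrite !coef_poly js => /addIr.
Qed.

End Coordinates.

(** * Toeplitz matrices as multiplication operators *)

Section ToeplitzForms.
Variable R : realType.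
Local Notation C := R[i].

Lemma nth_coordE n (u : 'cV[R]_n) (k : 'I_n) : nth_coord u k = u k 0.
Proof. by rewrite /nth_coord valK. Qed.

Lemma nth_coord_lt n (u : 'cV[R]_n) j (jn : (j < n)%N) : nth_coord u j = u (Ordinal jn) 0.
Proof. by rewrite -(nth_coordE u (Ordinal jn)). Qed.

Lemma nth_coord_ge n (u : 'cV[R]_n) j : (n <= j)%N -> nth_coord u j = 0.
Proof. by move=> nj; rewrite /nth_coord insubF // ltnNge nj. Qed.

Definition real_coef n (j : nat) (k : 'I_n) : C := (k == j :> nat)%:R.

Lemma theta_real n j (v : 'cV[R]_n.+1) : theta (@real_coef n.+1) j v = (nth_coord v j)%:C%C.
Proof.
rewrite /theta /real_coef; case: (ltnP j n.+1) => jn; last first.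
  rewrite nth_coord_ge // big1 // => k _.
  by rewrite ltn_eqF ?mulr0 // (leq_trans (ltn_ord k)).
rewrite (bigD1 (Ordinal jn)) //= eqxx mulr1 big1 ?addr0 ?nth_coord_lt // => k kj.
by rewrite (_ : (k == j :> nat) = false) ?mulr0 //; apply/negbTE.
Qed.

Lemma toeplitz_entryE n (l0 : R) (u : 'cV[R]_n.+1) i :
  (toeplitz_entry l0 u i)%:C%C = theta (@real_coef n.+1) i u + (l0%:C%C%:P + 'X)`_i.
Proof.
rewrite theta_real coefD coefC coefX; case: i => [|[|i]] /=.
- by rewrite addr0 rmorphD.
- by rewrite add0r rmorphD rmorph1.
- by rewrite !addr0.
Qed.

Lemma theta_toeplitz n (l0 : R) (u w : 'cV[R]_n.+1) j : (j < n.+1)%N ->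
  theta (@real_coef n.+1) j (toeplitz_form l0 u *m w) =
  \sum_(i < j.+1) (theta (@real_coef n.+1) i u + (l0%:C%C%:P + 'X)`_i) * theta (@real_coef n.+1) (j - i)%N w.
Proof.
move=> jn; rewrite theta_real nth_coord_lt mxE rmorph_sum.
under [RHS]eq_bigr do rewrite -toeplitz_entryE theta_real.
pose F k := (if (j < k)%N then 0 else toeplitz_entry l0 u (j - k))%:C%C * (nth_coord w k)%:C%C.
rewrite (eq_bigr (fun k : 'I_n.+1 => F k)); last first.
  by move=> k _; rewrite /F mxE /= nth_coordE rmorphM.
rewrite (bigID (fun k : 'I_n.+1 => (k < j.+1)%N)) /= [X in _ + X]big1 ?addr0; last first.
  by move=> k; rewrite -ltnNge ltnS => jk; rewrite /F jk mul0r.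
rewrite -(big_ord_widen _ F) // (reindex_inj rev_ord_inj) /=; apply: eq_bigr => k _.
have kj : (k <= j)%N by rewrite -ltnS.
by rewrite /F subSS ltnNge leq_subr subKn.
Qed.

Lemma half_doubleS k : (k.*2.+1)./2 = k.
Proof. by rewrite /= uphalf_double. Qed.

Lemma sum_pairs (G : nmodType) n s (F : nat -> G) : n = (2 * s)%N ->
  \sum_(k < n) F k = \sum_(i < s) (F i.*2 + F i.*2.+1).
Proof.
move=> ->; elim: s => [|s IH]; first by rewrite !big_ord0.
by rewrite mulnS addnC addn2 !big_ord_recr /= IH mul2n addrA.
Qed.

Definition complex_coef n (j : nat) (k : 'I_n) : C :=
  if k == j.*2 :> nat then 1 else if k == j.*2.+1 :> nat then 'i%C else 0.

Lemma theta_complex n s j (v : 'cV[R]_n.+1) : n.+1 = (2 * s)%N -> (j < s)%N ->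
  theta (@complex_coef n.+1) j v = (nth_coord v j.*2 +i* nth_coord v j.*2.+1)%C.
Proof.
move=> ns js; rewrite /theta /complex_coef.
pose F k := (nth_coord v k)%:C%C * (if k == j.*2 then 1 else if k == j.*2.+1 then 'i%C else 0).
rewrite (eq_bigr (fun k : 'I_n.+1 => F k)); last by move=> k _; rewrite /F nth_coordE.
rewrite (sum_pairs F ns) (bigD1 (Ordinal js)) //= big1 ?addr0; last first.
  move=> i ij; have {}ij : (i == j :> nat) = false by apply/negbTE.
  rewrite /F !eqSS -!muln2 eqn_pmul2r // ij.
  rewrite (_ : (_ == _) = false); last by apply/negP => /eqP; lia.
  rewrite (_ : (_ == _) = false); last by apply/negP => /eqP; lia.
  by rewrite !mulr0 addr0.
rewrite /F eqxx (_ : (j.*2.+1 == j.*2) = false); last by rewrite gtn_eqF.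
by rewrite eqxx mulr1; apply: ReIm_eq; rewrite ?ReD ?ImD ?cReM ?cImM /=; ring.
Qed.

Lemma block_entryE n s (a0 b0 : R) (u : 'cV[R]_n.+1) i : n.+1 = (2 * s)%N -> (i < s)%N ->
  let z := theta (@complex_coef n.+1) i u + ((a0 +i* b0)%C%:P + 'X)`_i in
  block_toeplitz_entry a0 b0 u i = conformal_mx (Re z) (Im z).
Proof.
move=> ns si /=; rewrite (theta_complex u ns si) ReD ImD coefD coefC coefX ReD ImD.
by case: i si => [|[|i]] si; apply/matrixP => p q; rewrite !mxE /=;
  case: (p == q); case: (p == 0) => /=; ring.
Qed.

(** A conformal block acts on a pair (x, y) as a complex number acts on x + iy, so the block
    Toeplitz matrix is multiplication in C[t] modulo t^s. *)
Lemma theta_block n s (a0 b0 : R) (u w : 'cV[R]_n.+1) j : n.+1 = (2 * s)%N -> (j < s)%N ->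
  theta (@complex_coef n.+1) j (block_toeplitz_form a0 b0 u *m w) =
  \sum_(i < j.+1) (theta (@complex_coef n.+1) i u + ((a0 +i* b0)%C%:P + 'X)`_i) *
    theta (@complex_coef n.+1) (j - i)%N w.
Proof.
move=> ns js; rewrite (theta_complex _ ns js).
pose z i := theta (@complex_coef n.+1) i u + ((a0 +i* b0)%C%:P + 'X)`_i.
have row p : (p < 2)%N -> nth_coord (block_toeplitz_form a0 b0 u *m w) (j.*2 + p) =
    \sum_(i < j.+1) (conformal_mx (Re (z (j - i)%N)) (Im (z (j - i)%N)) (inord p) 0 * nth_coord w i.*2 +
       conformal_mx (Re (z (j - i)%N)) (Im (z (j - i)%N)) (inord p) 1 * nth_coord w i.*2.+1).
  move=> p2; have jp : (j.*2 + p < n.+1)%N by rewrite ns -mul2n; lia.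
  rewrite nth_coord_lt mxE.
  have h2 : (j.*2 + p)./2 = j by lia.
  have hm : ((j.*2 + p) %% 2)%N = p by lia.
  pose F k := (if (j < k./2)%N then 0 else block_toeplitz_entry a0 b0 u (j - k./2) (inord p) (inord (k %% 2))) * nth_coord w k.
  rewrite (eq_bigr (fun k : 'I_n.+1 => F k)); last first.
    by move=> k _; rewrite /F nth_coordE mxE /= h2 hm.
  rewrite (sum_pairs F ns) (bigID (fun k : 'I_s => (k < j.+1)%N)) /= [X in _ + X]big1 ?addr0; last first.
    move=> k; rewrite -ltnNge ltnS => jk.
    by rewrite /F doubleK half_doubleS jk !mul0r addr0.
  rewrite -(big_ord_widen _ (fun i => F i.*2 + F i.*2.+1)) //; apply: eq_bigr => i _.
  have ij : (i <= j)%N by rewrite -ltnS.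
  rewrite /F doubleK half_doubleS ltnNge ij /=.
  have jis : (j - i < s)%N by apply: leq_ltn_trans js; exact: leq_subr.
  rewrite (block_entryE a0 b0 u ns jis) -/(z _).
  have -> : (i.*2 %% 2)%N = 0%N by lia.
  have -> : (i.*2.+1 %% 2)%N = 1%N by lia.
  by congr (_ * _ + _ * _); congr (conformal_mx _ _ _ _); apply: val_inj; rewrite /= inordK.
have r0 := row 0%N isT; have r1 := row 1%N isT; rewrite addn0 in r0; rewrite addn1 in r1.
rewrite r0 r1.
have i0 : inord 0 = 0 :> 'I_2 by apply: val_inj; rewrite /= inordK.
have i1 : inord 1 = 1 :> 'I_2 by apply: val_inj; rewrite /= inordK.
have jis (i : 'I_j.+1) : (j - i < s)%N by apply: leq_ltn_trans js; exact: leq_subr.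
have ij (i : 'I_j.+1) : (i <= j)%N by rewrite -ltnS.
apply: ReIm_eq; rewrite ?Re_sum ?Im_sum [LHS]/= (reindex_inj rev_ord_inj) /=; apply: eq_bigr => i _.
  rewrite subSS subKn // -/(z i) i0 (theta_complex w ns (jis i)) cReM !mxE /=.
  ring.
rewrite subSS subKn // -/(z i) i1 (theta_complex w ns (jis i)) cImM !mxE /=.
ring.
Qed.

End ToeplitzForms.

(** * Normal forms on the manifold *)

Section Germ.
Variables (R : realType) (cat : category) (n : nat) (M : manifold R cat n.+1).
Notation V := 'cV[R]_n.+1.
Local Notation C := R[i].
Variables (L : ofamily M) (e : vfamily M) (hLe : nijenhuis_with_unity L e).
Variables (p : M) (c : chart R n.+1 M) (hc : charts c) (dp : dom c p).

Let x0 : V := coord c p.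
Let Lc (x : V) := L c (param c x).
Let Ec (x : V) := e c (param c x).
Let E1 : V := \col_i (i == 0 :> nat)%:R.

Variables (s : nat) (mu : V -> C) (re : bool) (T : V -> 'M[R]_n.+1).
Variables (a : nat -> 'I_n.+1 -> C) (b : 'I_n.+1 -> C) (m : 'I_n.+1 -> nat).
Hypothesis theta_T : forall u w j, (j < s)%N ->
  theta a j (T u *m w) = \sum_(i < j.+1) (theta a i u + shift0 mu x0 i) * theta a (j - i)%N w.
Hypothesis theta_E1 : forall j, (j < s)%N -> theta a j E1 = (j == 0%N)%:R.
Hypothesis theta_inj : forall v, (forall j, (j < s)%N -> theta a j v = 0) -> v = 0.
Hypothesis theta_invK : forall z, (re -> forall j, Im (z j) = 0) ->
  forall j, (j < s)%N -> theta a j (theta_inv b m z) = z j.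
Hypothesis s0 : (0 < s)%N.
Variable Om : set V.
Hypotheses (oO : open Om) (O0 : Om x0) (OO : Om `<=` coord c @` dom c).
Hypothesis cmu : ccls cat Om mu.
Hypothesis spec : forall x, Om x -> spectral s (Lc x) (mu x).
Hypothesis hre : forall x, Om x -> if re then Im (mu x) = 0 else Im (mu x) != 0.
Hypothesis hreg : gl_regular (L c p).

Lemma normalizing_straightens u : normalizes L e p T u ->
  [/\ open (image c (dom u)), image c (dom u) x0, transition c u x0 = 0 &
   straightens cat Lc Ec T E1 (image c (dom u)) (transition c u)].
Proof.
move=> [hu du u0 hn]; have [_ _ pK _ _] := hc.1.
have oI : open (image c (dom u)) by apply: open_image; [case: hc|apply: open_dom; case: hu].
split=> //; first by exists p.
  by rewrite /x0 (transitionE _ hc.1 dp).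
split; first exact: transition_cls.
move=> _ [q [dq uq] <-]; have [eu Lu] := hn q uq.
have [he _] := hLe.2; have [hL _] := hLe.1.
have ch v : dmx (transition c u) (coord c q) v = change_of_components c u q v.
  by rewrite changeE.
rewrite /Ec /Lc pK // ch; split.
  by rewrite -((he c hc).2 u hu q dq uq I) eu.
move=> v; rewrite !ch (transitionE _ hc.1 dq) -Lu.
exact: (hL c hc).2.
Qed.

Lemma germ_exists_unique : exists_unique_germ p (normalizes L e p T).
Proof.
have [_ _ pK cc _] := hc.1.
have [sg js us] := hreg.
have LcE : Lc x0 = L c p by rewrite /Lc /x0 pK.
have [W [W0 WO aW]] : exists W, [/\ W x0, W `<=` Om & adapted cat Lc Ec s mu re W].
  apply: (@adapted_near _ cat _ Lc Ec s mu re Om _ _ _ _ _ _ _ _ x0 sg) => //.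
  - exact: mcls_sub (Lc_cls hc hLe).
  - exact: mcls_sub (Ec_cls hc hLe).
  - by move=> x v w Ox; exact: (torsion_chart hc hLe v w (OO Ox)).
  - by move=> x v Ox; exact: (unity_chart hc hLe v (OO Ox)).
  - by rewrite LcE.
split.
  have [W1 [phi [oW1 [W10 W1W] phi0 jphi sphi]]] :=
    normal_coordinates theta_T theta_E1 theta_inj theta_invK s0 aW W0.
  have [W2 [psi [[oW2 W20] W2W1 oI psiK cpsi]]] :=
    inverse_function oW1 W10 (fun i => sphi.1 i 0) jphi.
  have cphi2 : mcls cat W2 phi by apply: mcls_sub sphi.1.
  have cpsi2 : mcls cat (phi @` W2) psi by move=> i j; rewrite (ord1 j).
  have W2D : W2 `<=` coord c @` dom c.
    by move=> x /W2W1 /W1W /WO /OO.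
  pose u := new_chart c W2 phi psi.
  have hu : charts u by apply: new_chart_charts.
  exists u; split=> //.
  move=> q dq; have [dcq Wq] := dq; have [dE dT] := sphi.2 _ (W2W1 _ Wq).
  have ch v : change_of_components c u q v = dmx phi (coord c q) v.
    by apply: (@new_chart_change _ _ _ _ c hc W2).
  have [he _] := hLe.2; have [hL _] := hLe.1; split.
    rewrite ((he c hc).2 u hu q dcq dq I) ch.
    by move: dE; rewrite /Ec pK.
  (* The transformation rule describes L in the new chart only on the image of dphi; the chain rule
     for psi o phi shows that this image is everything. *)
  have surj w : exists v, w = dmx phi (coord c q) v.
    pose J := jac phi (coord c q); pose K := jac psi (phi (coord c q)).
    have KJ : K *m J = 1%:M.
      apply/matrixP => i j.
      have d1 : mder (coord c q) (delta_mx j 0) (psi \o phi) (dmx psi (phi (coord c q)) (dmx phi (coord c q) (delta_mx j 0))).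
        by apply: (@dmx_comp _ _ cat _ _ _ W2 (phi @` W2)) => // y Wy; exists y.
      have d2 : mder (coord c q) (delta_mx j 0) (psi \o phi) (delta_mx j 0).
        apply: (@mder_near _ _ _ _ id).
          by apply: filterS (open_nbhs_mem oW2 Wq) => y Wy; rewrite /= psiK.
        by move=> k l; rewrite (ord1 l); exact: ider_coord.
      have := mder_uniq d1 d2; rewrite !dmx_jac mulmxA -colE => /matrixP /(_ i 0).
      by rewrite !mxE eqxx andbT.
    by exists (K *m w); rewrite dmx_jac mulmxA (mulmx1C KJ) mul1mx.
  have key (w : V) : L u q *m w = T (phi (coord c q)) *m w.
    have [v ->] := surj w; rewrite dT -!ch ((hL c hc).2 u hu q dcq dq).
    by rewrite /Lc pK.
  apply/matrixP => i j; have := congr1 (fun w : V => w i 0) (key (delta_mx j 0)).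
  by rewrite -!colE !mxE.
move=> u u' hu hu'.
have [oU mU zU [cU sU]] := normalizing_straightens hu.
have [oU' mU' zU' [cU' sU']] := normalizing_straightens hu'.
pose W' := W `&` (image c (dom u) `&` image c (dom u')).
have oW' : open W' by apply: openI; [exact: ad_open aW|exact: openI].
have W'0 : W' x0 by [].
have [|||r r0 hr] := straightens_unique (a := a) (phi := transition c u) (psi := transition c u')
  theta_T theta_E1 theta_inj s0 aW oW' W'0 _ _ _ zU zU'.
- by move=> x [].
- by split=> [|x [_ [h _]]]; [apply: mcls_sub cU => // x [_ []]|exact: sU].
- by split=> [|x [_ [_ h]]]; [apply: mcls_sub cU' => // x [_ []]|exact: sU'].
have nb : nbhs p (coord c @^-1` ball x0 r).
  by apply: (cc p dp); apply: nbhsx_ballx.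
apply: filterS2 (open_nbhs_mem (open_dom hc.1) dp) nb => q dq bq.
by rewrite -(transitionE u hc.1 dq) -(transitionE u' hc.1 dq); exact: hr.
Qed.

End Germ.

Lemma chart_at (R : realType) (cat : category) (n : nat) (M : manifold R cat n) (p : M) :
  exists2 c : chart R n M, charts c & dom c p.
Proof.
have [c ac dc] := atlas_cover p; exists c => //; split; first exact: atlas_chart.
by move=> c'; exact: atlas_compatible.
Qed.

Section NormalFormTheorem.
Variables (R : realType) (cat : category) (n : nat) (M : manifold R cat n.+1).
Notation V := 'cV[R]_n.+1.
Local Notation C := R[i].
Variables (L : ofamily M) (e : vfamily M) (hLe : nijenhuis_with_unity L e).
Hypothesis hreg : gl_regular_field L.
Variables (p : M) (hgen : algebraically_generic L p).

Variables (c : chart R n.+1 M) (hc : charts c) (dp : dom c p).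
Let x0 : V := coord c p.
Let Lc (x : V) := L c (param c x).

Lemma segre_near : exists sigma Om, [/\ open Om /\ Om x0, Om `<=` coord c @` dom c,
  segre (L c p) sigma & forall x, Om x -> segre (Lc x) sigma].
Proof.
have [sigma hs] := hgen; exists sigma.
pose S := [set q | holds_at L q (fun A => segre A sigma)].
have oA : open S^° by exact: open_interior.
have hA q : S^° q -> S q by exact: interior_subset.
exists (image c S^°); split.
- by split; [apply: open_image => //; case: hc|exists p].
- by move=> _ [q [dq _] <-]; exists q.
- by apply: (hA p hs).
- have [_ _ pK _ _] := hc.1.
  by move=> _ [q [dq Aq] <-]; rewrite /Lc pK //; apply: (hA q Aq).
Qed.

Lemma trace_cls Om : open Om -> Om `<=` coord c @` dom c ->
  cls cat Om (fun x => \tr (Lc x) : R) /\ cls cat Om (fun x => \tr (Lc x *m Lc x) : R).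
Proof.
move=> oO OO; have cL : mcls cat Om Lc by exact: mcls_sub (Lc_cls hc hLe).
split; first by apply: cls_sum => // i _; exact: cL.
by apply: cls_sum => // i _; exact: cls_mulmx.
Qed.

Lemma real_case l0 : holds_at L p (eigenvalues_are [:: l0%:C%C]) ->
  exists_unique_germ p (normalizes L e p (toeplitz_form l0)).
Proof.
move=> ev; have {}ev := ev c hc dp.
have [sigma [Om [[oO O0] OO sp sO]]] := segre_near.
(* The number of distinct eigenvalues at p bounds the length of sigma, hence their number at all
   nearby points. *)
have s1 := segre_size sp ev.
pose mu (x : V) : C := (\tr (Lc x) / n.+1%:R)%:C%C.
have LcE : Lc x0 = L c p by have [_ _ pK _ _] := hc.1; rewrite /Lc /x0 pK.
have spO x : Om x -> spectral n.+1 (Lc x) (mu x).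
  by move=> Ox; apply: (spectral_single (sO x Ox)).
have mu0 : mu x0 = l0%:C%C.
  have [_ rt _] := spO x0 O0.
  have : root (cx (char_poly (Lc x0))) l0%:C%C.
    by rewrite cx_char_poly -eigenvalue_root_char LcE ev inE.
  by move/rt => [->|->] //; rewrite /mu /= oppr0.
apply: (@germ_exists_unique _ _ _ _ _ _ hLe _ _ hc dp n.+1 mu true _
  (@real_coef R n.+1) (fun=> 1) (fun k => k) _ _ _ _ _ Om) => //.
- by move=> u w j js; rewrite /shift0 mu0; exact: theta_toeplitz.
- by move=> j js; rewrite theta_real nth_coord_lt mxE; case: eqP.
- move=> v hv; apply/matrixP => i j; rewrite (ord1 j) mxE -nth_coordE.
  by have := hv i (ltn_ord i); rewrite theta_real => /complexI.
- move=> z rz j js; rewrite theta_real nth_coord_lt mxE /= mul1r.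
  by apply: ReIm_eq => //=; rewrite rz.
- split; last by apply: cls_cst.
  apply: cls_mul => //; last exact: cls_cst.
  by have [] := trace_cls oO OO.
- exact: hreg.
Qed.

Lemma complex_case a0 b0 : b0 != 0 ->
  holds_at L p (eigenvalues_are [:: (a0 +i* b0)%C; (a0 -i* b0)%C]) ->
  (exists s : nat, n.+1 = (2 * s)%N) /\
  exists_unique_germ p (normalizes L e p (block_toeplitz_form a0 b0)).
Proof.
move=> b00 ev; have {}ev := ev c hc dp.
have [sigma [Om1 [[oO1 O10] OO1 sp sO]]] := segre_near.
have s2 : (size sigma <= 2)%N := segre_size sp ev.
have LcE : Lc x0 = L c p by have [_ _ pK _ _] := hc.1; rewrite /Lc /x0 pK.
have [disc0 mu0] := conj_trace_sqr sp b00 ev.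
pose mu (x : V) : C := conj_mu b0 (Lc x).
have muE : mu x0 = (a0 +i* b0)%C by rewrite /mu LcE.
(* Positive at p, hence nearby; there the eigenvalues stay nonreal and the square root in [conj_mu]
   is of the given class. *)
pose D x := (\tr (Lc x)) ^+ 2 - n.+1%:R * \tr (Lc x *m Lc x).
have [t1 t2] := trace_cls oO1 OO1.
have cD : cls cat Om1 (fun x => D x : R).
  apply: cls_sub_fun => //; first by apply: cls_mul.
  by apply: cls_mul => //; exact: cls_cst.
have [r r0 [rO Dr]] : exists2 r : R, 0 < r & ball x0 r `<=` Om1 /\ forall x, ball x0 r x -> 0 < D x.
  have D0 : 0 < D x0 by rewrite subr_gt0 LcE.
  have /continuous_forP /(_ (D x0 / 2)) [|d d0 hd] := cls_cont cD O10; first by rewrite divr_gt0.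
  have [r r0 rO] := open_ballcv oO1 O10.
  exists (Order.min r d); first by rewrite lt_min r0.
  split=> [|x bx]; first by apply: subset_trans rO; apply: ball_le_sub; rewrite ge_min lexx.
  have : `|D x - D x0| <= D x0 / 2 by apply: hd; apply: ball_le_sub bx; rewrite ge_min lexx orbT.
  by rewrite ler_distl => /andP[h _]; apply: lt_le_trans h; rewrite subr_gt0 ltr_pdivrMr // mulr2n mulrDr mulr1 ltrDl.
pose Om : set V := ball x0 r.
have oO : open Om by exact: ball_opencv.
have O0 : Om x0 by exact: ballxx.
have sc x : Om x -> exists2 s : nat, n.+1 = (2 * s)%N & spectral s (Lc x) (mu x).
  by move=> Ox; apply: (spectral_conj (sO x (rO x Ox)) s2 _ b00); rewrite -subr_gt0; exact: Dr.
have [s ns _] := sc x0 O0; split; first by exists s.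
have spO x : Om x -> spectral s (Lc x) (mu x).
  by move=> /sc [s' ns' h]; rewrite (_ : s = s') //; lia.
have n0 : (0 : R) < n.+1%:R by rewrite ltr0n.
have rt x : Om x -> 0 < (\tr (Lc x) / n.+1%:R) ^+ 2 - \tr (Lc x *m Lc x) / n.+1%:R.
  move=> Ox; rewrite (_ : _ - _ = D x / n.+1%:R ^+ 2); last by rewrite /D; field; rewrite gt_eqF.
  by rewrite divr_gt0 ?exprn_gt0 // Dr.
apply: (@germ_exists_unique _ _ _ _ _ _ hLe _ _ hc dp s mu false _
  (@complex_coef R n.+1) (fun k => if odd k then (- 'i)%C else 1) (fun k => k./2) _ _ _ _ _ Om) => //.
- by move=> u w j js; rewrite /shift0 muE; exact: (theta_block a0 b0 u w ns js).
- move=> j js; rewrite (theta_complex _ ns js).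
  rewrite !nth_coord_lt; [lia|lia|move=> j1 j2]; rewrite !mxE /=.
  by case: j {js j1 j2} => [|j].
- move=> v hv; apply/matrixP => i j; rewrite (ord1 j) mxE -nth_coordE.
  have i2 : (i./2 < s)%N by have := ltn_ord i; lia.
  have := hv _ i2; rewrite (theta_complex _ ns i2) => -[h1 h2].
  by rewrite -(odd_double_half i); case: (odd i); rewrite ?add0n ?add1n.
- move=> z _ j js; rewrite (theta_complex _ ns js).
  rewrite !nth_coord_lt; [lia|lia|move=> j1 j2]; rewrite !mxE /= odd_double doubleK uphalf_double /=.
  by rewrite mul1r; apply: ReIm_eq => //=; rewrite cReM /=; ring.
- by lia.
- by move=> x /rO /OO1.
- have ca : cls cat Om (fun x => \tr (Lc x) / n.+1%:R : R).
    by apply: cls_mul; [exact: oO|exact: cls_sub t1|exact: cls_cst].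
  split; first exact: ca.
  apply: cls_mul => //; first exact: cls_cst.
  apply: cls_sqrt => //; apply: cls_sub_fun => //; first by apply: cls_mul.
  by apply: cls_mul; [exact: oO|exact: cls_sub t2|exact: cls_cst].
- by move=> x Ox /=; rewrite mulf_neq0 ?sgr_eq0 // gt_eqF // sqrtr_gt0; exact: rt.
- exact: hreg.
Qed.

End NormalFormTheorem.

Unset Implicit Arguments.

Theorem theorem2p3 (R : realType) (cat : category) (n : nat)
    (M : manifold R cat n) (L : ofamily M) (e : vfamily M)
    (hLe : nijenhuis_with_unity L e) (hreg : gl_regular_field L)
    (p : M) (hgen : algebraically_generic L p) :
  (forall lambda0 : R,
     holds_at L p (eigenvalues_are [:: lambda0%:C%C]) ->
     exists_unique_germ p (normalizes L e p (toeplitz_form lambda0))) /\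
  (forall a0 b0 : R, b0 != 0 ->
     holds_at L p (eigenvalues_are [:: (a0 +i* b0)%C; (a0 -i* b0)%C]) ->
     (exists s : nat, n = (2 * s)%N) /\
     exists_unique_germ p (normalizes L e p (block_toeplitz_form a0 b0))).
Proof.
have [c hc dp] := chart_at p.
(* In dimension 0 there are no eigenvalues, so both assumptions on the spectrum fail. *)
have nil0 (l : seq R[i]) z : n = 0%N -> holds_at L p (eigenvalues_are (z :: l)) -> False.
  move=> n0 ev; have := ev c hc dp z; rewrite mem_head => /eigenvalueP [v _].
  by subst n; rewrite [v]thinmx0 eqxx.
case: n M L e hLe hreg p hgen c hc dp nil0 => [|n'] M' L' e' hLe' hreg' p' hgen' c hc dp nil0.
  by split=> [l0 /nil0 []|a0 b0 _ /nil0 []].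
split=> [l0 ev|a0 b0 b00 ev].
  exact: (real_case hLe' hreg' hgen' hc dp ev).
exact: (complex_case hLe' hreg' hgen' hc dp b00 ev).
Qed.
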